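(* Let $\Theta$ be a completely random measure on $\Psi$ with no deterministic component, with $K_{fix}$ fixed-location atoms, $K_{fix}<\infty$, the $k$th of which can be written $\theta_{fix,k}\delta_{\psi_{fix,k}}$, and with ordinary component having rate measure $\mu(d\theta\times d\psi)=\nu(d\theta)\cdot G(d\psi)$, where $G$ is a diffuse probability distribution on $\Psi$ and $\nu$ is a $\sigma$-finite measure on $\mathbb{R}_+$ with $\nu(\mathbb{R}_+)=\infty$. Write $\Theta=\sum_{k=1}^\infty\theta_k\delta_{\psi_k}$, and let $X_n$ be generated i.i.d. given $\Theta$ according to $X_n=\sum_{k=1}^\infty x_{n,k}\delta_{\psi_k}$, where the $x_{n,k}$ are independent and $x_{n,k}$ has probability mass function $h(\cdot\mid\theta_k)$ on $\{0,1,2,\dots\}$. Suppose $$\sum_{x=1}^\infty\int_{\theta\in\mathbb{R}_+}\nu(d\theta)\,h(x\mid\theta)<\infty.$$ Then we can write $$\Theta=\sum_{m=1}^\infty\sum_{x=1}^\infty\sum_{j=1}^{\rho_{m,x}}\theta_{m,x,j}\,\delta_{\psi_{m,x,j}},$$ where - $\psi_{m,x,j}\sim G$, i.i.d. across $m,x,j$; - $\rho_{m,x}\sim\mathrm{Poisson}\left(\int_{\theta}\nu(d\theta)\,h(0\mid\theta)^{m-1}h(x\mid\theta)\right)$, independently across $m,x$; - $\theta_{m,x,j}\sim F_{size,m,x}(d\theta)\propto\nu(d\theta)\,h(0\mid\theta)^{m-1}h(x\mid\theta)$, i.i.d. across $j$ and independently across $m,x$; and the families $(\psi_{m,x,j})$,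 $(\rho_{m,x})$, $(\theta_{m,x,j})$ are mutually independent.
   Context: $\Psi$ is a measurable space whose $\sigma$-algebra contains all singletons; $\mathbb{R}_+$ denotes the non-negative reals. A completely random measure (CRM) on $\Psi$ is a random measure taking independent values on disjoint measurable sets. A CRM with no deterministic component is an independent sum of a fixed-location component $\sum_k\theta_{fix,k}\delta_{\psi_{fix,k}}$ (deterministic distinct locations, independent non-negative random weights) and an ordinary component $\sum_k\theta_{ord,k}\delta_{\psi_{ord,k}}$, where $\{(\theta_{ord,k},\psi_{ord,k})\}$ are the points of a Poisson point process on $\mathbb{R}_+\times\Psi$ with rate (mean) measure $\mu$. $\Theta=\sum_k\theta_k\delta_{\psi_k}$ lists all fixed-location and ordinary atoms. For each $\theta$, $h(\cdot\mid\theta)$ is a probability mass function on $\{0,1,2,\dots\}$.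
   Formalization: Two repairs: the fixed-location part is added to the triple sum (a diffuse G cannot produce fixed atoms), and it is assumed that ν{θ>0 : h(0|θ)=1}=0, since atoms that are never observed would be missing from the sum. *)

(* Defs.v *)
From HB Require Import structures.
From mathcomp Require Import all_boot all_order all_algebra.
From mathcomp Require Import all_classical all_reals all_analysis.
From mathcomp Require Import measurable_realfun.

Set Implicit Arguments.
Unset Strict Implicit.
Unset Printing Implicit Defensive.

Import Order.TTheory GRing.Theory Num.Theory.
Import numFieldNormedType.Exports.

Local Open Scope classical_set_scope.
Local Open Scope ring_scope.
Local Open Scope ereal_scope.

(* The sigma-algebra on T generated by the family (Y i)_(i in D). *)
Definition sigma_gen (I T : Type) d (T' : measurableType d) (D : set I)
    (Y : I -> T -> T') : set (set T) :=
  <<s \bigcup_(i in D) preimage_set_system setT (Y i) measurable >>.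

(* Mutual independence of a family of classes of events: the product rule over
   every finite subfamily. *)
Definition mutually_independent d (T : measurableType d) (R : realType)
    (P : probability T R) (I : eqType) (F : I -> set (set T)) : Prop :=
  forall (s : seq I) (E : I -> set T), uniq s ->
    (forall i, i \in s -> F i (E i)) ->
    P (\big[setI/setT]_(i <- s) E i) = \prod_(i <- s) P (E i).

Definition independent_rvs d (T : measurableType d) (R : realType)
    (P : probability T R) (I : eqType) d' (T' : measurableType d')
    (Y : I -> T -> T') : Prop :=
  mutually_independent P
    (fun i => preimage_set_system setT (Y i) measurable).

(* Y is a version of the conditional probability of E given the
   sigma-algebra F. *)
Definition conditional_probability d (T : measurableType d) (R : realType)
    (P : probability T R) (F : set (set T)) (E : set T) (Y : T -> R) : Prop :=
  (forall B : set R, measurable B -> F (Y @^-1` B)) /\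
  (forall C, F C -> P (E `&` C) = \int[P]_(w in C) (Y w)%:E).

(* The second argument of poisson_prob is a dummy.  We use poisson_prob and not
   poisson_pmf because only the former is right (a Dirac mass at 0) at rate 0. *)
Definition poisson_law (R : realType) (rate : R) : set nat -> \bar R :=
  poisson_prob rate 0%N.

(* The measure \sum_k w_k \delta_(a_k). *)
Definition atomic_measure (R : realType) d (T : measurableType d)
    (w : nat -> R) (a : nat -> T) (A : set T) : \bar R :=
  \sum_(k <oo) (w k)%:E * \d_(a k) A.

(* The N_w are the counting measures of a Poisson point process with mean
   measure mu: Poisson counts (infinite if the mean is), independent on disjoint
   sets. *)
Definition poisson_point_process d (Omega : measurableType d) (R : realType)
    (P : probability Omega R) d' (T : measurableType d')
    (mu : set T -> \bar R) (N : Omega -> set T -> \bar R) : Prop :=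
  [/\ forall B, measurable B -> measurable_fun setT (fun w => N w B),
      forall B n, measurable B -> mu B < +oo ->
        P [set w | N w B = n%:R%:E] = poisson_law (fine (mu B)) [set n],
      forall B, measurable B -> mu B = +oo -> P [set w | N w B = +oo] = 1
    & forall (n : nat) (B : 'I_n -> set T), (forall i, measurable (B i)) ->
        trivIset setT B -> independent_rvs P (fun i w => N w (B i))].

(* The sequence f_0, ..., f_(K-1), g_0, g_1, ... *)
Definition splice (T : Type) (K : nat) (f : 'I_K -> T) (g : nat -> T)
    (k : nat) : T :=
  if insub k is Some i then f i else g (k - K)%N.

(* Independence of the random weights of the fixed-location atoms and of the
   point process underlying the ordinary component (index None). *)
Definition independent_components d (Omega : measurableType d) (R : realType)
    (P : probability Omega R) d' (T : measurableType d') (K : nat)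
    (theta_fix : 'I_K -> Omega -> R) (N : Omega -> set T -> \bar R) : Prop :=
  mutually_independent P (fun i : option 'I_K =>
    if i is Some k then preimage_set_system setT (theta_fix k) measurable
    else sigma_gen measurable (fun B w => N w B)).

Definition ordinary_points d (Omega : measurableType d) (R : realType)
    d' (Psi : measurableType d') (theta : nat -> Omega -> R)
    (psi : nat -> Omega -> Psi) (w : Omega)
    (B : set (measurableTypeR R * Psi)) : \bar R :=
  \sum_(k <oo) \d_((theta k w : measurableTypeR R), psi k w) B.

(* R_+ is represented by the interval [0, +oo[ of R. *)
Definition pmf_family (R : realType) (h : nat -> R -> R) : Prop :=
  (forall x, measurable_fun (`[0%R, +oo[ : set R) (h x)) /\
  (forall theta, (0 <= theta)%R ->
     (forall x, (0 <= h x theta)%R) /\ \sum_(x <oo) (h x theta)%:E = 1).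

(* Given all the pairs (theta_k, psi_k), the x_(n,k) are independent and x_(n,k)
   has probability mass function h(. | theta_k); equivalently, every finite
   array of values v has the product as conditional probability. *)
Definition conditionally_independent_counts
    d (Omega : measurableType d) (R : realType) (P : probability Omega R)
    d' (Psi : measurableType d') (h : nat -> R -> R)
    (theta : nat -> Omega -> R) (psi : nat -> Omega -> Psi)
    (x : nat -> nat -> Omega -> nat) : Prop :=
  forall (N K : nat) (v : nat -> nat -> nat),
    conditional_probability P
      (sigma_gen setT
         (fun k w => ((theta k w : measurableTypeR R), psi k w)))
      [set w | forall n k, (n < N)%N -> (k < K)%N -> x n k w = v n k]
      (fun w => \prod_(n < N) \prod_(k < K) h (v n k) (theta k w))%R.

(* nu(d theta) h(0 | theta)^(m-1) h(x | theta), for m, x >= 1. *)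
Definition size_measure (R : realType)
    (nu : set (measurableTypeR R) -> \bar R) (h : nat -> R -> R) (m x : nat)
    (B : set (measurableTypeR R)) : \bar R :=
  \int[nu]_(theta in B `&` `[0%R, +oo[)
     (h 0%N theta ^+ m.-1 * h x theta)%:E.

Definition F_size (R : realType)
    (nu : set (measurableTypeR R) -> \bar R) (h : nat -> R -> R) (m x : nat)
    (B : set (measurableTypeR R)) : \bar R :=
  ((fine (size_measure nu h m x setT))^-1)%:E * size_measure nu h m x B.

Definition independent3 d (T : measurableType d) (R : realType)
    (P : probability T R) (F1 F2 F3 : set (set T)) : Prop :=
  forall E1 E2 E3, F1 E1 -> F2 E2 -> F3 E3 ->
    P (E1 `&` E2 `&` E3) = P E1 * P E2 * P E3.

(* Main.v *)
Require Import Defs.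
From HB Require Import structures.
From mathcomp Require Import all_boot all_order all_algebra fingroup perm.
From mathcomp Require Import all_classical all_reals all_analysis.
From mathcomp Require Import measurable_realfun.
From mathcomp Require Import ring lra.

Set Implicit Arguments.
Unset Strict Implicit.
Unset Printing Implicit Defensive.

Import Order.TTheory GRing.Theory Num.Theory.
Import numFieldNormedType.Exports.

Local Open Scope classical_set_scope.
Local Open Scope ring_scope.
Local Open Scope ereal_scope.

(** The data points are read one after the other. An ordinary atom belongs to the
class (m, y) when observation m, counted from 0, is the first one that sees it,
and sees it with the value y + 1. Given the points, an atom of weight t falls in
this class with probability
[h 0 t ^ m * h (y + 1) t], independently of the other atoms. By the marking
theorem the atoms of the different classes therefore form independent Poisson
point processes, with mean measures
[h 0 t ^ m * h (y + 1) t * nu (dt) * G (d psi)]. These are finite under the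
summability hypothesis, and a Poisson process of finite mean measure is a
Poisson number of i.i.d. points in random order. An atom of positive weight that
is in no class is never seen, which has probability 0 since nu-almost every t > 0
satisfies [h 0 t < 1]; so the classes exhaust the ordinary component.

The marking theorem is proved on expectations.
- [pgf]: the mean of the product of 1 - v over the points of a Poisson process
  is the exponential of minus the integral of v.
- [array_counts] and [thinned_product]: given the points, indicators of classes
  may be replaced by their conditional probabilities.
- [class_pgf]: together these give the joint generating functional of finitely
  many classes, which factors over the classes.
- [extract_symm]: comparing power series gives the law of the number of points
  of a class and of symmetric functions of them; polarization turns this into
  the law of these points after a uniformly random relabelling. [class_law] does
  it for one class after the other.

The enumeration of the atoms of a class can depend on their values, so the
relabelling is really needed to get i.i.d. points, and the sequences of the
conclusion are infinite whereas a class has finitely many atoms. Both are dealt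
with by an extension of the probability space: [fresh_space] carries, for each
class, independent uniform permutations of the labels 0, ..., r - 1 for every r,
and independent points that continue the list of the atoms of the class. It is a
countable product of probability spaces, built as a measure on boxes
([box_measure_sigma_additive]).

On the extended space [joint_law] computes the probability of prescribed totals
and of prescribed rectangles for the labelled points, and [family_law] rewrites
it as the product rule for all locations, weights and totals together. The laws
and the independence in the conclusion are consequences of this rule, and
[atomic_measure_ae] is the almost sure identity between the measures. *)

(** * Expectations of bounded random variables *)

Lemma measurable_nat_comp d (T : measurableType d) d' (T' : measurableType d')
  (N : T -> nat) (f : nat -> T -> T') :
  measurable_fun setT N -> (forall n, measurable_fun setT (f n)) ->
  measurable_fun setT (fun w => f (N w) w).
Proof.
move=> mN mf _ B mB; rewrite setTI.
rewrite (_ : _ @^-1` B = \bigcup_n (N @^-1` [set n] `&` f n @^-1` B)).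
  apply: bigcupT_measurable => n; apply: measurableI.
    by rewrite -[X in measurable X]setTI; exact: mN.
  by rewrite -[X in measurable X]setTI; exact: mf.
by apply/seteqP; split=> [w Bw|w [n _ [/= <-]]//]; exists (N w).
Qed.

Section bounded_expectation.
Context d (T : measurableType d) (R : realType) (P : probability T R).
Local Open Scope ring_scope.
Implicit Types (X Y : T -> R) (A : set T).

Definition bounded_measurable X :=
  measurable_fun setT X /\ exists M, forall w, `|X w| <= M.
Local Notation bm := bounded_measurable.

(** Real-valued, so that identities between expectations of bounded variables
are identities in the field R, without finiteness conditions. *)
Definition Ex X : R := \int[P]_w X w.

Lemma bm_integrable X : bm X -> P.-integrable setT (EFin \o X).
Proof.
move=> [mX [M XM]].
apply: (@le_integrable _ _ _ P setT _ _ (cst M%:E)) => //.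
- exact/measurable_EFinP.
- move=> w _ /=; rewrite lee_fin (le_trans (XM w))// ler_norm//.
- exact: finite_measure_integrable_cst.
Qed.

Lemma bm_cst (a : R) : bm (cst a).
Proof. by split; [exact: measurable_cst|exists `|a| => w]. Qed.

Lemma bmD X Y : bm X -> bm Y -> bm (fun w => X w + Y w).
Proof.
move=> [mX [M XM]] [mY [N YN]]; split; first exact: measurable_funD.
exists (M + N) => w; exact: le_trans (ler_normD _ _) (lerD _ _).
Qed.

Lemma bmM X Y : bm X -> bm Y -> bm (fun w => X w * Y w).
Proof.
move=> [mX [M XM]] [mY [N YN]]; split; first exact: measurable_funM.
by exists (M * N) => w; rewrite normrM ler_pM.
Qed.

Lemma bmN X : bm X -> bm (fun w => - X w).
Proof.
move=> [mX [M XM]]; split; first exact: measurableT_comp.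
by exists M => w; rewrite normrN.
Qed.

Lemma bmB X Y : bm X -> bm Y -> bm (fun w => X w - Y w).
Proof. by move=> bX bY; apply: bmD => //; exact: bmN. Qed.

Lemma bmZ a X : bm X -> bm (fun w => a * X w).
Proof. by move=> bX; apply: bmM => //; exact: bm_cst. Qed.

Lemma bm_sum I (s : seq I) (Q : pred I) (F : I -> T -> R) :
  (forall i, Q i -> bm (F i)) -> bm (fun w => \sum_(i <- s | Q i) F i w).
Proof.
move=> bF; elim: s => [|i s IH].
  under eq_fun do rewrite big_nil; exact: bm_cst.
under eq_fun do rewrite big_cons; have := bF i; case: (Q i) => // bFi.
by apply: bmD => //; exact: bFi.
Qed.

Lemma bm_prod I (s : seq I) (Q : pred I) (F : I -> T -> R) :
  (forall i, Q i -> bm (F i)) -> bm (fun w => \prod_(i <- s | Q i) F i w).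
Proof.
move=> bF; elim: s => [|i s IH].
  under eq_fun do rewrite big_nil; exact: bm_cst.
under eq_fun do rewrite big_cons; have := bF i; case: (Q i) => // bFi.
by apply: bmM => //; exact: bFi.
Qed.

Lemma bm_indic A : measurable A -> bm (\1_A).
Proof.
move=> mA; split; first exact: measurable_indic.
by exists 1 => w; rewrite indicE; case: (w \in A); rewrite ?normr0 ?normr1.
Qed.

Lemma bm_unit X : measurable_fun setT X -> (forall w, 0 <= X w <= 1) -> bm X.
Proof.
move=> mX X01; split => //; exists 1 => w; have /andP[X0 X1] := X01 w.
by rewrite ger0_norm.
Qed.

Lemma eq_Ex X Y : X =1 Y -> Ex X = Ex Y.
Proof. by move=> XY; congr Ex; exact/funext. Qed.

Lemma Ex_cst (a : R) : Ex (cst a) = a.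
Proof.
rewrite /Ex Rintegral_cst// (_ : fine _ = 1) ?mulr1//.
exact: (congr1 fine (probability_setT P)).
Qed.

Lemma ExD X Y : bm X -> bm Y -> Ex (fun w => X w + Y w) = Ex X + Ex Y.
Proof. by move=> bX bY; apply: RintegralD => //; exact: bm_integrable. Qed.

Lemma ExB X Y : bm X -> bm Y -> Ex (fun w => X w - Y w) = Ex X - Ex Y.
Proof. by move=> bX bY; apply: RintegralB => //; exact: bm_integrable. Qed.

Lemma ExZ a X : bm X -> Ex (fun w => a * X w) = a * Ex X.
Proof. by move=> bX; apply: RintegralZl => //; exact: bm_integrable. Qed.

Lemma Ex_sum I (s : seq I) (Q : pred I) (F : I -> T -> R) :
  (forall i, Q i -> bm (F i)) ->
  Ex (fun w => \sum_(i <- s | Q i) F i w) = \sum_(i <- s | Q i) Ex (F i).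
Proof.
move=> bF; elim: s => [|i s IH].
  by under eq_fun do rewrite big_nil; rewrite big_nil Ex_cst.
under eq_fun do rewrite big_cons; rewrite big_cons; have := bF i; case: (Q i) => // bFi.
by rewrite ExD ?IH//; [exact: bFi|exact: bm_sum].
Qed.

Lemma Ex_indic A : measurable A -> Ex \1_A = fine (P A).
Proof. by move=> mA; rewrite /Ex /Rintegral integral_indic// setIT. Qed.

Lemma indic_bool (b : T -> bool) w : \1_[set w | b w] w = (b w)%:R :> R.
Proof. by rewrite indicE mem_setE. Qed.

Lemma le_Ex X Y : bm X -> bm Y -> (forall w, X w <= Y w) -> Ex X <= Ex Y.
Proof.
by move=> bX bY XY; apply: le_Rintegral => //; exact: bm_integrable.
Qed.

Lemma normr_Ex_le X (M : R) : bm X -> (forall w, `|X w| <= M) -> `|Ex X| <= M.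
Proof.
move=> bX XM; have bM a := bm_cst a.
have lb : Ex (cst (- M)) <= Ex X.
  by apply: le_Ex => // w; have := XM w; rewrite ler_norml => /andP[].
have ub : Ex X <= Ex (cst M).
  by apply: le_Ex => // w; have := XM w; rewrite ler_norml => /andP[].
by rewrite ler_norml; rewrite !Ex_cst in lb ub; rewrite lb ub.
Qed.

Lemma EFin_Ex X : bm X -> (Ex X)%:E = (\int[P]_w (X w)%:E)%E.
Proof.
move=> bX; rewrite /Ex /Rintegral fineK//.
by apply: integrable_fin_num => //; exact: bm_integrable.
Qed.

(** Bounded convergence: the only passage to the limit under the expectation
that the proof needs, boundedness being inherited by the limit. *)
Lemma Ex_cvg (X_ : nat -> T -> R) X M :
  (forall n, measurable_fun setT (X_ n)) -> (forall n w, `|X_ n w| <= M) ->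
  (forall w, X_ ^~ w @ \oo --> X w) ->
  bm X /\ (fun n => Ex (X_ n)) @ \oo --> Ex X.
Proof.
move=> mX XM Xc.
have mXl : measurable_fun setT X.
  apply/measurable_EFinP; apply: (@emeasurable_fun_cvg _ _ _ setT (fun n => EFin \o X_ n)).
    by move=> n; exact/measurable_EFinP.
  by move=> w _; apply: (cvg_comp _ _ (Xc w)).
have XlM w : `|X w| <= M.
  have c : (fun n => `|X_ n w|) @ \oo --> `|X w| by apply: cvg_norm; exact: Xc.
  rewrite -(cvg_lim (@Rhausdorff R) c); apply: limr_le.
    by apply/cvg_ex; eexists; exact: c.
  by apply: nearW => n; exact: XM.
have bX : bm X by split => //; exists M.
split => //; apply: fine_cvg; rewrite -/(Ex X) EFin_Ex//.
have [||||| _ _] := @dominated_convergence _ _ _ P setT measurableT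
  (fun n => EFin \o X_ n) (EFin \o X) (cst M%:E) => //.
- by move=> n; exact/measurable_EFinP.
- exact/measurable_EFinP.
- by apply: aeW => w _; apply: (cvg_comp _ _ (Xc w)).
- exact: finite_measure_integrable_cst.
- by apply: aeW => w n _ /=; rewrite lee_fin.
Qed.

End bounded_expectation.

(** * Finite sets of indices *)

Section finite_index_sets.

Lemma perm_filter_cat (I : eqType) (b s : seq I) : uniq b -> uniq s -> {subset s <= b} ->
  perm_eq b ([seq i <- b | i \notin s] ++ s).
Proof.
move=> ub us sb; apply: uniq_perm => //.
  rewrite cat_uniq filter_uniq//= us andbT; apply/hasPn => i iS.
  by change (i \notin [seq i <- b | i \notin s]); rewrite mem_filter iS.
move=> i; rewrite mem_cat mem_filter; case: (boolP (i \in s)) => [/sb//|_].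
by rewrite orbF.
Qed.

Lemma sub_rectangle (s : seq (nat * nat)) :
  exists M N, {subset s <= [seq (m, n) | m <- iota 0 M, n <- iota 0 N]}.
Proof.
exists (\max_(i <- s) i.1).+1, (\max_(i <- s) i.2).+1 => i i_s.
apply/allpairsP; exists i; rewrite !mem_iota/= !add0n !ltnS.
by split; last (by case: i {i_s}); rewrite (big_rem i)//= leq_maxl.
Qed.

Lemma uniq_rectangle M N : uniq [seq (m, n) | m <- iota 0 M, n <- iota 0 N].
Proof. by apply: allpairs_uniq; rewrite ?iota_uniq// => -[? ?] [? ?]. Qed.

End finite_index_sets.

(** * Polarization of symmetric multilinear forms *)

Section polarization.
Context (R : comNzRingType) (n : nat).
Local Open Scope ring_scope.

(** The sign (-1) ^ (n - #|S|). *)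
Definition polar_sign (S : {set 'I_n}) : R :=
  \prod_(j < n) (if j \in S then 1 else -1).

(** By inclusion-exclusion the sets S that contain the image of phi cancel,
unless this image is everything. *)
Lemma sum_polar_sign (phi : {ffun 'I_n -> 'I_n}) :
  \sum_(S : {set 'I_n}) polar_sign S * \prod_(k < n) (phi k \in S)%:R
  = (injectiveb phi)%:R.
Proof.
pose im j := [exists k, phi k == j].
have -> : (injectiveb phi)%:R = \prod_(j < n) (1 + - (~~ im j)%:R) :> R.
  case: injectiveP => [phiI|phiNI].
    rewrite big1// => j _; rewrite (_ : im j) ?oppr0 ?addr0//.
    have [g _ gK] := injF_bij phiI; apply/existsP; exists (g j).
    by rewrite gK.
  case: (pickP (fun j => ~~ im j)) => [j jN|allim].
    by rewrite (bigD1 j)//= jN subrr mul0r.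
  exfalso; apply: phiNI; apply/injectiveP; rewrite /injectiveb /dinjectiveb.
  apply/(@leq_size_uniq _ (enum 'I_n)); rewrite ?enum_uniq ?size_map//.
  move=> j _; have /negbFE/existsP[k /eqP <-] := allim j.
  by apply: map_f; rewrite mem_enum.
rewrite bigA_distr; apply: eq_bigr => S _.
case: (pickP (fun k => phi k \notin S)) => [k kN|allS].
  rewrite (bigD1 k)//= (negbTE kN) mul0r mulr0 (bigD1 (phi k))//= (negbTE kN).
  have -> : im (phi k) by apply/existsP; exists k.
  by rewrite oppr0 mul0r.
rewrite [X in _ * X]big1 ?mulr1; last by move=> k _; rewrite (negbFE (allS k)).
apply: eq_bigr => j _; case: ifPn => // jS.
suff -> : im j = false by [].
apply: contraNF jS => /existsP[k /eqP <-]; exact: (negbFE (allS k)).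
Qed.

(** Expanding the products on the left produces one term for each map from 'I_n
to itself; the signed sum over S keeps the bijections only. *)
Lemma polarization (a : 'I_n -> 'I_n -> R) :
  \sum_(S : {set 'I_n}) polar_sign S * \prod_(k < n) \sum_(j in S) a k j =
  \sum_(s : 'S_n) \prod_(k < n) a k (s k).
Proof.
transitivity (\sum_(phi : {ffun 'I_n -> 'I_n})
    (injectiveb phi)%:R * \prod_(k < n) a k (phi k)).
  under eq_bigr => S _.
    rewrite (_ : \prod_(k < n) _ = \sum_(phi : {ffun 'I_n -> 'I_n})
      \prod_(k < n) ((phi k \in S)%:R * a k (phi k))); last first.
      rewrite -(bigA_distr_bigA (fun k j => (j \in S)%:R * a k j)).
      apply: eq_bigr => k _; rewrite big_mkcond/=; apply: eq_bigr => j _.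
      by case: (j \in S); rewrite ?mul1r ?mul0r.
    rewrite big_distrr/=.
    over.
  rewrite exchange_big/=; apply: eq_bigr => phi _.
  rewrite -sum_polar_sign big_distrl/=; apply: eq_bigr => S _.
  by rewrite big_split/= mulrA.
rewrite (bigID (fun phi : {ffun 'I_n -> 'I_n} => injectiveb phi))/=.
rewrite [X in _ + X]big1 ?addr0; last by move=> f /negbTE ->; rewrite mul0r.
rewrite (reindex (@pval _))/=; last first.
  pose in_Sn := insubd (1%g : 'S_n).
  by exists in_Sn => /= f Uf; first apply: val_inj; apply: insubdK.
apply: eq_big => /= [s | s _]; rewrite ?(valP s)// mul1r.
by apply: eq_bigr => k _; rewrite pvalE.
Qed.

End polarization.

(** * Enumerating the true values of a boolean sequence *)

Section counting.
Implicit Types (b : nat -> bool).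
Local Open Scope nat_scope.

Definition count_upto b K : nat := \sum_(k < K) b k.

Lemma count_uptoS b K : count_upto b K.+1 = count_upto b K + b K.
Proof. by rewrite /count_upto big_ord_recr. Qed.

Lemma count_upto_homo b : {homo count_upto b : m n / m <= n}.
Proof.
apply: homo_leq => //; first exact: leq_trans.
by move=> n; rewrite count_uptoS leq_addr.
Qed.

Definition count_is b (r : nat) :=
  exists K, forall K', K <= K' -> count_upto b K' = r.

Lemma count_is_uniq b r r' : count_is b r -> count_is b r' -> r = r'.
Proof.
move=> [K Kr] [K' K'r]; rewrite -(Kr (maxn K K')) ?leq_maxl//.
by rewrite K'r ?leq_maxr.
Qed.

Lemma count_upto_unbounded b : ~ (exists r, count_is b r) ->
  forall n, exists K, n <= count_upto b K.
Proof.
move=> nb; elim=> [|n [K nK]]; first by exists 0.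
have [[K' ltn]|nex] := pselect (exists K', n < count_upto b K').
  by exists K'.
exfalso; apply: nb; exists n; exists K => K' KK'.
apply/eqP; rewrite eqn_leq (leq_trans nK (count_upto_homo b KK')) andbT leqNgt.
by apply/negP => h; apply: nex; exists K'.
Qed.

Definition kth b i : nat := xget 0 [set k | b k /\ count_upto b k = i].

Lemma kth_count_upto b k : b k -> kth b (count_upto b k) = k.
Proof.
move=> bk; rewrite /kth; case: xgetP => [k' _ [bk' e]|/(_ k)]; last first.
  by move=> /not_andP[].
case: (ltngtP k k') => // h.
  by have := count_upto_homo b h; rewrite e count_uptoS bk addn1 ltnn.
by have := count_upto_homo b h; rewrite -e count_uptoS bk' addn1 ltnn.
Qed.

Lemma big_kth (T : Type) (idx : T) (op : Monoid.law idx) b (f : nat -> T) K :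
  \big[op/idx]_(k < K | b k) f k = \big[op/idx]_(i < count_upto b K) f (kth b i).
Proof.
elim: K => [|K IH]; first by rewrite /count_upto !big_ord0.
rewrite big_mkcond big_ord_recr/= -big_mkcond/= IH count_uptoS.
case bK : (b K); last by rewrite addn0 Monoid.mulm1.
by rewrite addn1 big_ord_recr/= kth_count_upto.
Qed.

End counting.

(** * Power series with bounded coefficients *)

Section power_series.
Context (R : realType).
Local Open Scope ring_scope.

Lemma cvg_prodr (I : Type) (s : seq I) (F : I -> nat -> R) (l : I -> R) :
  (forall i, F i @ \oo --> l i) ->
  (fun n => \prod_(i <- s) F i n) @ \oo --> \prod_(i <- s) l i.
Proof.
move=> Fl; elim: s => [|i s IH].
  by under eq_fun do rewrite big_nil; rewrite big_nil; exact: cvg_cst.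
under eq_fun do rewrite big_cons; rewrite big_cons.
exact: cvgM (Fl i) IH.
Qed.

Lemma sum_expr_tail (s : R) n N : 0 <= s -> s <= 2^-1 -> (n <= N)%N ->
  \sum_(n <= m < N) s ^+ m <= 2 * s ^+ n.
Proof.
move=> s0 s2 nN; suff : \sum_(n <= m < N) s ^+ m <= 2 * s ^+ n - 2 * s ^+ N.
  by move=> /le_trans; apply; rewrite lerBlDr lerDl mulr_ge0 ?exprn_ge0.
elim: N nN => [|N IH].
  by rewrite leqn0 => /eqP ->; rewrite big_geq// subrr.
rewrite leq_eqVlt => /predU1P[->|nN]; first by rewrite big_geq// subrr.
rewrite big_nat_recr//=; have := IH nN; rewrite exprS => h.
have : 0 <= s ^+ N by rewrite exprn_ge0.
by move: (s ^+ N) h => x h; nra.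
Qed.

(** The first non-zero coefficient would dominate the rest of the series for
small s. *)
Lemma power_series0 (d : nat -> R) (M : R) :
  (forall n, `|d n| <= M) ->
  (forall s : R, 0 < s -> s < 1 -> series (fun n => d n * s ^+ n) @ \oo --> (0 : R)) ->
  forall n, d n = 0.
Proof.
move=> dM d0 n; have M0 : 0 <= M by exact: le_trans (dM 0%N).
elim/ltn_ind: n => n IH.
(* The tail beyond n is at most M times a geometric series of ratio s <= 1/2. *)
have bd (s : R) : 0 < s -> s <= 2^-1 -> `|d n| <= 2 * M * s.
  move=> s0 s2; have s1 : s < 1 by lra.
  have sn0 : 0 < s ^+ n by rewrite exprn_gt0.
  rewrite -(ler_pM2r sn0) -[X in X <= _]/(`|d n| * s ^+ n).
  rewrite (_ : `|d n| * _ = `|d n * s ^+ n|); last by rewrite normrM (gtr0_norm sn0).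
  rewrite (_ : 2 * M * s * s ^+ n = 2 * M * s ^+ n.+1); last by rewrite exprS mulrA.
  have c : (fun N => `|series (fun n => d n * s ^+ n) N|) @ \oo --> `|0 : R|.
    by apply: cvg_norm; exact: d0.
  suff : `|d n * s ^+ n| - 2 * M * s ^+ n.+1 <= `|0 : R| by rewrite normr0; lra.
  rewrite -(cvg_lim (@Rhausdorff R) c); apply: limr_ge.
    by apply/cvg_ex; eexists; exact: c.
  near=> N; have nN : (n < N)%N by near: N; exists n.+1.
  rewrite /series/= (big_cat_nat _ (n := n.+1))//= big_nat_recr//=.
  rewrite [X in `|X + _ + _|]big_nat_cond [X in `|X + _ + _|]big1; last first.
    by move=> i /andP[/andP[_ ?] _]; rewrite IH// mul0r.
  rewrite add0r lerBlDr -lerBlDl.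
  apply: (le_trans (lerB_dist _ _)).
  rewrite opprD addrA subrr add0r normrN.
  apply: (le_trans (ler_norm_sum _ _ _)).
  apply: (@le_trans _ _ (\sum_(n.+1 <= i < N) M * s ^+ i)).
    apply: ler_sum => i _; rewrite normrM (ger0_norm (exprn_ge0 _ (ltW s0))).
    by rewrite ler_wpM2r// exprn_ge0// ltW.
  rewrite -big_distrr/= (mulrC 2) -mulrA ler_wpM2l//.
  by apply: sum_expr_tail => //; exact: ltW.
apply/eqP; rewrite -normr_eq0; apply/eqP/le_anti; rewrite normr_ge0 andbT.
apply/ler_addgt0Pl => e e0; rewrite addr0.
have M1 : 0 < 2 * M + 1 by lra.
pose s := Num.min 2^-1 (e / (2 * M + 1)).
have s0 : 0 < s by rewrite lt_min invr_gt0 ltr0n/= divr_gt0.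
apply: (le_trans (bd s s0 _)); first by rewrite ge_min lexx.
apply: (@le_trans _ _ ((2 * M + 1) * s)); first by nra.
by rewrite -ler_pdivlMl// mulrC ge_min lexx orbT.
Unshelve. all: by end_near. Qed.

Lemma power_series_unique (a b : nat -> R) (M N : R) :
  (forall n, `|a n| <= M) -> (forall n, `|b n| <= N) ->
  (forall s : R, 0 < s -> s < 1 -> exists l : R,
    series (fun n => a n * s ^+ n) @ \oo --> l /\
    series (fun n => b n * s ^+ n) @ \oo --> l) ->
  forall n, a n = b n.
Proof.
move=> aM bN ab n; apply/eqP; rewrite -subr_eq0; apply/eqP.
apply: (@power_series0 (fun n => a n - b n) (M + N)) => [m|s s0 s1].
  exact: le_trans (ler_normB _ _) (lerD _ _).
have [l [al bl]] := ab s s0 s1.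
rewrite (_ : series _ = series (fun n => a n * s ^+ n) - series (fun n => b n * s ^+ n)).
  by rewrite -(subrr l); exact: cvgB.
apply/funext => m; rewrite /series/= fctE/= -sumrB.
by apply: eq_bigr => i _; rewrite mulrBl.
Qed.

End power_series.

(** * Counting along random sequences *)

Section total_counts.
Context (R : realType).
Local Open Scope ring_scope.
Implicit Types (b : nat -> bool).

Definition count_isb b r : bool := `[< count_is b r >].
Definition finite_count b : bool := `[< exists r, count_is b r >].
(** The value is 0 when b is true infinitely often. *)
Definition total_count b : nat := xget 0%N [set r | count_is b r].

Lemma total_countP b : finite_count b -> count_is b (total_count b).
Proof. by move=> /asboolP [r br]; apply: (@xgetI _ 0%N [set r | count_is b r] r). Qed.

Lemma count_isbE b r : count_isb b r = finite_count b && (r == total_count b).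
Proof.
apply/asboolP/andP => [br|[fb /eqP ->]]; last exact: total_countP.
have fb : finite_count b by apply/asboolP; exists r.
by split => //; apply/eqP; exact: count_is_uniq br (total_countP fb).
Qed.

Lemma series_count_isb b (G : nat -> R) :
  series (fun r => (count_isb b r)%:R * G r) @ \oo --> (finite_count b)%:R * G (total_count b).
Proof.
apply: cvg_near_cst; exists (total_count b).+1 => // n /= nb.
rewrite /series/= (bigD1_seq (total_count b))/= ?iota_uniq ?mem_index_iota//.
rewrite count_isbE eqxx andbT big1 ?addr0// => i /negbTE ib.
by rewrite count_isbE ib andbF mul0r.
Qed.

(** The product of f over the indices where b is true, understood to be 0 when
there are infinitely many of them: this is the limit of the partial products
when f is bounded away from 1. *)
Definition count_prod b (f : nat -> R) : R :=
  (finite_count b)%:R * \prod_(i < total_count b) f (kth b i).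

Lemma prod_cvg_count_prod b (f : nat -> R) (s : R) : s < 1 ->
  (forall k, 0 <= f k <= s) ->
  (fun K => \prod_(k < K | b k) f k) @ \oo --> count_prod b f.
Proof.
move=> s1 fs; have s0 : 0 <= s by have /andP[/le_trans h /h] := fs 0%N.
under eq_fun do rewrite big_kth.
have [fb|nfb] := boolP (finite_count b).
  (* The partial products are constant once all true indices have been met. *)
  have [K0 K0b] := total_countP fb.
  apply: cvg_near_cst; exists K0 => // K /= KK0.
  by rewrite (K0b _ KK0) /count_prod fb mul1r.
rewrite /count_prod (negbTE nfb) mul0r.
(* With infinitely many true indices, the partial products are below powers of s. *)
have cs : (fun n => s ^+ n) @ \oo --> (0 : R) by apply: cvg_expr; rewrite ger0_norm.
apply/cvgrPdist_le => e e0.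
have [N _ Ns] := (cvgrPdist_le _ _).1 cs e e0.
have /asboolPn/(count_upto_unbounded)/(_ N)[K0 NK0] := nfb.
exists K0 => // K /= KK0.
rewrite sub0r normrN ger0_norm; last by apply: prodr_ge0 => i _; have /andP[] := fs (kth b i).
have := Ns (count_upto b K) (leq_trans NK0 (count_upto_homo b KK0)).
rewrite /= sub0r normrN ger0_norm ?exprn_ge0//; apply: le_trans.
rewrite -[in leRHS](card_ord (count_upto b K)) -prodr_const.
by apply: ler_prod => i _; exact: fs.
Qed.

End total_counts.

Section random_count.
Context d (T : measurableType d) (R : realType) (P : probability T R).
Local Open Scope ring_scope.
Local Notation bm := (@bounded_measurable _ _ R).
Variable b : nat -> T -> bool.
Hypothesis mb : forall k, measurable [set w | b k w].

Lemma measurable_count_upto K n : measurable [set w | count_upto (b ^~ w) K = n].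
Proof.
elim: K n => [|K IH] n.
  rewrite (_ : mkset _ = if n == 0%N then setT else set0); last first.
    by apply/seteqP; split=> w/=; rewrite /count_upto big_ord0; [move=> <-|case: eqP => // ->].
  by case: ifP.
rewrite (_ : mkset _ = ([set w | count_upto (b ^~ w) K = n] `\` [set w | b K w]) `|`
   ([set w | (count_upto (b ^~ w) K).+1 = n] `&` [set w | b K w])); last first.
  apply/seteqP; split=> w/=; rewrite count_uptoS; case: (b K w); rewrite ?addn0 ?addn1.
  - by right.
  - by left.
  - by case=> -[].
  - by case=> -[].
apply: measurableU; first exact: measurableD.
apply: measurableI => //; case: n => [|n]; last first.
  by rewrite (_ : mkset _ = [set w | count_upto (b ^~ w) K = n])//; apply/seteqP; split=> w/= => [[]|->].
by rewrite (_ : mkset _ = set0)//; apply/seteqP; split.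
Qed.

Lemma measurable_count_isb r : measurable [set w | count_isb (b ^~ w) r].
Proof.
rewrite (_ : mkset _ = \bigcup_K \bigcap_(K' in [set K' | (K <= K')%N])
    [set w | count_upto (b ^~ w) K' = r]); last first.
  by apply/seteqP; split=> w /= => [/asboolP[K Kr]|[K _ Kr]];
    [exists K|apply/asboolP; exists K].
apply: bigcupT_measurable => K; apply: bigcap_measurable; last first.
  by move=> *; exact: measurable_count_upto.
by exists K => /=.
Qed.

Lemma measurable_finite_count : measurable [set w | finite_count (b ^~ w)].
Proof.
rewrite (_ : mkset _ = \bigcup_r [set w | count_isb (b ^~ w) r]).
  by apply: bigcupT_measurable => r; exact: measurable_count_isb.
apply/seteqP; split=> w /= => [fb|[r _ /=]]; last by rewrite count_isbE => /andP[].
suff h : count_isb (b ^~ w) (total_count (b ^~ w)) by exists (total_count (b ^~ w)).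
by rewrite count_isbE fb eqxx.
Qed.

Lemma measurable_nat_fun (f : T -> nat) :
  (forall n, measurable (f @^-1` [set n])) -> measurable_fun setT f.
Proof.
move=> mf _ B _; rewrite setTI (_ : _ @^-1` _ = \bigcup_(n in B) f @^-1` [set n]).
  by apply: bigcup_measurable => n _; exact: mf.
by apply/seteqP; split=> w /= => [Bw|[n Bn /= ->//]]; exists (f w).
Qed.

Lemma measurable_total_count : measurable_fun setT (fun w => total_count (b ^~ w)).
Proof.
apply: measurable_nat_fun => n.
rewrite (_ : _ @^-1` _ = [set w | count_isb (b ^~ w) n] `|`
    (if n == 0%N then ~` [set w | finite_count (b ^~ w)] else set0)).
  apply: measurableU; first exact: measurable_count_isb.
  by case: ifP => // _; apply: measurableC; exact: measurable_finite_count.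
apply/seteqP; split=> w /=; rewrite count_isbE.
  move=> <-; rewrite eqxx andbT.
  case fb : (finite_count _); [by left|right].
  rewrite (_ : total_count _ = 0%N) ?eqxx//=; first by rewrite fb.
  rewrite /total_count xgetPN// => r; move/asboolP : fb => h br.
  by apply: h; exists r.
case=> [/andP[_ /eqP ->//]|]; case: eqVneq => // -> /= nf.
by rewrite /total_count xgetPN// => r br; apply: nf; apply/asboolP; exists r.
Qed.

Lemma measurable_kth i : measurable_fun setT (fun w => kth (b ^~ w) i).
Proof.
apply: measurable_nat_fun => n.
rewrite (_ : _ @^-1` _ = ([set w | b n w] `&` [set w | count_upto (b ^~ w) n = i]) `|`
    (if n == 0%N then \bigcap_k ~` ([set w | b k w] `&` [set w | count_upto (b ^~ w) k = i]) else set0)).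
  apply: measurableU.
    by apply: measurableI => //; exact: measurable_count_upto.
  case: ifP => // _; apply: bigcapT_measurable => k; apply: measurableC.
  by apply: measurableI => //; exact: measurable_count_upto.
apply/seteqP; split=> w /=.
  rewrite /kth; case: xgetP => [k -> [bk ck] <-|h <-]; first by left.
  by right; rewrite eqxx/= => k _; exact: h.
case=> [[bn <-]|]; first exact: kth_count_upto.
by case: eqVneq => // -> h; rewrite /kth xgetPN// => k; exact: h.
Qed.

Lemma Ex_series_count_isb (D : T -> R) (G : nat -> T -> R) : bm D ->
  (forall r, measurable_fun setT (G r)) -> (forall r w, `|G r w| <= 1) ->
  bm (fun w => D w * ((finite_count (b ^~ w))%:R * G (total_count (b ^~ w)) w)) /\
  series (fun r => Ex P (fun w => D w * ((count_isb (b ^~ w) r)%:R * G r w))) @ \oo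
   --> Ex P (fun w => D w * ((finite_count (b ^~ w))%:R * G (total_count (b ^~ w)) w)).
Proof.
move=> bD mG G1; have [mD [M DM]] := bD.
have bh r : bm (fun w => (count_isb (b ^~ w) r)%:R).
  rewrite (_ : (fun _ => _) = \1_[set w | count_isb (b ^~ w) r]).
    by apply: bm_indic; exact: measurable_count_isb.
  by apply/funext => w; rewrite indicE mem_setE.
have bt r : bm (fun w => D w * ((count_isb (b ^~ w) r)%:R * G r w)).
  by apply: bmM => //; apply: bmM => //; split => //; exists 1.
pose X_ n w := \sum_(0 <= r < n) D w * ((count_isb (b ^~ w) r)%:R * G r w).
have -> : series (fun r => Ex P (fun w => D w * ((count_isb (b ^~ w) r)%:R * G r w)))
    = fun n => Ex P (X_ n).
  by apply/funext => n; rewrite /series/= /X_ Ex_sum.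
apply: (@Ex_cvg _ _ _ P _ _ M).
- by move=> n; case: (@bm_sum _ _ R _ (index_iota 0 n) xpredT _ (fun r _ => bt r)).
- move=> n w; rewrite /X_ -big_distrr/= normrM.
  rewrite -[leRHS]mulr1 ler_pM// ?DM//.
  have [nt|nt] := ltnP (total_count (b ^~ w)) n; last first.
    rewrite big_nat_cond big1 ?normr0// => r /andP[/andP[_ rn] _].
    by rewrite count_isbE ltn_eqF ?andbF ?mul0r// (leq_trans rn).
  rewrite (bigD1_seq (total_count (b ^~ w)))/= ?iota_uniq ?mem_index_iota//.
  rewrite big1 ?addr0; last by move=> i /negbTE ib; rewrite count_isbE ib andbF mul0r.
  by rewrite normrM -[leRHS]mulr1 ler_pM//; case: count_isb; rewrite ?normr1 ?normr0.
- move=> w; rewrite /X_; under eq_fun do rewrite -big_distrr/=.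
  by apply: cvgMr; exact: (@series_count_isb R (b ^~ w) (fun r => G r w)).
Qed.

End random_count.

(** * The probability generating functional of a Poisson point process *)

Section poisson_and_simple_functions.
Context (R : realType).
Local Open Scope ring_scope.

Definition pois (l : R) (r : nat) : R := l ^+ r / r`!%:R * expR (- l).

Lemma pois_ge0 l r : 0 <= l -> 0 <= pois l r.
Proof. by move=> l0; rewrite !mulr_ge0 ?exprn_ge0 ?expR_ge0. Qed.

Lemma poisson_law1 l r : 0 <= l -> poisson_law l [set r] = (pois l r)%:E.
Proof.
rewrite le_eqVlt => /predU1P[<-|l0]; rewrite /poisson_law /poisson_prob.
  rewrite ltxx diracE /pois oppr0 expR0 mulr1.
  case: r => [|r]; first by rewrite mem_set// expr0 fact0 divr1.
  by rewrite memNset// exprS !mul0r.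
rewrite l0 esum_set1; first by rewrite /poisson_pmf l0.
by rewrite lee_fin poisson_pmf_ge0.
Qed.

Lemma series_pois l s : series (fun r => pois l r * s ^+ r) @ \oo --> expR (- (l * (1 - s))).
Proof.
have -> : expR (- (l * (1 - s))) = expR (- l) * expR (l * s).
  by rewrite -expRD; congr expR; ring.
rewrite (_ : series _ = fun n => expR (- l) * series (exp_coeff (l * s)) n).
  by apply: cvgMr; exact: is_cvg_series_exp_coeff.
apply/funext => n; rewrite /series/= big_distrr/=; apply: eq_bigr => i _.
by rewrite /exp_coeff/= /pois exprMn; ring.
Qed.

(** The identity behind the decomposition of a simple function along its
values; 0 may be absent from s. *)
Lemma sum_indic_seq (s : seq R) (y : R) : uniq s -> (y != 0 -> y \in s) ->
  \sum_(x <- s) x * (y == x)%:R = y.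
Proof.
move=> us ys; have [y0|y0] := eqVneq y 0.
  by rewrite big1// => x _; case: eqVneq => [<-|]; rewrite ?mulr0// y0 mul0r.
rewrite (bigD1_seq y)/= ?ys// eqxx mulr1 big1 ?addr0// => x.
by rewrite eq_sym => /negbTE ->; rewrite mulr0.
Qed.

Import HBNNSimple.

Lemma simple_approx dZ (Z : measurableType dZ) (v : Z -> R) :
  measurable_fun setT v -> (forall x, 0 <= v x) ->
  exists g : nat -> {nnsfun Z >-> R}, [/\ forall m n x, (m <= n)%N -> g m x <= g n x,
    forall x, (fun n => g n x) @ \oo --> v x & forall n x, g n x <= v x].
Proof.
move=> mv v0; have mEv : measurable_fun setT (EFin \o v) by exact/measurable_EFinP.
have Ev0 x : setT x -> (0 <= (EFin \o v) x)%E by rewrite lee_fin.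
pose g n := nnsfun_approx measurableT mEv n.
have gnd m n x : (m <= n)%N -> g m x <= g n x.
  by move=> mn; have /lefP := @nd_nnsfun_approx _ _ _ _ measurableT _ mEv m n mn; exact.
have gc x : (fun n => g n x) @ \oo --> v x.
  by have /fine_cvg := cvg_nnsfun_approx measurableT mEv Ev0 (I : setT x).
exists g; split => // n x; rewrite -(cvg_lim (@Rhausdorff R) (gc x)).
apply: nondecreasing_cvgn_le; last by apply/cvg_ex; eexists; exact: gc.
by move=> m m' mm'; exact: gnd.
Qed.

End poisson_and_simple_functions.

Section poisson_process.
Context d (T : measurableType d) (R : realType) (P : probability T R).
Context dZ (Z : measurableType dZ) (z : nat -> T -> Z) (mu : {measure set Z -> \bar R}).
Hypothesis mz : forall k, measurable_fun setT (z k).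
Hypothesis ppp : poisson_point_process P mu
  (fun w B => \sum_(k <oo) \d_(z k w) B)%E.
Local Open Scope ring_scope.
Local Notation bm := (@bounded_measurable _ _ R).

Definition in_set_at (B : set Z) k w : bool := z k w \in B.

Lemma measurable_in_set_at B k : measurable B -> measurable [set w | in_set_at B k w].
Proof.
move=> mB; rewrite (_ : mkset _ = z k @^-1` B).
  by rewrite -[X in measurable X]setTI; exact: mz.
by apply/seteqP; split=> w /=; rewrite /in_set_at inE.
Qed.

Lemma dirac_seriesE B w n :
  (\sum_(k <oo) \d_(z k w) B = n%:R%:E :> \bar R)%E <-> count_isb (in_set_at B ^~ w) n.
Proof.
have ps K : (\sum_(0 <= k < K) \d_(z k w) B = (count_upto (in_set_at B ^~ w) K)%:R%:E :> \bar R)%E.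
  rewrite big_mkord /count_upto natr_sum -sumEFin; apply: eq_bigr => i _.
  by rewrite diracE.
have ub m : (\sum_(k <oo) \d_(z k w) B = m%:R%:E :> \bar R)%E ->
    forall K, (count_upto (in_set_at B ^~ w) K <= m)%N.
  move=> e K; rewrite -(ler_nat R) -lee_fin -ps -e.
  by apply: nneseries_lim_ge => k _ _; exact: measure_ge0.
have cE m : count_is (in_set_at B ^~ w) m -> (\sum_(k <oo) \d_(z k w) B = m%:R%:E :> \bar R)%E.
  move=> [K Km]; apply: cvg_lim => //; apply: cvg_near_cst.
  by exists K => // K' /= KK'; rewrite ps Km.
split=> [e|/asboolP]; last exact: cE.
have [[r cr]|/count_upto_unbounded/(_ n.+1)[K]] := pselect (exists r, count_is (in_set_at B ^~ w) r).
  have := cE _ cr; rewrite e => -[/eqP]; rewrite eqr_nat => /eqP ->.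
  exact/asboolP.
by rewrite ltnNge ub.
Qed.

Local Notation exact_counts B r t w :=
  (\prod_(i <- t) (count_isb (in_set_at (B i) ^~ w) (r i))%:R).
Local Notation exact_mass B r t := (\prod_(i <- t) pois (fine (mu (B i))) (r i)).
Local Notation genfun B s t w :=
  (\prod_(i <- t) ((finite_count (in_set_at (B i) ^~ w))%:R * s i ^+ total_count (in_set_at (B i) ^~ w))).
Local Notation genfun_mass B s t :=
  (\prod_(i <- t) expR (- (fine (mu (B i)) * (1 - s i)))).

(** The Poisson probabilities of the counts of disjoint sets multiply; summing
them against s ^ r turns a prescribed count into a generating function. The
sets are treated one at a time, so the statement mixes prescribed counts (t1)
and generating functions (t2), and the case t1 = [::] is the one of interest. *)
Lemma pgf_sets_mixed n (B : 'I_n -> set Z) (s : 'I_n -> R) :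
  (forall i, measurable (B i)) -> trivIset setT B -> (forall i, (mu (B i) < +oo)%E) ->
  (forall i, 0 <= s i < 1) ->
  forall (t2 t1 : seq 'I_n) (r : 'I_n -> nat), uniq (t1 ++ t2) ->
  bm (fun w => exact_counts B r t1 w * genfun B s t2 w) /\
  Ex P (fun w => exact_counts B r t1 w * genfun B s t2 w) =
  exact_mass B r t1 * genfun_mass B s t2.
Proof.
move=> mB tB Boo s01; elim=> [|i t2 IH] t1 r ut.
  have mE : measurable (\big[setI/setT]_(i <- t1) [set w | count_isb (in_set_at (B i) ^~ w) (r i)]).
    apply: (big_ind (fun A => measurable A)) => //; first exact: measurableI.
    by move=> i _; apply: measurable_count_isb => k; exact: measurable_in_set_at.
  rewrite (_ : (fun w => _) =
      \1_(\big[setI/setT]_(i <- t1) [set w | count_isb (in_set_at (B i) ^~ w) (r i)])); last first.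
    apply/funext => w; rewrite big_nil mulr1.
    elim: (t1) => [|j t IHt]; first by rewrite !big_nil indicT.
    by rewrite !big_cons IHt indicI/= indic_bool.
  split; first exact: bm_indic.
  rewrite Ex_indic// big_nil mulr1.
  rewrite cats0 in ut.
  case: ppp => _ Bpois _ /(_ n B mB tB).
  pose E i := [set w | (\sum_(k <oo) \d_(z k w) (B i) = (r i)%:R%:E :> \bar R)%E].
  have EE i : [set w | count_isb (in_set_at (B i) ^~ w) (r i)] = E i.
    by apply/seteqP; split=> w /dirac_seriesE.
  move=> /(_ t1 E ut) indep.
  under eq_bigr do rewrite EE.
  rewrite indep; last first.
    move=> i _ /=; exists [set (r i)%:R%:E]; first exact: emeasurable_set1.
    by rewrite setTI.
  rewrite (_ : (\prod_(i <- t1) P (E i))%E = (exact_mass B r t1)%:E)//.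
  rewrite -prodEFin; apply: eq_bigr => i _.
  by rewrite Bpois// poisson_law1// fine_ge0.
have ui : uniq ((i :: t1) ++ t2).
  by rewrite -cat_rcons -cats1 in ut; rewrite -cat1s (perm_uniq (perm_cat (permEl (perm_catC _ _)) (perm_refl _))).
have it1 : i \notin t1.
  by move: ui => /= /andP[]; rewrite mem_cat negb_or => /andP[].
pose D w := exact_counts B r t1 w * genfun B s t2 w : R.
have ut' : uniq (t1 ++ t2) by case/andP: ui.
have [bD _] := IH t1 r ut'.
have [|||bDG] := @Ex_series_count_isb _ T R P (in_set_at (B i)) _ D (fun r _ => s i ^+ r) bD.
- by move=> k; exact: measurable_in_set_at.
- by move=> q; exact: measurable_cst.
- move=> q w; have /andP[s0 s1] := s01 i.
  by rewrite normrX ger0_norm// exprn_ile1// ltW.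
have fE w : exact_counts B r t1 w * genfun B s (i :: t2) w
  = D w * ((finite_count (in_set_at (B i) ^~ w))%:R * s i ^+ total_count (in_set_at (B i) ^~ w)) :> R.
  by rewrite big_cons /D; ring.
have fE' := funext fE; rewrite fE' => cS; split => //.
apply: (cvg_unique _ cS) => //.
rewrite (_ : series _ = fun n => (exact_mass B r t1 * genfun_mass B s t2) *
   series (fun q => pois (fine (mu (B i))) q * s i ^+ q) n); last first.
  apply/funext => m; rewrite /series/= big_distrr/=; apply: eq_bigr => q _.
  (* The induction hypothesis with the count of B i prescribed to be q. *)
  pose r' j := if j == i then q else r j.
  have [b' e'] := IH (i :: t1) r' ui.
  have r't1 (F : 'I_n -> nat -> R) : \prod_(i <- t1) F i (r' i) = \prod_(i <- t1) F i (r i).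
    apply: eq_big_seq => j jt; rewrite /r'; case: eqVneq => // ji.
    by rewrite -ji jt in it1.
  rewrite big_cons (r't1 (fun i q => pois (fine (mu (B i))) q)) /r' eqxx -/r' in e'.
  transitivity (s i ^+ q * Ex P (fun w =>
     exact_counts B r' (i :: t1) w * genfun B s t2 w)).
    rewrite -ExZ//; apply: eq_Ex => w.
    rewrite big_cons (r't1 (fun i q => (count_isb (in_set_at (B i) ^~ w) q)%:R)) {1}/r' eqxx /D.
    by ring.
  by rewrite e'; ring.
have -> : exact_mass B r t1 * genfun_mass B s (i :: t2) =
  (exact_mass B r t1 * genfun_mass B s t2) *
   expR (- (fine (mu (B i)) * (1 - s i))) by rewrite big_cons; ring.
by apply: cvgMr; exact: series_pois.
Qed.

Lemma one_sub_sum n (B : 'I_n -> set Z) (a : 'I_n -> R) x : trivIset setT B ->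
  1 - \sum_(i < n) a i * \1_(B i) x = \prod_(i < n) (if x \in B i then 1 - a i else 1).
Proof.
move=> tB; case: (pickP (fun i => x \in B i)) => [i xi|xN]; last first.
  rewrite !big1 ?subr0// => i _; first by rewrite xN.
  by rewrite indicE xN mulr0.
rewrite (bigD1 i)//= [in RHS](bigD1 i)//= xi indicE xi mulr1.
have h j : j != i -> x \in B j = false.
  move=> ji; apply/negP => xj; move: ji => /eqP; apply.
  by apply: tB => //; exists x; split; apply/set_mem.
rewrite !big1 ?addr0 ?mulr1// => j /h jx; first by rewrite jx.
by rewrite indicE jx mulr0.
Qed.

(** A point in B i contributes the factor 1 - a i, so the product over all
points is the product over i of (1 - a i) to the number of points in B i. *)
Lemma pgf_simple n (B : 'I_n -> set Z) (a : 'I_n -> R) :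
  (forall i, measurable (B i)) -> trivIset setT B -> (forall i, (mu (B i) < +oo)%E) ->
  (forall i, 0 < a i <= 1) ->
  (fun K => Ex P (fun w => \prod_(k < K) (1 - \sum_(i < n) a i * \1_(B i) (z k w)))) @ \oo
  --> expR (- \sum_(i < n) a i * fine (mu (B i))).
Proof.
move=> mB tB Boo a01.
have [||_] := @pgf_sets_mixed n B (fun i => 1 - a i) mB tB Boo _ (index_enum 'I_n) [::] (fun=> 0%N).
- by move=> i; have := a01 i; lra.
- by rewrite index_enum_uniq.
under eq_Ex do rewrite big_nil mul1r.
rewrite big_nil mul1r => e.
rewrite -sumrN expR_sum.
rewrite (eq_bigr (fun i => expR (- (fine (mu (B i)) * (1 - (1 - a i)))))); last first.
  by move=> i _; congr expR; ring.
rewrite -e; apply: (@Ex_cvg _ _ _ P _ _ 1 _ _ _).2.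
- move=> K; apply: measurable_prod => k _.
  apply: measurable_funB => //; apply: measurable_sum => i.
  apply: measurable_funM => //; apply: measurableT_comp => //; exact: mz.
- move=> K w; rewrite normr_prod; apply: prodr_ile1 => k _.
  rewrite normr_ge0/= one_sub_sum// normr_prod; apply: prodr_ile1 => i _.
  by rewrite normr_ge0/=; case: ifP => _; rewrite ?normr1//; have := a01 i => ?; rewrite ger0_norm; lra.
- move=> w.
  have fE (K : nat) : \prod_(k < K) (1 - \sum_(i < n) a i * \1_(B i) (z k w)) =
     \prod_(i < n) \prod_(k < K | in_set_at (B i) k w) (1 - a i).
    under eq_bigr do rewrite one_sub_sum//.
    by rewrite exchange_big/=; apply: eq_bigr => i _; rewrite [RHS]big_mkcond.
  under eq_fun do rewrite fE.
  apply: cvg_prodr => i.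
  have -> : (finite_count (in_set_at (B i) ^~ w))%:R * (1 - a i) ^+ total_count (in_set_at (B i) ^~ w) =
      count_prod (in_set_at (B i) ^~ w) (fun=> 1 - a i).
    by rewrite /count_prod big_const_ord iter_mulr_1.
  by apply: (@prod_cvg_count_prod R (in_set_at (B i) ^~ w) (fun=> 1 - a i) (1 - a i)) => [|_]; have := a01 i; lra.
Qed.

Import HBNNSimple.

Lemma pgf_nnsfun (g : {nnsfun Z >-> R}) :
  (forall x, g x <= 1) -> (\int[mu]_x (g x)%:E < +oo)%E ->
  (fun K => Ex P (fun w => \prod_(k < K) (1 - g (z k w)))) @ \oo
  --> expR (- fine (\int[mu]_x (g x)%:E)).
Proof.
move=> g1 goo.
pose s : seq R := [seq y <- finmap.enum_fset (fset_set (range g)) | y != 0].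
have us : uniq s by rewrite filter_uniq// finmap.fset_uniq.
have fP y : (y \in finmap.enum_fset (fset_set (range g))) = (y \in range g).
  exact: in_fset_set (fimfunP g) y.
have sP y : y \in s -> y != 0 /\ exists x, g x = y.
  rewrite mem_filter fP => /andP[y0].
  by rewrite inE => -[x _ gxy]; split=> //; exists x.
pose a i := tnth (in_tuple s) i.
have as_ i : a i \in s by rewrite mem_tnth.
pose B i := g @^-1` [set a i].
have mB i : measurable (B i) by exact: measurable_funPTI.
have gE x : g x = \sum_(i < size s) a i * \1_(B i) x.
  rewrite -[LHS](@sum_indic_seq _ s)//; last first.
    move=> g0; rewrite mem_filter g0/= fP.
    by rewrite inE; exists x.
  rewrite big_tnth; apply: eq_bigr => i _; congr (_ * _).
  rewrite indicE /B/=; congr (nat_of_bool _)%:R.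
  by apply/eqP/idP => [e|]; rewrite ?inE// /preimage/= => ->.
have a01 i : 0 < a i <= 1.
  have [a0 [x ax]] := sP _ (as_ i); rewrite lt_neqAle eq_sym a0/= -ax g1 andbT.
  exact: fun_ge0.
have tB : trivIset setT B.
  move=> i j _ _ [x [/= xi xj]].
  by have /tuple_uniqP inj : uniq (in_tuple s) := us; apply: inj; rewrite -/(a i) -xi xj.
have intE : (\int[mu]_x (g x)%:E = \sum_(i < size s) (a i)%:E * mu (B i))%E.
  under eq_integral do rewrite gE -sumEFin.
  rewrite ge0_integral_sum//.
  - apply: eq_bigr => i _; under eq_integral do rewrite EFinM.
    rewrite ge0_integralZl_EFin//.
    + by rewrite integral_indic// setIT.
    + by apply/measurable_EFinP; exact: measurable_indic.
    + by have /andP[/ltW] := a01 i.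
  - by move=> i; apply/measurable_EFinP; apply: measurable_funM => //; exact: measurable_indic.
  - by move=> i x _; rewrite lee_fin mulr_ge0//; have /andP[/ltW] := a01 i.
have Boo i : (mu (B i) < +oo)%E.
  rewrite ltey; apply/negP => /eqP Bi; move: goo.
  rewrite intE (bigD1 i)//= Bi gt0_muley ?lte_fin; last by have /andP[] := a01 i.
  rewrite addye ?ltxx// gt_eqF// (lt_le_trans ltNy0)// sume_ge0// => j _.
  by rewrite mule_ge0// lee_fin; have /andP[/ltW] := a01 j.
have := @pgf_simple (size s) B a mB tB Boo a01.
rewrite (_ : \sum_(i < size s) _ = fine (\int[mu]_x (g x)%:E)); last first.
  rewrite intE -sum_fine; last by move=> i _; rewrite fin_numM// ge0_fin_numE.
  by apply: eq_bigr => i _; rewrite fineM// ge0_fin_numE.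
apply: cvg_trans; apply: near_eq_cvg; apply: nearW => K /=.
by apply: eq_Ex => w; apply: eq_bigr => k _; rewrite gE.
Qed.

(** Simple functions g increase to v. The expectations decrease in v and in the
number K of factors. Hence, for every K, the expectation for v is at most the one
for g, whose limit in K is known, and it is at least the limit over g of the
exponentials, as each of these is below its expectation. *)
Lemma pgf (v : Z -> R) : measurable_fun setT v -> (forall x, 0 <= v x <= 1) ->
  (\int[mu]_x (v x)%:E < +oo)%E ->
  (fun K => Ex P (fun w => \prod_(k < K) (1 - v (z k w)))) @ \oo
  --> expR (- fine (\int[mu]_x (v x)%:E)).
Proof.
move=> mv v01 voo.
have mEv : measurable_fun setT (EFin \o v) by exact/measurable_EFinP.
have v0 x : 0 <= v x by have /andP[] := v01 x.
have [g [gnd gc gv]] := simple_approx mv v0.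
have g0 n x : 0 <= g n x by exact: fun_ge0.
have v1 x : v x <= 1 by have /andP[] := v01 x.
have g1 n x : g n x <= 1 := le_trans (gv n x) (v1 x).
have le_int n : (\int[mu]_x (g n x)%:E <= \int[mu]_x (v x)%:E)%E.
  apply: ge0_le_integral => //.
  - by move=> x _; rewrite lee_fin.
  - exact/measurable_EFinP.
  - by move=> x _; rewrite lee_fin.
have goo : forall n, (\int[mu]_x (g n x)%:E < +oo)%E.
  by move=> n; exact: le_lt_trans (le_int n) voo.
have int_c : (fun n => fine (\int[mu]_x (g n x)%:E)) @ \oo --> fine (\int[mu]_x (v x)%:E).
  apply: fine_cvg; rewrite fineK ?ge0_fin_numE//; last by apply: integral_ge0 => x _; rewrite lee_fin.
  rewrite (_ : (\int[mu]_x (v x)%:E = \int[mu]_x limn (fun n => (g n x)%:E))%E).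
    apply: cvg_monotone_convergence => //.
    - by move=> n; exact/measurable_EFinP.
    - by move=> n x _; rewrite lee_fin.
    - by move=> x _ m m' mm'; rewrite lee_fin; exact: gnd.
  apply: eq_integral => x _; apply/esym/cvg_lim => //.
  by apply: (cvg_comp _ _ (gc x)).
pose L (u : Z -> R) K := Ex P (fun w => \prod_(k < K) (1 - u (z k w))).
have bL (u : Z -> R) K : measurable_fun setT u -> (forall x, 0 <= u x <= 1) ->
    bm (fun w => \prod_(k < K) (1 - u (z k w))).
  move=> mu' u01; apply: bm_prod => k _; apply: bm_unit.
    by apply: measurable_funB => //; exact: measurableT_comp.
  by move=> w; have := u01 (z k w); lra.
have g01 n x : 0 <= g n x <= 1 by rewrite g0 g1.
have L_u n K : L v K <= L (g n) K.
  apply: le_Ex; [exact: bL|exact: bL|move=> w].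
  apply: ler_prod => k _; have := v01 (z k w); have := gv n (z k w); lra.
have L_K (u : Z -> R) : measurable_fun setT u -> (forall x, 0 <= u x <= 1) ->
    nonincreasing_seq (L u).
  move=> mu' u01; apply/nonincreasing_seqP => K.
  apply: le_Ex; [exact: bL|exact: bL|move=> w]; rewrite big_ord_recr/=.
  apply: ler_piMr; last by have := u01 (z K w); lra.
  by apply: prodr_ge0 => k _; have := u01 (z k w); lra.
have L_g n K : expR (- fine (\int[mu]_x (g n x)%:E)) <= L (g n) K.
  rewrite -(cvg_lim (@Rhausdorff R) (@pgf_nnsfun (g n) (g1 n) (goo n))).
  apply: nonincreasing_cvgn_ge; first exact: L_K.
  by apply/cvg_ex; eexists; exact: pgf_nnsfun.
have eint_c : (fun n => expR (- fine (\int[mu]_x (g n x)%:E))) @ \oo -->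
    expR (- fine (\int[mu]_x (v x)%:E)).
  by apply: continuous_cvg; [exact: continuous_expR|exact: cvgN].
have L_v K : expR (- fine (\int[mu]_x (v x)%:E)) <= L v K.
  have c : (fun n => L (g n) K) @ \oo --> L v K.
    apply: (@Ex_cvg _ _ _ P _ _ 1 _ _ _).2.
    - by move=> n; case: (bL (g n) K).
    - move=> n w; rewrite normr_prod; apply: prodr_ile1 => k _.
      by rewrite normr_ge0/= ger0_norm; have := g01 n (z k w); lra.
    - move=> w; apply: cvg_prodr => k; apply: cvgB; [exact: cvg_cst|exact: gc].
  by apply: (ler_cvg_to eint_c c); exact: nearW.
apply/cvgrPdist_le => e e0.
have e20 : 0 < e / 2 by rewrite divr_gt0.
have [N _ /(_ N (leqnn N)) hN] := (cvgrPdist_le _ _).1 eint_c _ e20.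
have [K0 _ hK] := (cvgrPdist_le _ _).1 (@pgf_nnsfun (g N) (g1 N) (goo N)) _ e20.
exists K0 => // K /= KK0; have := hK K KK0; rewrite -/(L (g N) K) -/(L v K).
move: hN => /=; have := L_u N K; have := L_v K; rewrite !ler_norml; lra.
Qed.

End poisson_process.

(** * Conditioning the counts on the points *)

Section conditional_probability_integral.
Context d (T : measurableType d) (R : realType) (P : probability T R).
Context (G : set (set T)).
Local Open Scope ring_scope.
Local Notation bm := (@bounded_measurable d T R).
Local Notation TG := (g_sigma_algebraType G).
Import HBNNSimple.

Lemma sfun_sum dT' (T' : measurableType dT') (g : {nnsfun T' >-> R}) :
  exists s : seq R, (forall y, y \in s -> exists x, g x = y) /\
   forall x, g x = \sum_(y <- s) y * \1_(g @^-1` [set y]) x.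
Proof.
exists (finmap.enum_fset (fset_set (range g))); split.
  by move=> y; rewrite (in_fset_set (fimfunP g) y) inE => -[x _ <-]; exists x.
move=> x; rewrite -[LHS](@sum_indic_seq _ (finmap.enum_fset (fset_set (range g)))).
- apply: eq_bigr => y _; congr (_ * _).
  rewrite indicE; congr (nat_of_bool _)%:R.
  by apply/eqP/idP => [e|]; rewrite ?inE// /preimage/=.
- exact: finmap.fset_uniq.
- by move=> _; rewrite (in_fset_set (fimfunP g) (g x)) inE; exists x.
Qed.

Hypothesis subG : <<s G>> `<=` measurable.

Lemma sub_measurable_fun (D : T -> R) : measurable_fun setT (D : TG -> R) ->
  measurable_fun setT D.
Proof.
move=> mD _ B mB; apply: subG.
by have := mD measurableT B mB.
Qed.

(** A conditional probability is tested on events; it can be tested on bounded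
functions D because these are limits of simple functions. *)
Lemma conditional_Ex (E : set T) (Y D : T -> R) : measurable E ->
  conditional_probability P <<s G>> E Y -> (forall w, 0 <= Y w <= 1) ->
  measurable_fun setT (D : TG -> R) -> (forall w, 0 <= D w <= 1) ->
  Ex P (fun w => D w * \1_E w) = Ex P (fun w => D w * Y w).
Proof.
move=> mE [mY YE] Y01 mD D01.
have bE : bm (\1_E) by exact: bm_indic.
have bY : bm Y.
  apply: bm_unit => // _ B mB; rewrite setTI; apply: subG; exact: mY.
have D0 x : 0 <= D x by have /andP[] := D01 x.
have [g [_ gc gD]] := @simple_approx R _ TG D mD D0.
have g1 n x : `|g n x| <= 1.
  by rewrite ger0_norm ?fun_ge0// (le_trans (gD n x))//; have /andP[] := D01 x.
have mg n : measurable_fun setT (g n : T -> R) by apply: sub_measurable_fun.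
have step n : Ex P (fun w => g n w * \1_E w) = Ex P (fun w => g n w * Y w).
  have [s [_ gE]] := sfun_sum (g n).
  have mC y : <<s G>> (g n @^-1` [set y]).
    by have := @measurable_funPTI _ _ _ _ (g n) [set y] (measurable_set1 y).
  have bC y : bm (\1_(g n @^-1` [set y])) by apply: bm_indic; exact: (subG (mC y)).
  have aux (W : T -> R) : bm W -> Ex P (fun w => g n w * W w) =
      \sum_(y <- s) y * Ex P (fun w => \1_(g n @^-1` [set y]) w * W w).
    move=> bW; transitivity (Ex P (fun w => \sum_(y <- s) y * (\1_(g n @^-1` [set y]) w * W w))).
      by apply: eq_Ex => w; rewrite gE big_distrl/=; apply: eq_bigr => y _; rewrite mulrA.
    rewrite Ex_sum; last by move=> y _; apply: bmZ; exact: bmM.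
    by apply: eq_bigr => y _; rewrite ExZ//; exact: bmM.
  rewrite !aux//; apply: eq_bigr => y _; congr (_ * _).
  apply: EFin_inj; rewrite !EFin_Ex; [|exact: bmM|exact: bmM].
  transitivity (P (E `&` (g n @^-1` [set y]))).
    transitivity (\int[P]_w (\1_(E `&` (g n @^-1` [set y])) w)%:E)%E.
      by apply: eq_integral => w _; rewrite indicI/= mulrC.
    by rewrite integral_indic ?setIT//; apply: measurableI => //; exact: (subG (mC y)).
  rewrite YE// integral_mkcond; apply: eq_integral => w _.
  by rewrite patchE indicE; case: ifP => _; rewrite ?mul1r ?mul0r.
have lim_ (W : T -> R) : bm W -> (forall w, `|W w| <= 1) ->
    (fun n => Ex P (fun w => g n w * W w)) @ \oo --> Ex P (fun w => D w * W w).
  move=> [mW _] W1; apply: (@Ex_cvg _ _ _ P _ _ 1 _ _ _).2.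
  - by move=> n; exact: measurable_funM.
  - by move=> n w; rewrite normrM -[leRHS]mulr1 ler_pM.
  - by move=> w; apply: cvgMl; exact: gc.
have lE := lim_ _ bE _; have lY := lim_ _ bY _.
have : (fun n => Ex P (fun w => g n w * \1_E w)) @ \oo --> Ex P (fun w => D w * Y w).
  rewrite (_ : (fun n => _) = (fun n => Ex P (fun w => g n w * Y w))); last exact/funext.
  by apply: lY => w; have /andP[? ?] := Y01 w; rewrite ger0_norm.
apply: cvg_unique => //; apply: lE => w.
by rewrite indicE; case: (_ \in _); rewrite ?normr0 ?normr1.
Qed.

End conditional_probability_integral.

Section array_counts.
Context d (T : measurableType d) (R : realType) (P : probability T R).
Context d' (Psi : measurableType d') (h : nat -> R -> R) (hh : pmf_family h).
Context (theta : nat -> T -> R) (psi : nat -> T -> Psi).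
Context (x : nat -> nat -> {mfun T >-> nat}).
Local Open Scope ring_scope.
Local Notation bm := (@bounded_measurable d T R).
Hypothesis theta0 : forall k w, 0 <= theta k w.
Hypothesis mtheta : forall k, measurable_fun setT (theta k).
Hypothesis mpsi : forall k, measurable_fun setT (psi k).
Hypothesis hx : conditionally_independent_counts P h theta psi x.

Let zz k w := ((theta k w : measurableTypeR R), psi k w).
Definition points_system : set (set T) :=
  \bigcup_(i in [set: nat]) preimage_set_system setT (zz i) measurable.
Local Notation TG := (g_sigma_algebraType points_system).

Lemma points_system_sub : <<s points_system >> `<=` measurable.
Proof.
apply: smallest_sub; first exact: sigma_algebra_measurable.
move=> _ [k _ [B mB <-]]; have : measurable_fun setT (zz k) by apply: measurable_fun_pair; [exact: mtheta|exact: mpsi].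
by move=> /(_ measurableT B mB).
Qed.

Lemma measurable_points k : measurable_fun setT (zz k : TG -> measurableTypeR R * Psi).
Proof.
move=> _ B mB; apply: sub_sigma_algebra; exists k => //.
by exists B.
Qed.

Lemma h_ge0 n t : 0 <= t -> 0 <= h n t.
Proof. by move=> t0; have [_ /(_ t t0)[]] := hh. Qed.

Lemma series_h t : 0 <= t -> series (fun n => h n t) @ \oo --> (1 : R).
Proof.
move=> t0; have [_ /(_ t t0)[h0 h1]] := hh.
have c : cvgn (eseries (fun n => (h n t)%:E)).
  by apply: is_cvg_nneseries => n _ _; rewrite lee_fin.
have : eseries (fun n => (h n t)%:E) @ \oo --> (1 : \bar R)%E.
  by rewrite -h1; exact: c.
move=> /fine_cvg /=; apply: cvg_trans; apply: near_eq_cvg; apply: nearW => n /=.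
by rewrite /eseries/series/= sumEFin.
Qed.

Lemma sum_h_le1 n t : 0 <= t -> \sum_(0 <= i < n) h i t <= 1.
Proof.
move=> t0; rewrite -(cvg_lim (@Rhausdorff R) (series_h t0)).
apply: (@nondecreasing_cvgn_le _ (series (fun n => h n t))).
  by apply/nondecreasing_seqP => m; rewrite /series/= big_nat_recr//= lerDl h_ge0.
by apply/cvg_ex; eexists; exact: series_h.
Qed.

Lemma h_le1 n t : 0 <= t -> h n t <= 1.
Proof.
move=> t0; apply: le_trans (sum_h_le1 n.+1 t0); rewrite big_nat_recr//= lerDr.
by apply: sumr_ge0 => i _; exact: h_ge0.
Qed.

Lemma measurable_htheta n k : measurable_fun setT (fun w => h n (theta k w)).
Proof.
apply: (@measurable_comp _ _ _ _ _ _ (`[0, +oo[ : set R)) => //.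
- by move=> _ [w _ <-] /=; rewrite in_itv/= theta0.
- by have [] := hh.
Qed.

(** The conditional law of the counts is given for rectangular arrays only.
Summing over all values of one entry removes this entry on both sides, since
the indicators and the probabilities h both sum to 1; so the formula descends
from a large rectangle to any finite set of entries. *)
Lemma array_counts (D : T -> R) : measurable_fun setT (D : TG -> R) ->
  (forall w, 0 <= D w <= 1) ->
  forall (s : seq (nat * nat)) (v : nat * nat -> nat), uniq s ->
  Ex P (fun w => D w * \prod_(i <- s) (x i.1 i.2 w == v i)%:R) =
  Ex P (fun w => D w * \prod_(i <- s) h (v i) (theta i.2 w)).
Proof.
move=> mD D01.
have bD : bm D by apply: bm_unit => //; exact: sub_measurable_fun points_system_sub _ mD.
have mxv i n : measurable [set w | x i.1 i.2 w == n].
  rewrite (_ : mkset _ = x i.1 i.2 @^-1` [set n]); first exact: measurable_funPTI.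
  by apply/seteqP; split=> w /= /eqP.
have bxv i n : bm (fun w => (x i.1 i.2 w == n)%:R).
  by rewrite -(funext (indic_bool R (fun w => x i.1 i.2 w == n))); exact: bm_indic.
have bh n k : bm (fun w => h n (theta k w)).
  by apply: bm_unit; [exact: measurable_htheta|move=> w; rewrite h_ge0//= h_le1].
pose claim s := forall v : nat * nat -> nat,
  Ex P (fun w => D w * \prod_(i <- s) (x i.1 i.2 w == v i)%:R) =
  Ex P (fun w => D w * \prod_(i <- s) h (v i) (theta i.2 w)).
(* Summation over the value of the entry i. *)
have step i s : uniq (i :: s) -> claim (i :: s) -> claim s.
  move=> /=/andP[iNs us] cs v.
  have vs (n : nat) (F : nat * nat -> nat -> R) : \prod_(j <- s) F j (if j == i then n else v j) =
      \prod_(j <- s) F j (v j).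
    by apply: eq_big_seq => j js; case: eqVneq => // ji; rewrite -ji js in iNs.
  have cn n : Ex P (fun w => (D w * \prod_(i <- s) (x i.1 i.2 w == v i)%:R) * (x i.1 i.2 w == n)%:R) =
      Ex P (fun w => (D w * \prod_(i <- s) h (v i) (theta i.2 w)) * h n (theta i.2 w)).
    have := cs (fun j => if j == i then n else v j).
    under eq_Ex do rewrite big_cons eqxx (vs n (fun i n => (x i.1 i.2 _ == n)%:R)) mulrCA mulrC.
    move=> ->; apply: eq_Ex => w.
    by rewrite big_cons eqxx (vs n (fun i n => h n (theta i.2 w))); ring.
  have lim (W : T -> R) (u : nat -> T -> R) : bm W -> (forall n, bm (u n)) ->
      (forall n w, 0 <= u n w) -> (forall n w, \sum_(0 <= j < n) u j w <= 1) ->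
      (forall w, series (u ^~ w) @ \oo --> (1 : R)) ->
      series (fun n => Ex P (fun w => W w * u n w)) @ \oo --> Ex P W.
    move=> bW bu u0 u1 uc; have [_ [M WM]] := bW.
    rewrite (_ : series _ = fun n => Ex P (fun w => \sum_(0 <= j < n) W w * u j w)); last first.
      by apply/funext => n; rewrite /series/= Ex_sum// => j _; exact: bmM.
    apply: (@Ex_cvg _ _ _ P _ _ M _ _ _).2.
    - by move=> n; case: (@bm_sum _ _ R _ (index_iota 0 n) xpredT _ (fun j _ => bmM bW (bu j))).
    - move=> n w; rewrite -big_distrr/= normrM -[leRHS]mulr1 ler_pM//.
      by rewrite ger0_norm// sumr_ge0.
    - move=> w; under eq_fun do rewrite -big_distrr/=.
      have cw : (fun n => W w * series (u ^~ w) n) @ \oo --> W w * 1.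
        by apply: cvgMr; exact: uc.
      by rewrite mulr1 in cw; exact: cw.
  have bW1 : bm (fun w => D w * \prod_(i <- s) (x i.1 i.2 w == v i)%:R).
    by apply: bmM => //; apply: bm_prod => j _; exact: bxv.
  have bW2 : bm (fun w => D w * \prod_(i <- s) h (v i) (theta i.2 w)).
    by apply: bmM => //; apply: bm_prod => j _; exact: bh.
  have := lim _ (fun n w => (x i.1 i.2 w == n)%:R) bW1 (bxv i).
  rewrite (funext cn) => l1.
  have := lim _ (fun n w => h n (theta i.2 w)) bW2 (fun n => bh n i.2).
  move=> l2; apply: (cvg_unique (@Rhausdorff R) (l1 _ _ _) (l2 _ _ _)) => //.
  - move=> n w; have [xn|xn] := ltnP (x i.1 i.2 w) n; last first.
      rewrite big_nat_cond big1// => j /andP[/andP[_ jn] _].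
      by rewrite gtn_eqF// (leq_trans jn).
    rewrite (bigD1_seq (x i.1 i.2 w))/= ?iota_uniq ?mem_index_iota// eqxx.
    by rewrite big1 ?addr0// => j; rewrite eq_sym => /negbTE ->.
  - move=> w; apply: cvg_near_cst; exists (x i.1 i.2 w).+1 => // n /= xn.
    rewrite /series/= (bigD1_seq (x i.1 i.2 w))/= ?iota_uniq ?mem_index_iota// eqxx.
    by rewrite big1 ?addr0// => j; rewrite eq_sym => /negbTE ->.
  - by move=> n w; exact: h_ge0.
  - by move=> n w; exact: sum_h_le1.
  - by move=> w; exact: series_h.
have perm s s' : perm_eq s s' -> claim s -> claim s'.
  move=> ss' cs v; have := cs v.
  by under eq_Ex do rewrite (perm_big _ ss')/=; move=> ->; apply: eq_Ex => w; rewrite (perm_big _ ss').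
have drop t s : uniq (t ++ s) -> claim (t ++ s) -> claim s.
  elim: t => //= i t IH /andP[its uts] c; apply: IH => //; apply: step c.
  by rewrite /= its.
have box N K : claim [seq (n, k) | n <- iota 0 N, k <- iota 0 K].
  move=> v.
  have [mY YE] := hx N K (fun n k => v (n, k)).
  pose E := [set w | forall n k, (n < N)%N -> (k < K)%N -> x n k w = v (n, k)].
  have mE : measurable E.
    rewrite (_ : E = \bigcap_n \bigcap_k [set w | (n < N)%N -> (k < K)%N -> x n k w = v (n, k)]).
      apply: bigcapT_measurable => n; apply: bigcapT_measurable => k.
      case: (ltnP n N) => nN; last by rewrite (_ : mkset _ = setT)//; exact/seteqP.
      case: (ltnP k K) => kK; last by rewrite (_ : mkset _ = setT)//; exact/seteqP.
      rewrite (_ : mkset _ = [set w | x n k w == v (n, k)]); first exact: (mxv (n, k)).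
      by apply/seteqP; split=> w /= => [/(_ isT isT) ->|/eqP].
    by apply/seteqP; split=> w /= H; [move=> n _ k _; exact: H|move=> n k; exact: H].
  transitivity (Ex P (fun w => D w * \1_E w)).
    apply: eq_Ex => w; congr (_ * _).
    rewrite indicE; have [wE|wE] := boolP (w \in E).
      rewrite big1_seq// => -[n k] /andP[_ /allpairsP[[n' k'] /= [n'N k'K [-> ->]]]].
      rewrite !mem_iota/= !add0n in n'N k'K.
      by rewrite (set_mem wE) ?eqxx.
    have : exists2 i, i \in [seq (n, k) | n <- iota 0 N, k <- iota 0 K] & x i.1 i.2 w != v i.
      apply: contrapT => H; move/negP: wE; apply; apply/mem_set => n k nN kK.
      apply: contrapT => xv; apply: H; exists (n, k); last exact/eqP.
      by apply/allpairsP; exists (n, k); rewrite !mem_iota.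
    move=> [i ins /negbTE xi].
    by rewrite (big_rem i)//= xi mul0r.
  rewrite (@conditional_Ex _ _ _ P points_system points_system_sub E
    (fun w => \prod_(n < N) \prod_(k < K) h (v (nat_of_ord n, nat_of_ord k)) (theta k w))) //.
    apply: eq_Ex => w; rewrite big_allpairs_dep/=; congr (_ * _).
    rewrite -[in RHS](subn0 N) -/(index_iota 0 N) big_mkord; apply: eq_bigr => n _.
    by rewrite -[in RHS](subn0 K) -/(index_iota 0 K) big_mkord.
  move=> w; apply/andP; split.
    by apply: prodr_ge0 => n _; apply: prodr_ge0 => k _; exact: h_ge0.
  apply: prodr_ile1 => n _; rewrite prodr_ge0/=; last by move=> k _; exact: h_ge0.
  by apply: prodr_ile1 => k _; rewrite h_ge0// h_le1.
move=> s v us.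
have [N [K sb]] := sub_rectangle s.
have pb := perm_filter_cat (uniq_rectangle N K) us sb.
apply: (drop _ _ _ (perm _ _ pb (box N K))); by rewrite -(perm_uniq pb) uniq_rectangle.
Qed.

End array_counts.

(** * The law of the points of a class, read off its generating functional *)

Section extraction.
Context d (T : measurableType d) (R : realType) (P : probability T R).
Context dZ (Z : measurableType dZ) (z : nat -> T -> Z) (b : nat -> T -> bool).
Local Open Scope ring_scope.
Local Notation bm := (@bounded_measurable d T R).
Hypothesis mz : forall k, measurable_fun setT (z k).
Hypothesis mb : forall k, measurable [set w | b k w].

Definition class_point (i : nat) w : Z := z (kth (b ^~ w) i) w.

Lemma measurable_class_point i : measurable_fun setT (class_point i).
Proof.
apply: (@measurable_nat_comp _ _ _ _ (fun w => kth (b ^~ w) i) z) => //.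
exact: measurable_kth.
Qed.

(** The conditional expectation, given the points, of the product of the g j
over the points when there are exactly r of them and they are labelled
uniformly at random. *)
Definition symm_count (r : nat) (g : 'I_r -> Z -> R) w : R :=
  (count_isb (b ^~ w) r)%:R * (r`!%:R^-1 * \sum_(s : 'S_r) \prod_(k < r) g (s k) (class_point k w)).

Lemma bm_count_isb r : bm (fun w => (count_isb (b ^~ w) r)%:R).
Proof.
rewrite -(funext (indic_bool R (fun w => count_isb (b ^~ w) r))).
by apply: bm_indic; exact: measurable_count_isb.
Qed.

Lemma bm_class_point (g : Z -> R) i : measurable_fun setT g -> (forall x, 0 <= g x <= 1) ->
  bm (fun w => g (class_point i w)).
Proof.
by move=> mg g01; apply: bm_unit => //; apply: measurableT_comp => //; exact: measurable_class_point.
Qed.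

Lemma bm_symm_count r (g : 'I_r -> Z -> R) : (forall j, measurable_fun setT (g j)) ->
  (forall j x, 0 <= g j x <= 1) -> bm (symm_count g).
Proof.
move=> mg g01; apply: bmM; first exact: bm_count_isb.
apply: bmZ; apply: bm_sum => s _; apply: bm_prod => k _; exact: bm_class_point.
Qed.

Context (Y : T -> R) (bY : bm Y) (y l : R) (m : (Z -> R) -> R).
Hypothesis m0 : forall f : Z -> R, measurable_fun setT f -> (forall x, 0 <= f x <= 1) -> 0 <= m f.
Hypothesis msum : forall n (g : 'I_n -> Z -> R) (S : {set 'I_n}) (c : R), 0 < c ->
  (forall j, measurable_fun setT (g j)) -> (forall j x, 0 <= g j x <= 1) ->
  m (fun x => (\sum_(j in S) g j x) / c) = (\sum_(j in S) m (g j)) / c.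
(** The generating functional of the points, with the factor Y, is that of a
Poisson process of total mass l and mean functional m. *)
Hypothesis HY : forall (f : Z -> R) (s : R), measurable_fun setT f ->
  (forall x, 0 <= f x <= 1) -> 0 <= s < 1 ->
  Ex P (fun w => Y w * count_prod (b ^~ w) (fun k => s * f (z k w))) =
  y * expR (- l + s * m f).

Lemma exp_coeff_le (t : R) n : 0 <= t -> exp_coeff t n <= expR t.
Proof.
move=> t0; apply: (@le_trans _ _ (series (exp_coeff t) n.+1)).
  rewrite /series/= big_nat_recr//= lerDr sumr_ge0// => i _.
  by rewrite exp_coeff_ge0.
apply: nondecreasing_cvgn_le; last exact: is_cvg_series_exp_coeff.
by apply/nondecreasing_seqP => k; rewrite /series/= big_nat_recr//= lerDl exp_coeff_ge0.
Qed.

(** Both sides are the coefficients of s ^ r in the same power series, by HY. *)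
Lemma extract_power (f : Z -> R) r : measurable_fun setT f ->
  (forall x, 0 <= f x <= 1) ->
  Ex P (fun w => Y w * ((count_isb (b ^~ w) r)%:R * \prod_(i < r) f (class_point i w))) =
  y * expR (- l) * (m f ^+ r / r`!%:R).
Proof.
move=> mf f01; have [mY [M YM]] := bY.
have M0 : 0 <= M by exact: le_trans (YM point).
have bG q : bm (fun w => \prod_(i < q) f (class_point i w)).
  by apply: bm_prod => i _; exact: bm_class_point.
have G1 q w : `|\prod_(i < q) f (class_point i w)| <= 1.
  rewrite normr_prod; apply: prodr_ile1 => i _.
  by have /andP[? ?] := f01 (class_point i w); rewrite normr_ge0/= ger0_norm.
have bH q : bm (fun w => Y w * ((count_isb (b ^~ w) q)%:R * \prod_(i < q) f (class_point i w))).
  by apply: bmM => //; apply: bmM => //; exact: bm_count_isb.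
apply: (@power_series_unique R
  (fun r => Ex P (fun w => Y w * ((count_isb (b ^~ w) r)%:R * \prod_(i < r) f (class_point i w))))
  (fun r => y * expR (- l) * (m f ^+ r / r`!%:R)) M (`|y * expR (- l)| * expR (m f))).
- move=> q; apply: normr_Ex_le => // w; rewrite normrM -[leRHS]mulr1.
  apply: ler_pM => //; rewrite normrM; apply: mulr_ile1 => //.
  by case: count_isb; rewrite ?normr1 ?normr0.
- move=> q; rewrite normrM ler_wpM2l// ger0_norm; first by apply: exp_coeff_le; exact: m0.
  by rewrite divr_ge0// exprn_ge0// m0.
move=> s s0 s1; exists (y * expR (- l + s * m f)); split.
  have s01 : 0 <= s < 1 by rewrite ltW.
  have [||_] := @Ex_series_count_isb _ T R P b mb Y (fun q w => s ^+ q * \prod_(i < q) f (class_point i w)) bY.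
  - by move=> q; case: (bmZ (s ^+ q) (bG q)).
  - move=> q w; rewrite normrM mulr_ile1// normrX exprn_ile1// ger0_norm; exact: ltW.
  rewrite (_ : Ex P (fun w => Y w * ((finite_count (b ^~ w))%:R * _)) = y * expR (- l + s * m f)); last first.
    rewrite -HY//; apply: eq_Ex => w; rewrite /count_prod; congr (_ * (_ * _)).
    by rewrite big_split/= big_const_ord iter_mulr_1.
  apply: cvg_trans; apply: near_eq_cvg; apply: nearW => n.
  rewrite /series/=; apply: eq_bigr => q _.
  by rewrite mulrC -ExZ//; apply: eq_Ex => w; ring.
rewrite (_ : series _ = fun n => y * expR (- l) * series (exp_coeff (s * m f)) n).
  rewrite expRD mulrA; apply: cvgMr; exact: is_cvg_series_exp_coeff.
apply/funext => n; rewrite /series/= big_distrr/=; apply: eq_bigr => i _.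
by rewrite /exp_coeff/= exprMn; ring.
Qed.

(** The product of the g j, symmetrised over the labels, is by polarization a
combination of products of a single function along all points, whose law is
[extract_power]; on the right polarization is undone. *)
Lemma extract_symm r (g : 'I_r -> Z -> R) : (forall j, measurable_fun setT (g j)) ->
  (forall j x, 0 <= g j x <= 1) ->
  Ex P (fun w => Y w * symm_count g w) =
  y * (expR (- l) * (\prod_(j < r) m (g j) / r`!%:R)).
Proof.
move=> mg g01.
(* Dividing by r + 1 keeps the sums of the g j, for j in S, below 1. *)
pose c : R := r.+1%:R; have c0 : 0 < c by rewrite ltr0n.
pose f (S : {set 'I_r}) x := (\sum_(j in S) g j x) / c.
have mf S : measurable_fun setT (f S).
  apply: measurable_funM => //.
  by case: (@bm_sum dZ Z R _ (index_enum 'I_r) (mem S) g (fun j _ => bm_unit (mg j) (g01 j))).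
have f01 S x : 0 <= f S x <= 1.
  rewrite divr_ge0 ?(ltW c0) ?sumr_ge0//=; last by move=> j _; have /andP[] := g01 j x.
  rewrite ler_pdivrMr// mul1r (@le_trans _ _ (\sum_(j < r) 1))//.
    rewrite big_mkcond/=; apply: ler_sum => j _; have /andP[? ?] := g01 j x.
    by case: ifP.
  by rewrite sumr_const card_ord ler_nat.
have bH S : bm (fun w => Y w * ((count_isb (b ^~ w) r)%:R * \prod_(i < r) f S (class_point i w))).
  apply: bmM => //; apply: bmM; first exact: bm_count_isb.
  by apply: bm_prod => i _; exact: bm_class_point.
transitivity (\sum_(S : {set 'I_r}) (polar_sign R S * (r`!%:R^-1 * c ^+ r)) *
    Ex P (fun w => Y w * ((count_isb (b ^~ w) r)%:R * \prod_(i < r) f S (class_point i w)))).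
  under [RHS]eq_bigr do rewrite -ExZ//.
  rewrite -Ex_sum; last by move=> S _; exact: bmZ.
  apply: eq_Ex => w; rewrite /symm_count.
  have := polarization (fun k j => g j (class_point k w)) => /= <-.
  rewrite !big_distrr/=; apply: eq_bigr => S _.
  have -> : \prod_(k < r) \sum_(j in S) g j (class_point k w) = c ^+ r * \prod_(k < r) f S (class_point k w).
    rewrite /f big_split/= big_const_ord iter_mulr_1 mulrCA -exprMn divff ?gt_eqF//.
    by rewrite expr1n mulr1.
  by ring.
under eq_bigr do rewrite extract_power// msum//.
transitivity (y * expR (- l) / r`!%:R / r`!%:R *
   \sum_(S : {set 'I_r}) polar_sign R S * \prod_(k < r) \sum_(j in S) m (g j)).
  rewrite big_distrr/=; apply: eq_bigr => S _.
  rewrite big_const_ord iter_mulr_1 exprMn exprVn.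
  by field; rewrite pnatr_eq0 -lt0n fact_gt0/= expf_neq0// gt_eqF.
have /= -> := @polarization R r (fun k j => m (g j)).
rewrite (eq_bigr (fun=> \prod_(j < r) m (g j))); last by move=> s _; rewrite [RHS](reindex_perm s).
rewrite sumr_const -[#|_|]/#|{: 'S_r}| card_Sn.
rewrite -mulr_natr.
have : (r`!%:R : R) != 0 by rewrite pnatr_eq0 -lt0n fact_gt0.
by move=> ?; field.
Qed.

End extraction.

(** * Classes of atoms and the marking theorem *)

Section classes.
Context d (T : measurableType d) (R : realType) (P : probability T R).
Context d' (Psi : measurableType d') (h : nat -> R -> R) (hh : pmf_family h).
Context (theta : nat -> T -> R) (psi : nat -> T -> Psi).
Context (x : nat -> nat -> {mfun T >-> nat}) (K0 : nat).
Local Open Scope ring_scope.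
Local Notation bm := (@bounded_measurable d T R).
Hypothesis theta0 : forall k w, 0 <= theta k w.
Hypothesis mtheta : forall k, measurable_fun setT (theta k).
Hypothesis mpsi : forall k, measurable_fun setT (psi k).
Hypothesis hx : conditionally_independent_counts P h theta psi x.
Local Notation Z := (measurableTypeR R * Psi)%type.
Local Notation class := (nat * nat)%type.
Local Notation TG := (g_sigma_algebraType (points_system theta psi)).

(** The conditional probability that an atom of weight t is in the class c:
observations before c.1 do not see it and observation c.1 sees it c.2 + 1
times. It is 0 for negative t, where h is arbitrary. *)
Definition class_weight (c : class) (t : R) : R :=
  if 0 <= t then h 0%N t ^+ c.1 * h c.2.+1 t else 0.

(** The first K0 atoms are those of fixed location, and k numbers the ordinary
atoms. *)
Definition in_class (c : class) k w : bool :=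
  [forall n : 'I_c.1, x n (K0 + k)%N w == 0%N] && (x c.1 (K0 + k)%N w == c.2.+1).

Definition ord_point k w : Z := (theta (K0 + k)%N w, psi (K0 + k)%N w).

Lemma measurable_ord_point k : measurable_fun setT (ord_point k).
Proof. by apply: measurable_fun_pair; [exact: mtheta|exact: mpsi]. Qed.

Lemma in_class_uniq c c' k w : in_class c k w -> in_class c' k w -> c = c'.
Proof.
move: c c' => [m y] [m' y'] /andP[/forallP/= a0 /eqP/= ay] /andP[/forallP/= b0 /eqP/= by_].
have [mm|mm|mm] := ltngtP m m'.
- by have := b0 (Ordinal mm); rewrite /= ay.
- by have := a0 (Ordinal mm); rewrite /= by_.
- by move: ay by_; rewrite mm => -> [->].
Qed.

Lemma in_classE c k w : (in_class c k w)%:R = \prod_(n <- iota 0 c.1.+1)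
  (x n (K0 + k)%N w == if (n < c.1)%N then 0%N else c.2.+1)%:R :> R.
Proof.
rewrite -addn1 iotaD add0n big_cat/= big_seq1 ltnn /in_class -mulnb natrM; congr (_ * _).
case: forallP => [H|/forallP].
  rewrite big1_seq// => n /andP[_]; rewrite mem_iota add0n => /= nc.
  by rewrite nc (H (Ordinal nc)).
rewrite negb_forall => /existsP[n xn].
have nin : nat_of_ord n \in iota 0 c.1 by rewrite mem_iota add0n/=.
by rewrite (big_rem _ nin)/= ltn_ord (negbTE xn) mul0r.
Qed.

Lemma class_weightE c t : 0 <= t -> class_weight c t = \prod_(n <- iota 0 c.1.+1)
  h (if (n < c.1)%N then 0%N else c.2.+1) t.
Proof.
move=> t0; rewrite -addn1 iotaD add0n big_cat/= big_seq1 ltnn /class_weight t0; congr (_ * _).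
rewrite (eq_big_seq (fun=> h 0%N t)); last first.
  by move=> n; rewrite mem_iota add0n/= => ->.
by rewrite -[in RHS](subn0 c.1) -/(index_iota 0 c.1) prodr_const_nat subn0.
Qed.

Lemma class_weight_ge0 c t : 0 <= class_weight c t.
Proof. by rewrite /class_weight; case: ifP => // t0; rewrite mulr_ge0 ?exprn_ge0 ?(h_ge0 hh). Qed.

(** The classes are disjoint events; on the level of weights, the sum over the
values y is at most [1 - h 0 t] and the sum over m is geometric. *)
Lemma sum_class_weight_le1 (C : seq class) t : uniq C -> \sum_(c <- C) class_weight c t <= 1.
Proof.
move=> uC; have [t0|t0] := boolP (0 <= t); last first.
  by rewrite big1// => c _; rewrite /class_weight (negbTE t0).
have [M [Y CB]] := sub_rectangle C.
pose B := [seq (m, y) | m <- iota 0 M, y <- iota 0 Y]; rewrite -/B in CB.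
apply: (@le_trans _ _ (\sum_(c <- B) class_weight c t)).
  have pB := perm_filter_cat (uniq_rectangle M Y) uC CB.
  by rewrite (perm_big _ pB)/= big_cat/= lerDr sumr_ge0// => c _; exact: class_weight_ge0.
rewrite big_allpairs_dep/=.
have h0 := h_ge0 hh 0 t0.
apply: (@le_trans _ _ (\sum_(m <- iota 0 M) h 0%N t ^+ m * (1 - h 0%N t))).
  apply: ler_sum => m _; rewrite /class_weight t0/= -big_distrr/= ler_wpM2l ?exprn_ge0//.
  rewrite lerBrDl; apply: le_trans (sum_h_le1 hh Y.+1 t0).
  rewrite [leRHS]big_ltn//= lerD2l.
  by rewrite -[in leLHS](subn0 Y) -/(index_iota 0 Y) big_add1.
rewrite -[in leLHS](subn0 M) -/(index_iota 0 M).
rewrite big_mkord -big_distrl/=.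
have -> : (\sum_(i < M) h 0%N t ^+ i) * (1 - h 0%N t) = 1 - h 0%N t ^+ M.
  by rewrite -[RHS]opprB subrX1; ring.
by rewrite lerBlDr lerDl exprn_ge0.
Qed.

Lemma measurable_class_weight c : measurable_fun setT (class_weight c).
Proof.
have m0 : measurable (`[0, +oo[ : set R) by [].
rewrite (_ : class_weight c = (fun t => h 0%N t ^+ c.1 * h c.2.+1 t) \_ (`[0, +oo[ : set R)).
  apply/(measurable_restrictT _ _).1 => //.
  have mh n : measurable_fun (`[0, +oo[ : set R) (h n) by have [] := hh.
  by apply: measurable_funM => //; exact: measurable_funX.
apply/funext => t; rewrite patchE /class_weight.
have -> : (t \in (`[0, +oo[%classic : set R)) = (0 <= t) by rewrite mem_setE in_itv/= andbT.
by [].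
Qed.

Lemma measurable_in_class c k : measurable [set w | in_class c k w].
Proof.
have mxv n l v : measurable [set w | x n l w == v].
  rewrite (_ : mkset _ = x n l @^-1` [set v]); first exact: measurable_funPTI.
  by apply/seteqP; split=> w /= /eqP.
rewrite (_ : mkset _ = (\bigcap_(n in [set n | (n < c.1)%N]) [set w | x n (K0 + k)%N w == 0%N])
   `&` [set w | x c.1 (K0 + k)%N w == c.2.+1]).
  apply: measurableI => //.
  case: (posnP c.1) => [c0|c0].
    by rewrite (_ : [set n | _] = set0) ?bigcap_set0//; apply/seteqP; split=> // n; rewrite /= c0.
  by apply: bigcap_measurable => //; exists 0%N.
apply/seteqP; split=> w /=.
  by move=> /andP[/forallP H ->]; split=> // n nc; exact: (H (Ordinal nc)).
by move=> [H e]; rewrite /in_class e andbT; apply/forallP => n; exact: (H n (ltn_ord n)).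
Qed.

Lemma bm_in_class c k : bm (fun w => (in_class c k w)%:R).
Proof. by rewrite -(funext (indic_bool R (in_class c k))); apply: bm_indic; exact: measurable_in_class. Qed.

Lemma measurable_class_weight_theta c k : measurable_fun setT (fun w => class_weight c (theta k w)).
Proof. by apply: measurableT_comp => //; exact: measurable_class_weight. Qed.

Lemma class_weight_le1 c t : class_weight c t <= 1.
Proof. by have := @sum_class_weight_le1 [:: c] t isT; rewrite big_seq1. Qed.

Lemma bm_class_weight c k : bm (fun w => class_weight c (theta k w)).
Proof.
by apply: bm_unit; [exact: measurable_class_weight_theta|move=> w; rewrite class_weight_ge0 class_weight_le1].
Qed.

Lemma class_counts (D : T -> R) : measurable_fun setT (D : TG -> R) ->
  (forall w, 0 <= D w <= 1) ->
  forall (ks : seq nat) (kap : nat -> class), uniq ks ->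
  Ex P (fun w => D w * \prod_(k <- ks) (in_class (kap k) k w)%:R) =
  Ex P (fun w => D w * \prod_(k <- ks) class_weight (kap k) (theta (K0 + k)%N w)).
Proof.
move=> mD D01 ks kap uks.
pose s := [seq (n, (K0 + k)%N) | k <- ks, n <- iota 0 (kap k).1.+1].
pose v (i : nat * nat) := let c := kap (i.2 - K0)%N in if (i.1 < c.1)%N then 0%N else c.2.+1.
have us : uniq s.
  apply: allpairs_uniq_dep => //.
  - by move=> k _; exact: iota_uniq.
  - move=> [k n] [k' n'] _ _ /= [-> /addnI ->] //.
have := @array_counts _ T R P _ Psi h hh theta psi x theta0 mtheta mpsi hx D mD D01 s v us.
under eq_Ex do rewrite big_allpairs_dep/=.
under [in X in _ = X -> _]eq_Ex do rewrite big_allpairs_dep/=.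
move=> e; transitivity (Ex P (fun w => D w * (\prod_(k <- ks) \prod_(n <- iota 0 (kap k).1.+1)
   (x n (K0 + k)%N w == v (n, (K0 + k)%N))%:R))).
  apply: eq_Ex => w; congr (_ * _); apply: eq_bigr => k _.
  by rewrite in_classE; apply: eq_bigr => n _; rewrite /v/= addKn.
rewrite e; apply: eq_Ex => w; congr (_ * _); apply: eq_bigr => k _.
by rewrite class_weightE//; apply: eq_bigr => n _; rewrite /v/= addKn.
Qed.

(** The product is affine in the indicator of each class for each atom, so
these indicators can be replaced by their conditional probabilities one atom at
a time. Expanding the last factor turns its atom into one of prescribed class, so
the induction on K is for all lists ks of such atoms. *)
Lemma thinned_product (C : seq class) (q : class -> Z -> R) :
  (forall c, measurable_fun setT (q c)) -> (forall c z, 0 <= q c z <= 1) ->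
  forall K (ks : seq nat) (kap : nat -> class) (D : T -> R), uniq ks ->
  (forall k, k \in ks -> (K <= k)%N) ->
  measurable_fun setT (D : TG -> R) -> (forall w, 0 <= D w <= 1) ->
  Ex P (fun w => (D w * \prod_(k <- ks) (in_class (kap k) k w)%:R) *
     \prod_(k < K) (1 - \sum_(c <- C) (in_class c k w)%:R * q c (ord_point k w))) =
  Ex P (fun w => (D w * \prod_(k <- ks) class_weight (kap k) (theta (K0 + k)%N w)) *
     \prod_(k < K) (1 - \sum_(c <- C) class_weight c (theta (K0 + k)%N w) * q c (ord_point k w))).
Proof.
move=> mq q01; have bq c k : bm (fun w => q c (ord_point k w)).
  by apply: bm_unit => //; apply: measurableT_comp => //; exact: measurable_ord_point.
have b1 K : bm (fun w => \prod_(k < K) (1 - \sum_(c <- C) (in_class c k w)%:R * q c (ord_point k w))).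
  apply: bm_prod => k _; apply: bmB; first exact: bm_cst.
  by apply: bm_sum => c _; apply: bmM => //; exact: bm_in_class.
have b2 K : bm (fun w => \prod_(k < K) (1 - \sum_(c <- C) class_weight c (theta (K0 + k)%N w) * q c (ord_point k w))).
  apply: bm_prod => k _; apply: bmB; first exact: bm_cst.
  by apply: bm_sum => c _; apply: bmM => //; exact: bm_class_weight.
elim=> [|K IH] ks kap D uks ksK mD D01.
  under eq_Ex do rewrite big_ord0 mulr1.
  under [in RHS]eq_Ex do rewrite big_ord0 mulr1.
  exact: class_counts.
have bD : bm D.
  by apply: bm_unit => //; exact: sub_measurable_fun (points_system_sub mtheta mpsi) _ mD.
have bD1 : bm (fun w => D w * \prod_(k <- ks) (in_class (kap k) k w)%:R).
  by apply: bmM => //; apply: bm_prod => k _; exact: bm_in_class.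
have bD2 : bm (fun w => D w * \prod_(k <- ks) class_weight (kap k) (theta (K0 + k)%N w)).
  by apply: bmM => //; apply: bm_prod => k _; exact: bm_class_weight.
have KNks : K \notin ks by apply/negP => /ksK; rewrite ltnn.
have ks' k : k \in ks -> (K <= k)%N by move=> /ksK /ltnW.
have split_ (A B : T -> R) (F : class -> T -> R) : bm A -> bm B -> (forall c, bm (F c)) ->
    Ex P (fun w => A w * (B w * (1 - \sum_(c <- C) F c w))) =
    Ex P (fun w => A w * B w) - \sum_(c <- C) Ex P (fun w => A w * B w * F c w).
  move=> bA bB bF; have bAB := bmM bA bB.
  rewrite -Ex_sum; last by move=> c _; exact: bmM.
  rewrite -ExB//; last by apply: bm_sum => c _; exact: bmM.
  by apply: eq_Ex => w; rewrite mulrA mulrBr mulr1 big_distrr.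
under eq_Ex do rewrite big_ord_recr/=.
rewrite (split_ _ _ _ bD1 (b1 K)); last by move=> c; apply: bmM; [exact: bm_in_class|exact: bq].
under [in RHS]eq_Ex do rewrite big_ord_recr/=.
rewrite (split_ _ _ _ bD2 (b2 K)); last by move=> c; apply: bmM; [exact: bm_class_weight|exact: bq].
congr (_ - _); first exact: IH.
apply: eq_bigr => c _.
(* The indicator taken from the last factor prescribes the class of atom K. *)
pose kap' k := if k == K then c else kap k.
have kE (F : nat -> class -> R) : \prod_(k <- ks) F k (kap' k) = \prod_(k <- ks) F k (kap k).
  by apply: eq_big_seq => k kks; rewrite /kap'; case: eqVneq => // kK; rewrite -kK kks in KNks.
have := IH (K :: ks) kap' (fun w => D w * q c (ord_point K w)).
under eq_Ex do rewrite big_cons (kE (fun k c => (in_class c k _)%:R)) {1}/kap' eqxx.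
under [in X in _ = X]eq_Ex do rewrite big_cons (kE (fun k c => class_weight c (theta (K0 + k)%N _))) {1}/kap' eqxx.
move=> IH'.
transitivity (Ex P (fun w => D w * q c (ord_point K w) *
   ((in_class c K w)%:R * \prod_(k <- ks) (in_class (kap k) k w)%:R) *
   \prod_(k < K) (1 - \sum_(c <- C) (in_class c k w)%:R * q c (ord_point k w)))).
  by apply: eq_Ex => w; ring.
rewrite IH'.
- by apply: eq_Ex => w; ring.
- by rewrite /= KNks.
- by move=> k; rewrite inE => /predU1P[->//|]; exact: ks'.
- apply: measurable_funM => //.
  by apply: measurableT_comp => //; exact: measurable_points.
- move=> w; have := D01 w; have := q01 c (ord_point K w) => /andP[a b] /andP[e f].
  by rewrite mulr_ge0//= mulr_ile1.
Qed.

Context (mu : {measure set Z -> \bar R}).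
Hypothesis ppp : poisson_point_process P mu (fun w B => \sum_(k <oo) \d_(ord_point k w) B)%E.

(** The integral of f against the mean measure of the points of class c. *)
Definition class_integral (c : class) (f : Z -> R) : R := fine (\int[mu]_z (class_weight c z.1 * f z)%:E).

Hypothesis class_fin : forall c, (\int[mu]_z (class_weight c z.1)%:E < +oo)%E.

Lemma measurable_class_weightM c (f : Z -> R) : measurable_fun setT f ->
  measurable_fun setT (fun z : Z => class_weight c z.1 * f z).
Proof.
by move=> mf; apply: measurable_funM => //; apply: measurableT_comp => //; exact: measurable_class_weight.
Qed.

Let class_weightM_ge0 c (f : Z -> R) z : 0 <= f z <= 1 -> (0 <= (class_weight c z.1 * f z)%:E)%E.
Proof. by move=> /andP[f0 _]; rewrite lee_fin mulr_ge0 ?class_weight_ge0. Qed.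

Lemma class_integral_lty c (f : Z -> R) M : measurable_fun setT f -> (forall z, 0 <= f z <= M) ->
  (\int[mu]_z (class_weight c z.1 * f z)%:E < +oo)%E.
Proof.
move=> mf fM.
have M0 : 0 <= M by have /andP[] := fM point; exact: le_trans.
apply: (@le_lt_trans _ _ (\int[mu]_z (M%:E * (class_weight c z.1)%:E))%E).
  apply: ge0_le_integral => //.
  - by move=> z _; rewrite lee_fin mulr_ge0 ?class_weight_ge0//; have /andP[] := fM z.
  - by apply/measurable_EFinP; exact: measurable_class_weightM.
  - by apply/measurable_EFinP/measurable_funM => //; apply: measurableT_comp => //; exact: measurable_class_weight.
  - by move=> z _; rewrite -EFinM lee_fin mulrC ler_wpM2r ?class_weight_ge0//; have /andP[] := fM z.
rewrite ge0_integralZl_EFin//.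
- by rewrite lte_mul_pinfty// lee_fin.
- by move=> z _; rewrite lee_fin class_weight_ge0.
- by apply/measurable_EFinP; apply: measurableT_comp => //; exact: measurable_class_weight.
Qed.

Local Notation genfun C f s w :=
  (\prod_(c <- C) count_prod (in_class c ^~ w) (fun k => s c * f c (ord_point k w))).
Local Notation genfun_mass C f s :=
  (\prod_(c <- C) expR (- class_integral c (cst 1) + s c * class_integral c (f c))).

(** The product over the classes is a single product over the points, with at
most one class active at each of them. After replacing indicators by
conditional probabilities it has the form required by [pgf], and the exponent
that comes out is a sum over the classes. *)
Lemma class_pgf (C : seq class) (f : class -> Z -> R) (s : class -> R) : uniq C ->
  (forall c, measurable_fun setT (f c)) -> (forall c z, 0 <= f c z <= 1) ->
  (forall c, 0 <= s c < 1) ->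
  bm (fun w => genfun C f s w) /\
  Ex P (fun w => genfun C f s w) =
  genfun_mass C f s.
Proof.
move=> uC mf f01 s01.
pose q c z := 1 - s c * f c z.
have sf01 c z : 0 <= s c * f c z <= 1.
  have /andP[a b] := f01 c z; have /andP[e g] := s01 c.
  by rewrite mulr_ge0//= mulr_ile1// ltW.
have q01 c z : 0 <= q c z <= 1 by have := sf01 c z; rewrite /q; lra.
have mq c : measurable_fun setT (q c).
  by apply: measurable_funB => //; apply: measurable_funM.
pose v (z : Z) := \sum_(c <- C) class_weight c z.1 * q c z.
have mv : measurable_fun setT v by apply: measurable_sum => c; exact: measurable_class_weightM.
have v01 z : 0 <= v z <= 1.
  rewrite sumr_ge0/=; last by move=> c _; rewrite mulr_ge0 ?class_weight_ge0//; have /andP[] := q01 c z.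
  apply: le_trans (sum_class_weight_le1 z.1 uC); apply: ler_sum => c _.
  by rewrite ler_piMr ?class_weight_ge0//; have /andP[] := q01 c z.
have intv : (\int[mu]_z (v z)%:E = \sum_(c <- C) \int[mu]_z (class_weight c z.1 * q c z)%:E)%E.
  under eq_integral do rewrite -sumEFin.
  rewrite ge0_integral_sum//.
  - by move=> c; apply/measurable_EFinP; exact: measurable_class_weightM.
  - by move=> c z _; exact: class_weightM_ge0.
have qoo c : (\int[mu]_z (class_weight c z.1 * q c z)%:E < +oo)%E by exact: class_integral_lty (mq c) (q01 c).
have q0 c : (0 <= \int[mu]_z (class_weight c z.1 * q c z)%:E)%E.
  by apply: integral_ge0 => z _; exact: class_weightM_ge0.
have voo : (\int[mu]_z (v z)%:E < +oo)%E.
  by rewrite intv; apply: lte_sum_pinfty.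
have fineE c : fine (\int[mu]_z (class_weight c z.1 * q c z)%:E) = class_integral c (cst 1) - s c * class_integral c (f c).
  have /andP[s0 _] := s01 c.
  have foo : (\int[mu]_z (class_weight c z.1 * f c z)%:E < +oo)%E by exact: class_integral_lty (mf c) (f01 c).
  have f0 : (0 <= \int[mu]_z (class_weight c z.1 * f c z)%:E)%E.
    by apply: integral_ge0 => z _; exact: class_weightM_ge0.
  have : (\int[mu]_z (class_weight c z.1 * cst 1 z)%:E = \int[mu]_z (class_weight c z.1 * q c z)%:E +
      (s c)%:E * \int[mu]_z (class_weight c z.1 * f c z)%:E)%E.
    rewrite -ge0_integralZl_EFin//; last 2 first.
    - by move=> z _; exact: class_weightM_ge0.
    - by apply/measurable_EFinP; exact: measurable_class_weightM.
    rewrite -ge0_integralD//.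
    - by apply: eq_integral => z _; rewrite -EFinM -EFinD /q /cst; congr EFin; ring.
    - by move=> z _; exact: class_weightM_ge0.
    - by apply/measurable_EFinP; exact: measurable_class_weightM.
    - by move=> z _; rewrite mule_ge0// lee_fin mulr_ge0 ?class_weight_ge0//; have /andP[] := f01 c z.
    - apply/measurable_EFinP; apply: measurable_funM => //; exact: measurable_class_weightM.
  have F1 : (\int[mu]_z (class_weight c z.1 * q c z)%:E)%E \is a fin_num by rewrite ge0_fin_numE.
  have F2 : (\int[mu]_z (class_weight c z.1 * f c z)%:E)%E \is a fin_num by rewrite ge0_fin_numE.
  have F3 : ((s c)%:E * \int[mu]_z (class_weight c z.1 * f c z)%:E)%E \is a fin_num by rewrite fin_numM.
  rewrite /class_integral => ->; rewrite (fineD F1 F3) (fineM _ F2)//=.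
  by rewrite addrK.
have prodE k w : 1 - \sum_(c <- C) (in_class c k w)%:R * q c (ord_point k w) =
    \prod_(c <- C) (if in_class c k w then s c * f c (ord_point k w) else 1).
  case: (boolP (has (fun c => in_class c k w) C)) => [/hasP[c cC ck]|/hasPn/= nC].
    rewrite (bigD1_seq c)//= [RHS](bigD1_seq c)//= ck mul1r.
    have h0 c' : c' != c -> in_class c' k w = false.
      by move=> c'c; apply: contra_neqF c'c => /in_class_uniq; exact.
    rewrite !big1 ?addr0 ?mulr1; first by rewrite /q subKr.
    - by move=> c' /h0 ->.
    - by move=> c' /h0 ->; rewrite mul0r.
  rewrite big1_seq ?subr0; last by move=> c /andP[_ /nC/negbTE ->]; rewrite mul0r.
  by rewrite big1_seq// => c /andP[_ /nC/negbTE ->].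
have thE K : Ex P (fun w => \prod_(c <- C) \prod_(k < K | in_class c k w) (s c * f c (ord_point k w))) =
    Ex P (fun w => \prod_(k < K) (1 - v (ord_point k w))).
  have := @thinned_product C q mq q01 K [::] (fun=> (0%N, 0%N)) (cst 1) isT.
  move=> /(_ (fun k => ltac:(by [])) (measurable_cst _)) th.
  transitivity (Ex P (fun w => cst 1 w * \prod_(k <- [::]) (in_class (0%N, 0%N) k w)%:R *
     \prod_(k < K) (1 - \sum_(c <- C) (in_class c k w)%:R * q c (ord_point k w)))).
    apply: eq_Ex => w; rewrite big_nil mulr1 mul1r.
    under [RHS]eq_bigr do rewrite prodE.
    rewrite exchange_big/=; apply: eq_bigr => k _.
    by rewrite [LHS]big_mkcond.
  rewrite th; last by move=> w; rewrite /cst ler01 lexx.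
  by apply: eq_Ex => w; rewrite big_nil mulr1 mul1r.
have [|||bl cvl] := @Ex_cvg _ T R P
   (fun K w => \prod_(c <- C) \prod_(k < K | in_class c k w) (s c * f c (ord_point k w)))
   (fun w => genfun C f s w) 1.
- move=> K.
  have : bm (fun w => \prod_(c <- C) \prod_(k < K) (1 + (in_class c k w)%:R * (s c * f c (ord_point k w) - 1))).
    apply: bm_prod => c _; apply: bm_prod => k _; apply: bmD; first exact: bm_cst.
    apply: bmM; first exact: bm_in_class.
    apply: bmB; last exact: bm_cst.
    apply: bm_unit; last by move=> w; exact: sf01.
    by apply: measurable_funM => //; apply: measurableT_comp => //; exact: measurable_ord_point.
  move=> [+ _]; apply: eq_measurable_fun => w _.
  apply: eq_bigr => c _; rewrite [RHS]big_mkcond; apply: eq_bigr => k _.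
  by case: (in_class c k w); rewrite ?mul1r ?mul0r ?addr0// addrC subrK.
- move=> K w; rewrite normr_prod; apply: prodr_ile1 => c _.
  rewrite normr_ge0/= normr_prod; apply: prodr_ile1 => k _.
  by have /andP[? ?] := sf01 c (ord_point k w); rewrite normr_ge0/= ger0_norm.
- move=> w; apply: cvg_prodr => c; apply: (@prod_cvg_count_prod R (in_class c ^~ w) _ (s c)).
    by have /andP[] := s01 c.
  move=> k; have /andP[? ?] := sf01 c (ord_point k w).
  have /andP[? ?] := s01 c; have /andP[? ?] := f01 c (ord_point k w).
  by apply/andP; split=> //; rewrite ler_piMr.
split => //; apply: (cvg_unique (@Rhausdorff R) cvl).
rewrite (funext thE).
have := @pgf _ T R P _ Z ord_point mu measurable_ord_point ppp v mv v01 voo.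
rewrite intv -sum_fine; last by move=> c _; rewrite ge0_fin_numE.
rewrite -sumrN expR_sum.
rewrite (eq_bigr (fun c => expR (- class_integral c (cst 1) + s c * class_integral c (f c))))//.
by move=> c _; rewrite fineE opprB addrC.
Qed.

Lemma class_integral_ge0 c f : (forall z, 0 <= f z <= 1) -> 0 <= class_integral c f.
Proof.
move=> f01; apply: fine_ge0; apply: integral_ge0 => z _.
by rewrite lee_fin mulr_ge0 ?class_weight_ge0//; have /andP[] := f01 z.
Qed.

Lemma class_integral_sum c n (g : 'I_n -> Z -> R) (S : {set 'I_n}) (a : R) : 0 < a ->
  (forall j, measurable_fun setT (g j)) -> (forall j z, 0 <= g j z <= 1) ->
  class_integral c (fun z => (\sum_(j in S) g j z) / a) = (\sum_(j in S) class_integral c (g j)) / a.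
Proof.
move=> a0 mg g01; rewrite /class_integral.
pose g' j z := if j \in S then g j z else 0.
have mg' j : measurable_fun setT (g' j).
  by rewrite /g'; case: (j \in S) => //; exact: measurable_cst.
have g'0 j z : 0 <= g' j z by rewrite /g'; case: ifP => // _; have /andP[] := g01 j z.
have goo j : (\int[mu]_z (class_weight c z.1 * g j z)%:E < +oo)%E.
  exact: (class_integral_lty c (mg j) (g01 j)).
have gge0 j : (0 <= \int[mu]_z (class_weight c z.1 * g j z)%:E)%E.
  by apply: integral_ge0 => z _; exact: class_weightM_ge0.
have -> : (\int[mu]_z (class_weight c z.1 * ((\sum_(j in S) g j z) / a))%:E =
   (a^-1)%:E * \sum_(j < n) \int[mu]_z (class_weight c z.1 * g' j z)%:E)%E.
  rewrite -ge0_integral_sum//; last 2 first.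
  - by move=> j; apply/measurable_EFinP; exact: measurable_class_weightM.
  - by move=> j z _; rewrite lee_fin mulr_ge0 ?class_weight_ge0.
  rewrite -ge0_integralZl_EFin//.
  - apply: eq_integral => z _; rewrite sumEFin -EFinM; congr EFin.
    by rewrite -big_distrr/= /g' -big_mkcond/=; ring.
  - by move=> z _; apply: sume_ge0 => j _; rewrite lee_fin mulr_ge0 ?class_weight_ge0.
  - by apply: emeasurable_sum => j; apply/measurable_EFinP; exact: measurable_class_weightM.
  - by rewrite invr_ge0 ltW.
have intg' j : (\int[mu]_z (class_weight c z.1 * g' j z)%:E = if j \in S then \int[mu]_z (class_weight c z.1 * g j z)%:E else 0)%E.
  rewrite /g'; case: ifP => // _.
  by under eq_integral do rewrite mulr0; rewrite integral0.
under eq_bigr do rewrite intg'.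
rewrite -big_mkcond/= fineM//; last first.
  by apply/sum_fin_numP => j _ _; rewrite ge0_fin_numE.
by rewrite -sum_fine 1?mulrC// => j _; rewrite ge0_fin_numE.
Qed.

Local Notation symm_counts r g C w :=
  (\prod_(c <- C) symm_count ord_point (in_class c) (fun j : 'I_(r c) => g c j) w).
Local Notation symm_mass r g C :=
  (\prod_(c <- C) (expR (- class_integral c (cst 1)) * (\prod_(j < r c) class_integral c (g c j) / (r c)`!%:R))).

(** The classes are independent because their generating functional factors.
Moving a class from C2 to C1 replaces its generating functional by the law of
its labelled points; the case C2 = [::] is the one of interest. *)
Lemma class_law (r : class -> nat) (g : class -> nat -> Z -> R) :
  (forall c j, measurable_fun setT (g c j)) -> (forall c j z, 0 <= g c j z <= 1) ->
  forall (C1 C2 : seq class) (f : class -> Z -> R) (s : class -> R), uniq (C1 ++ C2) ->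
  (forall c, measurable_fun setT (f c)) -> (forall c z, 0 <= f c z <= 1) ->
  (forall c, 0 <= s c < 1) ->
  bm (fun w => symm_counts r g C1 w * genfun C2 f s w) /\
  Ex P (fun w => symm_counts r g C1 w * genfun C2 f s w) =
  symm_mass r g C1 * genfun_mass C2 f s.
Proof.
move=> mg g01; elim=> [|c C1 IH] C2 f s uC mf f01 s01.
  under eq_fun do rewrite big_nil mul1r.
  rewrite big_nil mul1r.
  exact: class_pgf.
have uC' : uniq (C1 ++ c :: C2).
  by rewrite -cat1s uniq_catCA.
have cC2 : c \notin C2.
  by move: uC => /= /andP[]; rewrite mem_cat negb_or => /andP[].
have uC1 : uniq (C1 ++ C2) by case/andP: uC.
pose Y w := symm_counts r g C1 w * genfun C2 f s w.
pose y := symm_mass r g C1 * genfun_mass C2 f s.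
have [bY _] := IH C2 f s uC1 mf f01 s01.
have HY (f0 : Z -> R) (s0 : R) : measurable_fun setT f0 ->
    (forall x, 0 <= f0 x <= 1) -> 0 <= s0 < 1 ->
    Ex P (fun w => Y w * count_prod (in_class c ^~ w) (fun k => s0 * f0 (ord_point k w))) =
    y * expR (- class_integral c (cst 1) + s0 * class_integral c f0).
  move=> mf0 f001 s001.
  (* The induction hypothesis with c among the classes in generating form. *)
  pose f' c' := if c' == c then f0 else f c'.
  pose s' c' := if c' == c then s0 else s c'.
  have [|||_ e] := IH (c :: C2) f' s' uC'.
  - by move=> c'; rewrite /f'; case: ifP.
  - by move=> c'; rewrite /f'; case: ifP.
  - by move=> c'; rewrite /s'; case: ifP.
  have fE (F : class -> (Z -> R) -> R -> R) :
      \prod_(c <- C2) F c (f' c) (s' c) = \prod_(c <- C2) F c (f c) (s c).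
    apply: eq_big_seq => c' c'C; rewrite /f' /s'; case: eqVneq => // cc'.
    by rewrite -cc' c'C in cC2.
  move: e; rewrite [in X in _ = X]big_cons (fE (fun c f s => expR (- class_integral c (cst 1) + s * class_integral c f))).
  have f'c : f' c = f0 by rewrite /f' eqxx.
  have s'c : s' c = s0 by rewrite /s' eqxx.
  rewrite f'c s'c => e.
  transitivity (Ex P (fun w => symm_counts r g C1 w *
    \prod_(c <- c :: C2) count_prod (in_class c ^~ w) (fun k => s' c * f' c (ord_point k w)))).
    apply: eq_Ex => w; rewrite big_cons.
    rewrite (fE (fun c f s => count_prod (in_class c ^~ w) (fun k => s * f (ord_point k w)))).
    by rewrite f'c s'c /Y; ring.
  by rewrite e /y; ring.
have mcl := measurable_in_class c.
have mz k : measurable_fun setT (ord_point k) by exact: measurable_ord_point.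
have [eqf eqv] : (fun w => symm_counts r g (c :: C1) w * genfun C2 f s w) =
   (fun w => Y w * symm_count ord_point (in_class c) (fun j : 'I_(r c) => g c j) w) /\
  symm_mass r g (c :: C1) * genfun_mass C2 f s =
  y * (expR (- class_integral c (cst 1)) * (\prod_(j < r c) class_integral c (g c j) / (r c)`!%:R)).
  split; first by apply/funext => w; rewrite big_cons /Y; ring.
  by rewrite big_cons /y; ring.
rewrite eqf eqv; split.
  by apply: bmM => //; apply: bm_symm_count.
apply: (extract_symm mz mcl bY _ _ HY) => //.
- by move=> f0 _ f001; exact: class_integral_ge0.
- by move=> n g0 S a a0 mg0 g001; exact: class_integral_sum.
Qed.

End classes.

(** * Countable products of probability measures *)

(** A copy of the function type, to carry the semiring of boxes. *)
Definition seq_space (T : Type) : Type := nat -> T.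

Section boxes.
Context d (T : measurableType d).

HB.instance Definition _ := Pointed.copy (seq_space T) (nat -> T).

Definition box (A : nat -> set T) : set (seq_space T) := [set s | forall i, A i (s i)].

(** Boxes constrain finitely many coordinates; p.2 bounds the constrained
ones. *)
Definition box_of (X : set (seq_space T)) (p : (nat -> set T) * nat) :=
  [/\ forall i, measurable (p.1 i), forall i, (p.2 <= i)%N -> p.1 i = setT & X = box p.1].

Definition is_box X := exists p, box_of X p.

Let box0 : is_box set0.
Proof.
exists ((fun i => if i == 0%N then set0 else setT), 1%N); split => /=.
- by move=> i; case: ifP.
- by case.
- by apply/seteqP; split=> // s /(_ 0%N).
Qed.

Let boxI : setI_closed is_box.
Proof.
move=> X Y [[A n] [/= mA /= An /= ->]] [[B m] [/= mB /= Bm /= ->]].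
exists ((fun i => A i `&` B i), maxn n m); split => /=.
- by move=> i; exact: measurableI.
- by move=> i; rewrite geq_max => /andP[/An -> /Bm ->]; rewrite setIT.
- by apply/seteqP; split=> s; [move=> [sA sB] i; split|move=> sAB; split=> i; have [] := sAB i].
Qed.

(** The difference of two boxes is cut according to the first coordinate that
is outside of the second box. *)
Let boxD : semi_setD_closed is_box.
Proof.
move=> X Y [[A n] [/= mA /= An /= ->]] [[B m] [/= mB /= Bm /= ->]].
pose piece i j := if (j < i)%N then A j `&` B j else if j == i then A j `\` B j else A j.
exists [set box (piece i) | i in `I_m]; split.
- exact: finite_image (finite_II m).
- move=> _ [i im <-]; exists (piece i, maxn n i.+1); split => //=.
    by move=> j; rewrite /piece; case: ifP => _; [exact: measurableI|case: ifP => _ //; exact: measurableD].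
  move=> j; rewrite geq_max => /andP[nj ij].
  by rewrite /piece ltnNge ltnW//= gtn_eqF// An.
- apply/seteqP; split.
    move=> s [sA sB].
    have [i iB] : exists i, ~ B i (s i) by apply/existsNP.
    have eB : exists i, ~~ `[< B i (s i) >] by exists i; apply/asboolPn.
    pose i0 := ex_minn eB; have /asboolPn i0B : ~~ `[< B i0 (s i0) >].
      by rewrite /i0; case: ex_minnP.
    have i0m j : (j < i0)%N -> B j (s j).
      move=> ji; apply: contrapT => jB; move: ji; rewrite /i0; case: ex_minnP => k _ km.
      by rewrite ltnNge km//; apply/asboolPn.
    exists (box (piece i0)).
      exists i0 => //=; rewrite ltnNge; apply/negP => mi; apply: i0B.
      by rewrite Bm.
    move=> j; rewrite /piece; case: ifPn => [ji|_]; first by split=> //; exact: i0m.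
    by case: eqVneq => [->|_//]; split.
  move=> s [_ [i im <-] sp]; split=> [j|sB].
    by have := sp j; rewrite /piece; case: ifP => _; [case|case: ifP => _ //; case].
  by have := sp i; rewrite /piece ltnn eqxx => -[_]; exact.
- move=> _ _ [i im <-] [j jm <-] [s [/= si sj]].
  have [ij|ij|->//] := ltngtP i j.
    have := sj i; rewrite /piece ij => -[_].
    by have := si i; rewrite /piece ltnn eqxx => -[].
  have := si j; rewrite /piece ij => -[_].
  by have := sj j; rewrite /piece ltnn eqxx => -[].
Qed.

Fact box_display : measure_display. Proof. exact: default_measure_display. Qed.

HB.instance Definition _ := @isSemiRingOfSets.Build box_display (seq_space T)
  is_box box0 boxI boxD.

End boxes.

Section infinite_product.
Context d (T : measurableType d) (R : realType) (Q : nat -> probability T R).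
Local Open Scope ring_scope.
Implicit Types (p : (nat -> set T) * nat) (s t : seq_space T).

(** The conditional mass of the box given that the first N coordinates are those
of s. *)
Definition box_mass p N s : R :=
  \prod_(i < p.2) (if (i < N)%N then \1_(p.1 i) (s i) else fine (Q i (p.1 i))).

Lemma box_mass_ge0 p N s : 0 <= box_mass p N s.
Proof. by apply: prodr_ge0 => i _; case: ifP => _; rewrite ?indicE// fine_ge0. Qed.

Lemma eq_box_mass p N s t : (forall i, (i < N)%N -> s i = t i) -> box_mass p N s = box_mass p N t.
Proof. by move=> st; apply: eq_bigr => i _; case: ifP => // /st ->. Qed.

Lemma box_mass_in p N s : (p.2 <= N)%N -> box p.1 s -> box_mass p N s = 1.
Proof.
move=> pN ps; rewrite /box_mass big1// => i _.
by rewrite (leq_trans (ltn_ord i) pN) indicE mem_set.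
Qed.

Lemma box_mass_out p N s : (p.2 <= N)%N -> (forall i, (p.2 <= i)%N -> p.1 i = setT) ->
  ~ box p.1 s -> box_mass p N s = 0.
Proof.
move=> pN pT /existsNP[i is_].
have ip : (i < p.2)%N by rewrite ltnNge; apply/negP => /pT pi; apply: is_; rewrite pi.
by rewrite /box_mass (bigD1 (Ordinal ip))//= (leq_trans ip pN) indicE memNset// mul0r.
Qed.

Lemma box_mass_neq0 p N s : (forall i, (p.2 <= i)%N -> p.1 i = setT) ->
  box_mass p N s != 0 -> exists2 t, box p.1 t & forall i, (i < N)%N -> t i = s i.
Proof.
move=> pT; rewrite /box_mass => /prodf_neq0 H.
pose t i := if (i < N)%N then s i else xget point (p.1 i).
exists t; last by move=> i iN; rewrite /t iN.
move=> i; have [ip|/pT ->//] := ltnP i p.2.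
have := H (Ordinal ip) isT; rewrite /= /t; case: ifP => [iN|_].
  rewrite indicE; case: (boolP (s i \in _)) => [/set_mem//|_].
  by rewrite eqxx.
move=> Q0; apply: xgetPex; apply: contrapT => /forallNP A0.
move/negP: Q0; apply; rewrite (_ : p.1 i = set0) ?measure0//.
by apply/seteqP; split=> // u /A0.
Qed.

(** The conditional masses form a martingale. *)
Lemma box_mass_step p N s : (forall i, measurable (p.1 i)) ->
  (\int[Q N]_u (box_mass p N.+1 (fun i => if i == N then u else s i))%:E =
   (box_mass p N s)%:E)%E.
Proof.
move=> mp; have [Np|pN] := ltnP N p.2; last first.
  under eq_integral.
    move=> u _; rewrite (_ : box_mass p N.+1 _ = box_mass p N s); last first.
      apply: eq_bigr => i _; have iN := leq_trans (ltn_ord i) pN.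
      by rewrite ltnS ltnW// iN ltn_eqF.
    over.
  rewrite integral_cst//= [X in (_ * X)%E](_ : _ = 1%E) ?mule1//.
  exact: probability_setT.
pose c := \prod_(i < p.2 | i != Ordinal Np)
  (if (i < N)%N then \1_(p.1 i) (s i) else fine (Q i (p.1 i))) : R.
have c0 : 0 <= c by apply: prodr_ge0 => i _; case: ifP => _; rewrite ?indicE// fine_ge0.
transitivity (\int[Q N]_u (c%:E * (\1_(p.1 N) u)%:E))%E.
  apply: eq_integral => u _; rewrite /box_mass (bigD1 (Ordinal Np))//= ltnSn eqxx mulrC EFinM.
  congr ((_)%:E * _)%E; apply: eq_bigr => i iN.
  have : (i : nat) != N by apply: contra iN => /eqP iN; apply/eqP/val_inj.
  by rewrite ltnS leq_eqVlt => /negbTE ->.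
rewrite ge0_integralZl_EFin//; last by apply/measurable_EFinP; exact: measurable_indic.
rewrite integral_indic// setIT /box_mass (bigD1 (Ordinal Np))//= ltnn mulrC EFinM.
by rewrite fineK// fin_num_measure.
Qed.

Definition box_measure (X : set (seq_space T)) : \bar R :=
  if pselect (is_box X) is left H then (box_mass (projT1 (cid H)) 0%N point)%:E else 0%E.

(** A non-empty box determines its sides, but not the bound p.2. *)
Lemma box_mass_uniq X p q : box_of X p -> box_of X q ->
  box_mass p 0 point = box_mass q 0 point.
Proof.
move=> [mp pT Xp] [mq qT Xq].
have [X0|/set0P[s Xs]] := eqVneq X set0.
  have h r : (forall i, (r.2 <= i)%N -> r.1 i = setT) -> X = box r.1 -> box_mass r 0 point = 0.
    move=> rT Xr; apply/eqP; apply: contrapT => /negP /(box_mass_neq0 rT)[t].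
    by rewrite -Xr X0.
  by rewrite !h.
have e i : p.1 i = q.1 i.
  have h r1 r2 : X = box r1 -> X = box r2 -> (r1 i `<=` r2 i)%classic.
    move=> X1 X2 u ru.
    have : box r2 (fun j => if j == i then u else s j).
      rewrite -X2 X1 => j; case: eqVneq => [->//|_].
      by move: Xs; rewrite X1; exact.
    by move=> /(_ i); rewrite eqxx.
  by apply/seteqP; split; exact: h.
rewrite /box_mass.
have ext r N : (forall i, (r.2 <= i)%N -> r.1 i = setT) -> (r.2 <= N)%N ->
    \prod_(i < r.2) fine (Q i (r.1 i)) = \prod_(i < N) fine (Q i (r.1 i)).
  move=> rT rN; rewrite -(big_mkord xpredT (fun i => fine (Q i (r.1 i)))).
  rewrite -(big_mkord xpredT (fun i => fine (Q i (r.1 i)))) [RHS](big_cat_nat _ rN)//=.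
  rewrite [X in _ * X]big_nat_cond [X in _ * X]big1 ?mulr1//.
  by move=> i /andP[/andP[/rT -> _] _]; rewrite probability_setT.
rewrite (ext p (maxn p.2 q.2))// ?leq_maxl// (ext q (maxn p.2 q.2))// ?leq_maxr//.
by apply: eq_bigr => i _; rewrite e.
Qed.

Lemma box_measureE X p : box_of X p -> box_measure X = (box_mass p 0 point)%:E.
Proof.
move=> Xp; rewrite /box_measure; case: pselect => [H|[]]; last by exists p.
by case: cid => /= q Xq; rewrite (box_mass_uniq Xq Xp).
Qed.

Let box_measure0 : box_measure set0 = 0%E.
Proof.
have [p H] := (measurable0 : is_box (set0 : set (seq_space T))).
rewrite (box_measureE H); congr EFin; apply/eqP; apply: contrapT => /negP.
by case: H => _ pT e /(box_mass_neq0 pT)[t]; rewrite -e.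
Qed.

Let box_measure_ge0 X : (0 <= box_measure X)%E.
Proof. by rewrite /box_measure; case: pselect => // H; rewrite lee_fin box_mass_ge0. Qed.

(** Suppose that additivity fails for a box p that is a disjoint union of boxes.
Since the conditional masses are averages over the next coordinate, it fails
for the conditional masses given some first coordinate, then given some second
one, and so on. The sequence t of these coordinates contradicts this: if t is
in none of the boxes of the union, all masses are 0 after the coordinates that p
constrains, and if it is in one of them, both sides are 1 after finitely many
coordinates. *)
Let box_measure_sigma_additive : semi_sigma_additive box_measure.
Proof.
move=> F mF tF [p Fp].
have /(_ _)/cid-/all_sig[q Fq] : forall k, exists q, box_of (F k) q by [].
rewrite (box_measureE Fp).
suff : (\sum_(k <oo) (box_mass (q k) 0 point)%:E = (box_mass p 0 point)%:E)%E.
  move=> <-; under eq_fun do under eq_bigr do rewrite (box_measureE (Fq _)).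
  by apply: is_cvg_nneseries => k _ _; rewrite lee_fin box_mass_ge0.
have [mp pT pX] := Fp.
pose bad N s := (\sum_(k <oo) (box_mass (q k) N s)%:E <> (box_mass p N s)%:E)%E.
have step N s : bad N s -> exists u, bad N.+1 (fun i => if i == N then u else s i).
  move=> bNs; apply: contrapT => /forallNP nb; apply: bNs.
  rewrite -box_mass_step//; transitivity (\int[Q N]_u
     \sum_(k <oo) (box_mass (q k) N.+1 (fun i => if i == N then u else s i))%:E)%E; last first.
    by apply: eq_integral => u _; apply: contrapT; exact: nb.
  have mterm r : (forall i, measurable (r.1 i)) -> measurable_fun setT
      (fun u => (box_mass r N.+1 (fun i => if i == N then u else s i))%:E).
    move=> mr; apply/measurable_EFinP; apply: measurable_prod => i _.
    case: (i < N.+1)%N => //; case: (nat_of_ord i == N) => //; exact: measurable_indic.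
  rewrite integral_nneseries//.
  - apply: eq_eseriesr => k _; rewrite box_mass_step//.
    by case: (Fq k).
  - by move=> k; apply: mterm; case: (Fq k).
  - by move=> k u _; rewrite lee_fin box_mass_ge0.
apply: contrapT => bad0.
have /(_ _ _ _)/cid-ch := step.
pose upd N (s : {s | bad N s}) : {s | bad N.+1 s} :=
  let u := ch N (sval s) (svalP s) in exist _ (fun i => if i == N then sval u else sval s i) (svalP u).
(* Only the coordinates below N of the N-th sequence matter, and they never change afterwards. *)
pose fix seqs N : {s | bad N s} := if N is N'.+1 then upd N' (seqs N') else exist _ point bad0.
pose t i := sval (seqs i.+1) i.
have tE N i : (i < N)%N -> sval (seqs N) i = t i.
  elim: N => // N IH; rewrite ltnS leq_eqVlt => /predU1P[->//|iN].
  by rewrite -IH//= ltn_eqF.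
have badt N : bad N t.
  have := svalP (seqs N); rewrite /bad (eq_box_mass p (tE N)).
  by under eq_eseriesr do rewrite (eq_box_mass _ (tE N)).
have [Ft|Ft] := pselect ((\bigcup_k F k) t); last first.
  apply: (badt p.2).
  rewrite (box_mass_out (leqnn _) pT) -?pX// eseries0// => k _ _.
  congr EFin; apply/eqP; apply: contrapT => /negP.
  case: (Fq k) => _ qT Fk /(box_mass_neq0 qT)[t' kt' t't]; apply: Ft.
  rewrite pX => i; have [ip|/pT ->//] := ltnP i p.2.
  rewrite -t't//; suff : box p.1 t' by exact.
  by rewrite -pX; exists k => //; rewrite Fk.
case: (Ft) => k0 _ k0t.
pose N := maxn p.2 (q k0).2.
apply: (badt N); rewrite box_mass_in ?leq_maxl -?pX//.
have [mq0 q0T F0] := Fq k0.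
rewrite (@nneseriesD1 _ _ k0)//; last by move=> k _; rewrite lee_fin box_mass_ge0.
rewrite box_mass_in ?leq_maxr -?F0// eseries0 ?adde0// => k _ kk0.
congr EFin; apply/eqP; apply: contrapT => /negP.
case: (Fq k) => _ qT Fk /(box_mass_neq0 qT)[t' kt' t't].
have k0t' : F k0 t'.
  rewrite F0 => i; have [iq|/q0T ->//] := ltnP i (q k0).2.
  rewrite t't; first by move: k0t; rewrite F0; exact.
  by rewrite (leq_trans iq)// leq_maxr.
have := tF k k0 I I => /(_ _)/eqP; rewrite (negbTE kk0) => /(_ _)/notF; apply.
by exists t'; split => //; rewrite Fk.
Qed.

HB.instance Definition _ := isMeasure.Build _ (seq_space T) R box_measure
  box_measure0 box_measure_ge0 box_measure_sigma_additive.

End infinite_product.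

Section product_probability.
Context d (T : measurableType d) (R : realType) (Q : nat -> probability T R).

Definition seq_type : measurableType _ :=
  g_sigma_algebraType (@measurable _ (seq_space T)).

Definition seq_prob : set seq_type -> \bar R := measure_extension (box_measure Q).

HB.instance Definition _ := Measure.copy seq_prob (measure_extension (box_measure Q)).

Lemma measurable_box (A : nat -> set T) n : (forall i, measurable (A i)) ->
  (forall i, (n <= i)%N -> A i = setT) -> measurable (box A : set seq_type).
Proof.
by move=> mA An; apply: sub_sigma_algebra; exists (A, n); split.
Qed.

Lemma seq_prob_box (A : nat -> set T) n : (forall i, measurable (A i)) ->
  (forall i, (n <= i)%N -> A i = setT) -> seq_prob (box A) = \prod_(i < n) Q i (A i).
Proof.
move=> mA An; have bA : box_of (box A) (A, n) by split.
rewrite /seq_prob /measure_extension measurable_mu_extE; last by exists (A, n).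
rewrite /= (box_measureE Q bA) /box_mass/= -prodEFin; apply: eq_bigr => i _.
by rewrite fineK// fin_num_measure.
Qed.

Let seq_probT : seq_prob setT = 1.
Proof.
rewrite (_ : setT = box (fun=> setT)); last by apply/seteqP; split.
by rewrite (@seq_prob_box _ 0) ?big_ord0.
Qed.

HB.instance Definition _ := @Measure_isProbability.Build _ _ R seq_prob seq_probT.

Definition seq_coord (n : nat) (w : seq_type) : T := w n.

Lemma measurable_seq_coord n : measurable_fun setT (seq_coord n).
Proof.
move=> _ B mB; rewrite setTI.
rewrite (_ : _ @^-1` B = box (fun i => if i == n then B else setT)).
  apply: (@measurable_box _ n.+1) => i; first by case: ifP.
  by move=> ni; rewrite gtn_eqF.
apply/seteqP; split=> w; last by move=> /(_ n); rewrite eqxx.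
by move=> Bw i; case: eqVneq => // ->.
Qed.

Lemma seq_prob_coord (A : nat -> set T) (s : seq nat) : uniq s ->
  (forall i, measurable (A i)) ->
  seq_prob [set w | forall i, i \in s -> A i (seq_coord i w)] = \prod_(i <- s) Q i (A i).
Proof.
move=> us mA; pose n := (\max_(i <- s) i).+1.
have sn i : i \in s -> (i < n)%N by move=> i_s; rewrite ltnS (big_rem i)//= leq_maxl.
pose B i := if i \in s then A i else setT.
rewrite (_ : mkset _ = box B); last first.
  apply/seteqP; split=> w H i; rewrite /B; first by case: ifPn => // /H.
  by move=> i_s; have := H i; rewrite /B i_s.
rewrite (@seq_prob_box _ n).
- rewrite /B -(big_mkord xpredT (fun i => Q i (if i \in s then A i else setT))).
  rewrite (bigID (mem s))/= [X in _ * X]big1 ?mule1; last first.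
    by move=> i /negbTE ->; rewrite probability_setT.
  have ps : perm_eq [seq i <- index_iota 0 n | i \in s] s.
    apply: uniq_perm => //; first by rewrite filter_uniq// iota_uniq.
    by move=> i; rewrite mem_filter mem_index_iota; case: (boolP (i \in s)) => //= /sn ->.
  rewrite -big_filter (perm_big _ ps)/=.
  by apply: eq_big_seq => i ->.
- by move=> i; rewrite /B; case: ifP.
- move=> i ni; rewrite /B; case: ifPn => // /sn; by rewrite ltnNge ni.
Qed.

End product_probability.

(** * Independence of generated sigma-algebras *)

Section independence.
Context d (T : measurableType d) (R : realType) (P : probability T R).

(** The events A that satisfy the product rule with D form a Dynkin system. *)
Lemma indep_extend (G : set (set T)) (D : set T) :
  setI_closed G -> G `<=` measurable -> measurable D ->
  (forall A, G A -> P (A `&` D) = P A * P D) ->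
  forall A, <<s G >> A -> P (A `&` D) = P A * P D.
Proof.
move=> IG mG mD GD; rewrite -setI_closed_g_dynkin_g_sigma_algebra// => A.
suff : <<d G >> `<=` [set A | measurable A /\ P (A `&` D) = P A * P D] by move=> H /H[].
apply: smallest_sub; last by move=> B GB; split; [exact: mG|exact: GD].
split.
- by split; [exact: measurableT|rewrite setTI probability_setT mul1e].
- move=> B [mB BD]; split; first exact: measurableC.
  have e : P D = P (B `&` D) + P (~` B `&` D).
    rewrite -measureU//; first by rewrite -setIUl setUCr setTI.
    - exact: measurableI.
    - by apply: measurableI => //; exact: measurableC.
    - by rewrite setIACA setICr set0I.
  have fin A' : measurable A' -> P A' \is a fin_num by move=> ?; exact: fin_num_measure.
  have mCD : measurable (~` B `&` D) by apply: measurableI => //; exact: measurableC.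
  rewrite probability_setC//.
  move: e; rewrite BD.
  rewrite -(fineK (fin _ mB)) -(fineK (fin _ mD)) -(fineK (fin _ mCD)).
  rewrite -EFinM -EFinD -EFinB -EFinM => -[e]; congr EFin.
  by rewrite mulrBl mul1r {1}e; ring.
- move=> F tF FD; split; first by apply: bigcupT_measurable => k; case: (FD k).
  have mF k : measurable (F k) by case: (FD k).
  have mFD k : measurable (F k `&` D) by apply: measurableI.
  have tFD : trivIset setT (fun k => F k `&` D).
    by move=> i j _ _ [w [[Fi _] [Fj _]]]; apply: tF => //; exists w.
  have mbF : measurable (\bigcup_k F k) by exact: bigcupT_measurable.
  have mbFD : measurable (\bigcup_k (F k `&` D)) by exact: bigcupT_measurable.
  rewrite setI_bigcupl (measure_semi_bigcup _ mFD tFD mbFD) (measure_semi_bigcup _ mF tF mbF).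
  rewrite muleC -(fineK (fin_num_measure P D mD)) -nneseriesZl//.
  apply: eq_eseriesr => k _; transitivity (P (F k) * P D); first by have [] := FD k.
  by rewrite muleC fineK ?fin_num_measure.
Qed.

Lemma indep3_sigma (G1 G2 G3 : set (set T)) :
  setI_closed G1 -> setI_closed G2 -> setI_closed G3 ->
  G1 setT -> G2 setT -> G3 setT ->
  G1 `<=` measurable -> G2 `<=` measurable -> G3 `<=` measurable ->
  independent3 P G1 G2 G3 -> independent3 P <<s G1 >> <<s G2 >> <<s G3 >>.
Proof.
move=> I1 I2 I3 T1 T2 T3 m1 m2 m3 ind.
have PT : P setT = 1 by exact: probability_setT.
have sm (G : set (set T)) : G `<=` measurable -> <<s G >> `<=` measurable.
  by move=> mG; apply: smallest_sub => //; exact: sigma_algebra_measurable.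
have st1 E1 E2 E3 : <<s G1 >> E1 -> G2 E2 -> G3 E3 -> P (E1 `&` E2 `&` E3) = P E1 * P E2 * P E3.
  move=> g1 g2 g3; rewrite -setIA.
  have e23 : P (E2 `&` E3) = P E2 * P E3.
    by have := ind _ _ _ T1 g2 g3; rewrite setTI PT mul1e.
  rewrite (indep_extend I1 m1 _ _ g1); first by rewrite e23 muleA.
    by apply: measurableI; [exact: m2|exact: m3].
  by move=> A gA; rewrite setIA ind// e23 muleA.
have st2 E1 E2 E3 : <<s G1 >> E1 -> <<s G2 >> E2 -> G3 E3 -> P (E1 `&` E2 `&` E3) = P E1 * P E2 * P E3.
  move=> g1 g2 g3; rewrite (setIC E1) -setIA.
  have e13 : P (E1 `&` E3) = P E1 * P E3.
    by have := st1 _ _ _ g1 T2 g3; rewrite setIT PT mule1.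
  rewrite (indep_extend I2 m2 _ _ g2); first by rewrite e13 muleA (muleC (P E2)).
    by apply: measurableI; [exact: (sm _ m1)|exact: m3].
  by move=> A gA; rewrite setIA (setIC A) st1// e13 muleA (muleC (P A)).
move=> E1 E2 E3 g1 g2 g3; rewrite setIC.
have e12 : P (E1 `&` E2) = P E1 * P E2.
  by have := st2 _ _ _ g1 g2 T3; rewrite setIT PT mule1.
rewrite (indep_extend I3 m3 _ _ g3); first by rewrite e12 muleC.
  by apply: measurableI; [exact: (sm _ m1)|exact: (sm _ m2)].
by move=> A gA; rewrite setIC st2// e12 muleC.
Qed.

Context (I : eqType) (F : I -> set (set T)).
Hypothesis IF : forall i, setI_closed (F i).
Hypothesis FT : forall i, F i setT.
Hypothesis mF : forall i, F i `<=` measurable.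
Hypothesis indF : mutually_independent P F.

Definition cyl (b : pred I) : set (set T) := [set X | exists s E,
  [/\ uniq s, forall i, i \in s -> b i, forall i, i \in s -> F i (E i) &
      X = \big[setI/setT]_(i <- s) E i]].

Lemma bigsetI_mem (s : seq I) (E : I -> set T) :
  \big[setI/setT]_(i <- s) E i = [set w | forall i, i \in s -> E i w].
Proof.
elim: s => [|i s IH]; first by rewrite big_nil; apply/seteqP; split.
rewrite big_cons IH; apply/seteqP; split=> w /=.
  by move=> [Ei H] j; rewrite inE => /predU1P[->|/H].
by move=> H; split=> [|j js]; apply: H; rewrite inE ?eqxx ?js ?orbT.
Qed.

Lemma cyl_setI (b : pred I) : setI_closed (cyl b).
Proof.
move=> X Y [s [E [us sb sE ->]]] [s' [E' [us' sb' sE' ->]]].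
exists (undup (s ++ s')), (fun i => (if i \in s then E i else setT) `&` (if i \in s' then E' i else setT)).
split.
- exact: undup_uniq.
- by move=> i; rewrite mem_undup mem_cat => /orP[/sb|/sb'].
- move=> i _; apply: IF; case: ifPn => [i_s|_]; [exact: sE|exact: FT|exact: sE'|exact: FT].
- rewrite !bigsetI_mem; apply/seteqP; split=> w /=.
    by move=> [h h'] i _; split; case: ifPn => // ?; [exact: h|exact: h'].
  move=> H; split=> i i_s; have := H i; rewrite mem_undup mem_cat i_s ?orbT => /(_ isT)[]; by [].
Qed.

Lemma cylT b : cyl b setT.
Proof. by exists [::], (fun=> setT); split=> //; rewrite big_nil. Qed.

Lemma measurable_cyl b : cyl b `<=` measurable.
Proof.
move=> _ [s [E [_ _ sE ->]]]; rewrite big_seq.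
by apply: bigsetI_measurable => i /sE; exact: mF.
Qed.

Lemma cyl_gen (b : pred I) i : b i -> F i `<=` cyl b.
Proof.
move=> bi A FA; exists [:: i], (fun=> A); split => //.
- by move=> j; rewrite inE => /eqP ->.
- by move=> j; rewrite inE => /eqP ->.
- by rewrite big_seq1.
Qed.

(** Finite intersections of events with indices in one block form a pi-system
that generates the sigma-algebra of the block. *)
Lemma independent_blocks (b1 b2 b3 : pred I) :
  (forall i, b1 i -> ~~ b2 i) -> (forall i, b1 i -> ~~ b3 i) -> (forall i, b2 i -> ~~ b3 i) ->
  independent3 P <<s \bigcup_(i in [set i | b1 i]) F i >>
    <<s \bigcup_(i in [set i | b2 i]) F i >> <<s \bigcup_(i in [set i | b3 i]) F i >>.
Proof.
move=> b12 b13 b23.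
have : independent3 P <<s cyl b1 >> <<s cyl b2 >> <<s cyl b3 >>.
  apply: indep3_sigma; try exact: cyl_setI; try exact: cylT; try exact: measurable_cyl.
  move=> _ _ _ [s1 [E1 [u1 sb1 sE1 ->]]] [s2 [E2 [u2 sb2 sE2 ->]]] [s3 [E3 [u3 sb3 sE3 ->]]].
  pose E i := if b1 i then E1 i else if b2 i then E2 i else E3 i.
  have e1 i : i \in s1 -> E i = E1 i by move=> /sb1; rewrite /E => ->.
  have e2 i : i \in s2 -> E i = E2 i.
    by move=> /sb2 bi; rewrite /E bi; case: ifPn => // /b12; rewrite bi.
  have e3 i : i \in s3 -> E i = E3 i.
    move=> /sb3 bi; rewrite /E; case: ifPn => [/b13|_]; first by rewrite bi.
    by case: ifPn => // /b23; rewrite bi.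
  have us : uniq (s1 ++ s2 ++ s3).
    rewrite !cat_uniq u1 u2 u3 andbT/=; apply/andP; split.
      apply/hasPn => i; rewrite mem_cat => /orP[/sb2|/sb3] bi; apply/negP => /sb1.
        by move=> /b12; rewrite bi.
      by move=> /b13; rewrite bi.
    by apply/hasPn => i /sb3 bi; apply/negP => /sb2 /b23; rewrite bi.
  have sE i : i \in s1 ++ s2 ++ s3 -> F i (E i).
    rewrite !mem_cat => /or3P[] h; rewrite ?(e1 _ h) ?(e2 _ h) ?(e3 _ h).
    - exact: sE1.
    - exact: sE2.
    - exact: sE3.
  have ind1 s : uniq s -> {subset s <= s1 ++ s2 ++ s3} ->
      P (\big[setI/setT]_(i <- s) E i) = \prod_(i <- s) P (E i).
    by move=> us' ss; apply: indF => // i /ss /sE.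
  have := ind1 _ us (fun _ h => h); rewrite !big_cat/=.
  rewrite (eq_big_seq _ e1) (eq_big_seq _ e2) (eq_big_seq _ e3) setIA => ->.
  rewrite -(eq_big_seq _ e1) -(eq_big_seq _ e2) -(eq_big_seq _ e3).
  rewrite (ind1 s1)//; last by move=> i; rewrite !mem_cat => ->.
  rewrite (ind1 s2)//; last by move=> i; rewrite !mem_cat => ->; rewrite orbT.
  rewrite (ind1 s3)//; last by move=> i; rewrite !mem_cat => ->; rewrite !orbT.
  by rewrite muleA.
have sub (b : pred I) : <<s \bigcup_(i in [set i | b i]) F i >> `<=` <<s cyl b >>.
  apply: smallest_sub; first exact: smallest_sigma_algebra.
  by move=> A [i bi FA]; apply: sub_sigma_algebra; exact: cyl_gen FA.
by move=> H E1 E2 E3 /sub g1 /sub g2 /sub g3; exact: H.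
Qed.

End independence.

(** * The law of the weights within a class *)

Section size_law.
Context (R : realType) (h : nat -> R -> R).
Context (nu : {sigma_finite_measure set (measurableTypeR R) -> \bar R}).

Definition size_law (hh : pmf_family h) (c : nat * nat) (B : set (measurableTypeR R)) : \bar R :=
  \int[nu]_(t in B) (class_weight h c t)%:E.

Section size_law_measure.
Context (hh : pmf_family h) (c : nat * nat).

Let pc0 t : 0 <= (class_weight h c t)%:E.
Proof. by rewrite lee_fin (class_weight_ge0 hh). Qed.

Let mpc : measurable_fun setT (fun t => (class_weight h c t)%:E).
Proof. by apply/measurable_EFinP; exact: measurable_class_weight. Qed.

Let size_law0 : size_law hh c set0 = 0.
Proof. exact: integral_set0. Qed.

Let size_law_ge0 B : 0 <= size_law hh c B.
Proof. exact: integral_ge0. Qed.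

Let size_law_sigma_additive : semi_sigma_additive (size_law hh c).
Proof.
by apply: semi_sigma_additive_nng_induced.
Qed.

HB.instance Definition _ := isMeasure.Build _ _ _ (size_law hh c)
  size_law0 size_law_ge0 size_law_sigma_additive.

End size_law_measure.

Context (hh : pmf_family h).

Lemma size_lawE c B : size_law hh c B = size_measure nu h c.1.+1 c.2.+1 B.
Proof.
rewrite /size_measure integral_mkcondr; apply: eq_integral => t _.
rewrite patchE; have -> : (t \in (`[0%R, +oo[%classic : set R)) = (0 <= t)%R.
  by rewrite mem_setE in_itv/= andbT.
by rewrite /class_weight/=; case: ifP.
Qed.

Lemma size_law_fin : \sum_(1 <= y <oo) \int[nu]_(t in `[0%R, +oo[) (h y t)%:E < +oo ->
  forall c, size_law hh c setT < +oo.
Proof.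
move=> hfin c; apply: le_lt_trans hfin.
have mh n : measurable_fun (`[0%R, +oo[ : set R) (h n) by have [] := hh.
have h0 y t : (`[0%R, +oo[%classic : set R) t -> 0 <= (h y t)%:E.
  by rewrite /= in_itv/= andbT lee_fin => t0; exact: (h_ge0 hh).
have i0 y : 0 <= \int[nu]_(t in `[0%R, +oo[) (h y t)%:E.
  by apply: integral_ge0 => t; exact: h0.
apply: (@le_trans _ _ (\int[nu]_(t in `[0%R, +oo[) (h c.2.+1 t)%:E)).
  rewrite size_lawE /size_measure setTI; apply: ge0_le_integral => //.
  - move=> t t0; rewrite lee_fin mulr_ge0 ?exprn_ge0//; rewrite -lee_fin; exact: h0.
  - apply/measurable_EFinP; apply: measurable_funM; last exact: mh.
    apply: measurable_funX; exact: mh.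
  - apply/measurable_EFinP; exact: mh.
  - move=> t t0; rewrite lee_fin ler_piMl//; first by rewrite -lee_fin; exact: h0.
    move: t0; rewrite /= in_itv/= andbT => t0.
    by rewrite exprn_ile1// ?(h_ge0 hh)// (h_le1 hh).
apply: (le_trans _ (nneseries_lim_ge c.2.+2 _)); last by move=> k _ _; exact: i0.
by rewrite big_nat_recr//= leeDr// sume_ge0.
Qed.

Hypothesis size_fin : forall c, size_law hh c setT < +oo.

Lemma size_law_le c B : measurable B -> size_law hh c B <= size_law hh c setT.
Proof.
move=> mB; apply: (@le_measure _ _ _ (size_law hh c)); rewrite ?inE//.
Qed.

Lemma size_law_fin_num c B : measurable B -> size_law hh c B \is a fin_num.
Proof.
by move=> mB; rewrite ge0_fin_numE ?measure_ge0// (le_lt_trans (size_law_le c mB)).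
Qed.

Definition size_rate c : R := fine (size_law hh c setT).

Lemma size_rate_ge0 c : (0 <= size_rate c)%R.
Proof. by rewrite fine_ge0. Qed.

(** A class of mass 0 gets a Dirac law, so that points of this class can be drawn
in all cases. *)
Definition size_prob c : probability (measurableTypeR R) R :=
  mnormalize (size_law hh c) (\d_(0%R : measurableTypeR R)).

Lemma size_probE c B : size_law hh c setT != 0 ->
  size_prob c B = (size_rate c)^-1%:E * size_law hh c B.
Proof.
move=> c0; rewrite /size_prob/= /mnormalize (negbTE c0)/=.
by rewrite lt_eqF ?size_fin//= muleC.
Qed.

Lemma size_law_prob c B : measurable B ->
  (fine (size_law hh c B) = size_rate c * fine (size_prob c B))%R.
Proof.
move=> mB; have [c0|c0] := eqVneq (size_law hh c setT) 0.
  rewrite /size_rate c0 mul0r; suff -> : size_law hh c B = 0 by [].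
  by apply/eqP; rewrite eq_le measure_ge0 andbT -c0 size_law_le.
rewrite size_probE// fineM ?size_law_fin_num//= mulrA divff ?mul1r//.
by rewrite /size_rate fine_eq0// ?size_law_fin_num.
Qed.

Context dPsi (Psi : measurableType dPsi) (G : probability Psi R).

Lemma integral_class_weight_rect c (B : set (measurableTypeR R)) (A : set Psi) :
  measurable B -> measurable A ->
  \int[nu \x G]_z (class_weight h c z.1 * \1_(B `*` A) z)%:E = size_law hh c B * G A.
Proof.
move=> mB mA.
have mf : measurable_fun setT (fun z : measurableTypeR R * Psi => (class_weight h c z.1 * \1_(B `*` A) z)%:E).
  apply/measurable_EFinP; apply: measurable_funM.
    by apply: measurableT_comp => //; exact: measurable_class_weight.
  by apply: measurable_indic; exact: measurableX.
rewrite (@fubini_tonelli1 _ _ _ _ _ nu G _ mf); last first.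
  by move=> z; rewrite lee_fin mulr_ge0// ?(class_weight_ge0 hh)// indicE.
rewrite /fubini_F/=.
transitivity (\int[nu]_t ((class_weight h c t * \1_B t)%:E * G A)).
  apply: eq_integral => t _.
  transitivity (\int[G]_y ((class_weight h c t * \1_B t)%:E * (\1_A y)%:E)).
    apply: eq_integral => y _; rewrite -EFinM; congr EFin.
    rewrite -mulrA; congr (_ * _)%R; rewrite !indicE -natrM mulnb; congr (nat_of_bool _)%:R.
    by apply/idP/andP; [rewrite inE => -[? ?]; rewrite !inE|rewrite !inE].
  rewrite ge0_integralZl_EFin//.
  - by rewrite integral_indic// setIT.
  - by apply/measurable_EFinP; exact: measurable_indic.
  - by rewrite mulr_ge0// ?(class_weight_ge0 hh)// indicE.
have GA : G A = (fine (G A))%:E by rewrite fineK// fin_num_measure.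
rewrite GA; under eq_integral do rewrite muleC.
rewrite ge0_integralZl_EFin//; last 3 first.
- by move=> t _; rewrite lee_fin mulr_ge0// ?(class_weight_ge0 hh)// indicE.
- apply/measurable_EFinP; apply: measurable_funM; first exact: measurable_class_weight.
  exact: measurable_indic.
- by rewrite fine_ge0.
rewrite muleC; congr (_ * _); rewrite /size_law [RHS]integral_mkcond.
apply: eq_integral => t _; rewrite patchE indicE.
by case: ifP => _; rewrite ?mulr1 ?mulr0.
Qed.

(** The mean measure of a class is its total mass times a product of two
probabilities, which makes locations and weights independent. *)
Lemma class_integral_rect c (B : set (measurableTypeR R)) (A : set Psi) :
  measurable B -> measurable A ->
  (class_integral h (nu \x G) c (\1_(B `*` A)) = size_rate c * (fine (size_prob c B) * fine (G A)))%R.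
Proof.
move=> mB mA; rewrite /class_integral integral_class_weight_rect// fineM ?size_law_fin_num ?fin_num_measure//.
by rewrite size_law_prob// mulrA.
Qed.

Lemma class_integral_total c : class_integral h (nu \x G) c (cst 1%R) = size_rate c.
Proof.
rewrite (_ : cst 1%R = \1_(setT `*` setT)); last first.
  by rewrite setXTT indicT.
rewrite (class_integral_rect c measurableT measurableT).
transitivity (size_rate c * (1 * 1))%R; last by rewrite !mulr1.
congr (_ * (_ * _))%R.
  exact: (congr1 fine (probability_setT (size_prob c))).
exact: (congr1 fine (probability_setT G)).
Qed.

Lemma class_weight_integrable c : \int[nu \x G]_z (class_weight h c z.1)%:E < +oo.
Proof.
have -> : \int[nu \x G]_z (class_weight h c z.1)%:E =
   \int[nu \x G]_z (class_weight h c z.1 * \1_(setT `*` setT) z)%:E.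
  by apply: eq_integral => z _; rewrite setXTT indicT mulr1.
rewrite (integral_class_weight_rect c measurableT measurableT).
have -> : G setT = 1 by exact: probability_setT.
by rewrite mule1 size_fin.
Qed.

End size_law.

(** * Uniform relabellings *)

Section uniform_permutation.
Context (R : realType).
Local Open Scope ring_scope.

Definition unif_weight (n : nat) : {nonneg R} := NngNum (ler0n R n.+1 : 0 <= n.+1%:R)%R.

Definition unif_nat (n : nat) : set nat -> \bar R :=
  mscale ((unif_weight n)%:num^-1)%:nng (msum (fun k : nat => \d_k) n.+1).

HB.instance Definition _ n := Measure.on (unif_nat n).

Lemma unif_natE n V : unif_nat n V = (n.+1%:R^-1 * \sum_(k < n.+1) \1_V (k : nat))%:E.
Proof.
rewrite /unif_nat /mscale/= /msum EFinM -sumEFin; by congr (_ * _)%E.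
Qed.

Let unif_natT n : unif_nat n setT = 1%E.
Proof.
rewrite unif_natE (eq_bigr (fun=> 1)); last by move=> k _; rewrite indicT.
by rewrite sumr_const card_ord mulVf.
Qed.

HB.instance Definition _ n := @Measure_isProbability.Build _ _ R (unif_nat n) (unif_natT n).

Definition nth_perm (r n : nat) : 'S_r := nth 1%g (enum 'S_r) n.

(** The permutation acts on labels below r; other labels are sent to 0. *)
Definition permn (r n j : nat) : nat :=
  if insub j is Some i then val (nth_perm r n (i : 'I_r)) else 0%N.

Lemma permnE r n (j : 'I_r) : permn r n j = nth_perm r n j.
Proof. by rewrite /permn valK. Qed.

Lemma unif_perm r (phi : 'S_r -> bool) :
  fine (unif_nat (r`!).-1 [set n | phi (nth_perm r n)]) =
  r`!%:R^-1 * \sum_(s : 'S_r) (phi s)%:R.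
Proof.
have fS : ((r`!).-1.+1 = r`!)%N by rewrite prednK ?fact_gt0.
rewrite unif_natE/= fS; congr (_ * _).
have sz : size (enum 'S_r) = r`! by rewrite -cardE card_Sn.
have -> : \sum_(s : 'S_r) (phi s)%:R = \sum_(s <- enum 'S_r) (phi s)%:R :> R.
  by rewrite big_enum.
rewrite (big_nth 1%g) sz big_mkord.
by apply: eq_bigr => k _; rewrite indicE mem_setE.
Qed.

End uniform_permutation.

(** * Poisson laws, independent families and partitions of series *)

(** Written with the mass function [pois], which is right at rate 0 as well. *)
Lemma poisson_lawE (R : realType) (l : R) (U : set nat) : (0 <= l)%R ->
  (poisson_law l U = \sum_(r <oo) (if r \in U then (pois l r)%:E else 0))%E.
Proof.
move=> l0; pose F r : set nat := if r \in U then [set r] else set0.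
have UF : U = \bigcup_r F r.
  apply/seteqP; split=> r; rewrite /F.
    by move=> Ur; exists r => //=; rewrite mem_set.
  by move=> [r' _]; case: ifPn => //= /set_mem Ur' ->.
have tF : trivIset setT F.
  by move=> i j _ _ [r []]; rewrite /F; do 2 case: ifP => // _; move=> -> ->.
have e : (poisson_law l (\bigcup_r F r) = \sum_(r <oo) poisson_law l (F r))%E.
  exact: (@measure_semi_bigcup _ _ _ (poisson_prob l 0%N)).
rewrite {1}UF e; apply: eq_eseriesr => r _; rewrite /F.
case: ifP => _; first exact: poisson_law1.
exact: (measure0 (poisson_prob l 0%N)).
Qed.

Lemma prod_restrict (R : realType) (I : eqType) (b s : seq I) (F : I -> \bar R) :
  uniq b -> uniq s -> {subset s <= b} ->
  \prod_(i <- b) (if i \in s then F i else 1) = \prod_(i <- s) F i.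
Proof.
move=> ub us sb; have pb : perm_eq [seq i <- b | i \in s] s.
  apply: uniq_perm => //; first by rewrite filter_uniq.
  by move=> i; rewrite mem_filter; case: (boolP (i \in s)) => //= /sb ->.
rewrite -(perm_big _ pb)/= big_filter [RHS]big_mkcond/=.
by apply: eq_bigr.
Qed.

Lemma mutually_independent_inj d (T : measurableType d) (R : realType)
    (P : probability T R) (I J : eqType) (F : I -> set (set T)) (f : J -> I)
    (g : I -> option J) : pcancel f g ->
  mutually_independent P F -> mutually_independent P (fun j => F (f j)).
Proof.
move=> fK ind s E us FE.
(* Events indexed by I, obtained by pulling back along the partial inverse of f. *)
pose E' i := if g i is Some j then E j else setT.
have := ind (map f s) E'; rewrite map_inj_uniq; last exact: pcan_inj fK.
move=> /(_ us) H.
transitivity (P (\big[setI/setT]_(i <- map f s) E' i)).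
  by congr (P _); rewrite big_map; apply: eq_bigr => j _; rewrite /E' fK.
rewrite H; first by rewrite big_map; apply: eq_bigr => j _; rewrite /E' fK.
by move=> _ /mapP[j js ->]; rewrite /E' fK; exact: FE.
Qed.

Lemma preimage_system_setI d (T : measurableType d) d' (T' : measurableType d') (f : T -> T') :
  setI_closed (preimage_set_system setT f measurable).
Proof.
move=> _ _ [X mX <-] [Y mY <-]; exists (X `&` Y); first exact: measurableI.
by rewrite !setTI preimage_setI.
Qed.

Lemma preimage_systemT d (T : measurableType d) d' (T' : measurableType d') (f : T -> T') :
  preimage_set_system setT f measurable setT.
Proof. by exists setT => //; rewrite preimage_setT setTI. Qed.

Lemma preimage_system_sub d (T : measurableType d) d' (T' : measurableType d') (f : T -> T') :
  measurable_fun setT f -> preimage_set_system setT f measurable `<=` measurable.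
Proof. by move=> mf _ [X mX <-]; exact: mf. Qed.

Section partition_of_series.
Context (R : realType).
Implicit Types (a : nat -> \bar R) (b : nat -> bool).

Lemma nneseries_single (f : nat -> \bar R) (n : nat) :
  (forall i, 0 <= f i) -> (forall i, i != n -> f i = 0) -> \sum_(i <oo) f i = f n.
Proof.
move=> f0 fn; rewrite (@nneseriesD1 _ f n xpredT)//.
rewrite eseries0 ?adde0// => i _ /andP[_ ni]; exact: fn.
Qed.

Lemma series_kth b a : finite_count b ->
  \sum_(k <oo) (if b k then a k else 0) = \sum_(i < total_count b) a (kth b i).
Proof.
move=> /total_countP [K0 K0b]; apply: cvg_lim => //; apply: cvg_near_cst.
exists K0 => // K /= K0K; rewrite big_mkord -big_mkcond/= (@big_kth _ _ _ b a K).
by rewrite K0b.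
Qed.

Lemma sum_permn (r n : nat) (f : nat -> \bar R) :
  \sum_(j < r) f (permn r n j) = \sum_(j < r) f j.
Proof.
rewrite [RHS](reindex_inj (@perm_inj _ (nth_perm r n))).
by apply: eq_bigr => j _; rewrite permnE.
Qed.

(** Non-negative terms may be grouped by classes; terms that vanish need not
have a class. *)
Lemma series_partition (b : nat * nat -> nat -> bool) a :
  (forall k, 0 <= a k) -> (forall c c' k, b c k -> b c' k -> c = c') ->
  (forall k, a k != 0 -> exists c, b c k) ->
  \sum_(k <oo) a k =
    \sum_(m <oo) \sum_(y <oo) \sum_(k <oo) (if b (m, y) k then a k else 0).
Proof.
move=> a0 bu be.
have t0 m y k : 0 <= (if b (m, y) k then a k else 0) by case: ifP.
transitivity (\sum_(k <oo) \sum_(m <oo) \sum_(y <oo) (if b (m, y) k then a k else 0)).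
  apply: eq_eseriesr => k _; have [ak|/be[[m y] bk]] := eqVneq (a k) 0.
    rewrite ak eseries0// => m _ _; rewrite eseries0// => y _ _; by case: ifP.
  rewrite (@nneseries_single _ m).
  - rewrite (@nneseries_single _ y) ?bk// => y' y'y.
    case: ifP => // /(bu _ _ _ bk) [yy]; by rewrite yy eqxx in y'y.
  - by move=> m'; apply: nneseries_ge0.
  - move=> m' m'm; rewrite eseries0// => y' _ _.
    case: ifP => // /(bu _ _ _ bk) [mm]; by rewrite mm eqxx in m'm.
rewrite nneseries_interchange; last by move=> k m; exact: nneseries_ge0.
apply: eq_eseriesr => m _; rewrite nneseries_interchange//.
Qed.

End partition_of_series.

(** * The extended probability space *)

(** The coordinates of the countable product are numbered, and nothing but the
injectivity of the numbering matters. *)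
Lemma index_coding : {p : ((nat * nat * nat -> nat) * (nat -> nat * nat * nat))%type |
  cancel p.1 p.2}.
Proof.
exists (pickle, fun n => odflt (0%N, 0%N, 0%N) (unpickle n)) => i /=.
by rewrite pickleK.
Qed.

Definition index_code : nat * nat * nat -> nat := (sval index_coding).1.
Definition index_decode : nat -> nat * nat * nat := (sval index_coding).2.

Lemma index_codeK : cancel index_code index_decode.
Proof. exact: (svalP index_coding). Qed.

Section extension.
Context d (T : measurableType d) (R : realType) (P : probability T R).
Context d' (Psi : measurableType d') (h : nat -> R -> R) (hh : pmf_family h).
Context (theta : nat -> T -> R) (psi : nat -> T -> Psi).
Context (x : nat -> nat -> {mfun T >-> nat}) (K0 : nat).
Local Open Scope ring_scope.
Local Notation bm := (@bounded_measurable d T R).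
Hypothesis theta0 : forall k w, 0 <= theta k w.
Hypothesis mtheta : forall k, measurable_fun setT (theta k).
Hypothesis mpsi : forall k, measurable_fun setT (psi k).
Hypothesis hx : conditionally_independent_counts P h theta psi x.
Local Notation Z := (measurableTypeR R * Psi)%type.
Local Notation class := (nat * nat)%type.
Local Notation TG := (g_sigma_algebraType (points_system theta psi)).

Local Notation ord_point := (ord_point theta psi K0).
Local Notation in_class := (in_class x K0).
Context (nu : {sigma_finite_measure set (measurableTypeR R) -> \bar R}) (G : probability Psi R).
Hypothesis ppp : poisson_point_process P (nu \x G)%E (fun w B => \sum_(k <oo) \d_(ord_point k w) B)%E.
Hypothesis size_fin : forall c, (size_law nu hh c setT < +oo)%E.
Local Notation rate := (size_rate nu hh).
Local Notation szp := (size_prob nu hh).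

(** The coordinate (c, j) consists of a point with the law of the points of class
c and of a uniform code for a permutation of j labels. *)
Definition fresh_law (i : class * nat) : probability (Z * nat)%type R :=
  ((szp i.1 \x G) \x unif_nat R (i.2)`!.-1)%E.

Definition fresh_space := seq_type (Z * nat)%type.
Definition fresh_prob : probability fresh_space R := seq_prob (fun n => fresh_law (index_decode n)).
Definition fresh (i : class * nat) (u : fresh_space) : Z * nat := seq_coord (index_code i) u.

Lemma measurable_fresh i : measurable_fun setT (fresh i).
Proof. exact: measurable_seq_coord. Qed.

Lemma fresh_prob_coord (s : seq (class * nat)) (B : class * nat -> set (Z * nat)) :
  uniq s -> (forall i, measurable (B i)) ->
  fresh_prob [set u | forall i, i \in s -> B i (fresh i u)] = (\prod_(i <- s) fresh_law i (B i))%E.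
Proof.
move=> us mB.
have us' : uniq (map index_code s) by rewrite map_inj_uniq//; exact: (can_inj index_codeK).
have := @seq_prob_coord _ _ R (fun n => fresh_law (index_decode n)) (fun n => B (index_decode n)) _ us' (fun n => mB _).
set lhs := fresh_prob _.
set rhs := seq_prob _ _; have -> : rhs = lhs; last first.
  move=> ->; transitivity (\prod_(i <- s) fresh_law (index_decode (index_code i)) (B (index_decode (index_code i))))%E.
    exact: (big_map index_code xpredT (fun n => fresh_law (index_decode n) (B (index_decode n)))).
  by apply: eq_bigr => i _; rewrite index_codeK.
rewrite /rhs /lhs; congr (fresh_prob _); apply/seteqP; split=> u /= H.
  by move=> i i_s; have := H _ (map_f index_code i_s); rewrite index_codeK.
by move=> _ /mapP[i i_s ->]; rewrite index_codeK; exact: H.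
Qed.

Local Notation Omega' := (T * fresh_space)%type.
Definition ext_prob : probability Omega' R := (P \x fresh_prob)%E.
Local Notation P' := ext_prob.

Definition rho (c : class) (w : Omega') : nat := total_count (in_class c ^~ w.1).

(** The atoms of the class, in the order of the random permutation drawn for their
number, followed by fresh points. *)
Definition labelled_point (c : class) (j : nat) (w : Omega') : Z :=
  if (j < rho c w)%N then
    class_point ord_point (in_class c) (permn (rho c w) (fresh (c, rho c w) w.2).2 j) w.1
  else (fresh (c, j) w.2).1.

Lemma measurable_rho c : measurable_fun setT (rho c).
Proof.
have mt : measurable_fun setT (fun w => total_count (in_class c ^~ w)).
  by apply: measurable_total_count => k; exact: measurable_in_class.
exact: (measurableT_comp mt measurable_fst).
Qed.

Let mord k : measurable_fun setT (ord_point k).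
Proof. exact: measurable_ord_point. Qed.

Lemma measurable_labelled_point c j : measurable_fun setT (labelled_point c j).
Proof.
pose f r (w : Omega') := if (j < r)%N then
    class_point ord_point (in_class c) (permn r (fresh (c, r) w.2).2 j) w.1
  else (fresh (c, j) w.2).1.
apply: (@measurable_nat_comp _ _ _ _ (rho c) f); first exact: measurable_rho.
move=> r; rewrite /f; case: (j < r)%N.
  apply: (@measurable_nat_comp _ _ _ _ (fun w : Omega' => (fresh (c, r) w.2).2)
     (fun n w => class_point ord_point (in_class c) (permn r n j) w.1)).
    exact: (measurableT_comp measurable_snd (measurableT_comp (measurable_fresh (c, r)) measurable_snd)).
  move=> n; have mp : measurable_fun setT (class_point ord_point (in_class c) (permn r n j)).
    by apply: measurable_class_point; [exact: mord|move=> k; exact: measurable_in_class].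
  exact: (measurableT_comp mp measurable_fst).
exact: (measurableT_comp measurable_fst (measurableT_comp (measurable_fresh (c, j)) measurable_snd)).
Qed.

Definition rho_is (c : class) (r : nat) : set Omega' := [set w | count_isb (in_class c ^~ w.1) r].

Lemma measurable_rho_is c r : measurable (rho_is c r).
Proof.
have := measurable_count_isb (fun k => measurable_in_class x K0 c k) r.
by move=> /(@measurable_fst _ _ T fresh_space measurableT); rewrite setTI.
Qed.

Definition rect (A : set (measurableTypeR R)) (B : set Psi) : set Z := A `*` B.

Section joint.
Context (C : seq class) (uC : uniq C) (r : class -> nat).
Context (A : class -> nat -> set (measurableTypeR R)) (B : class -> nat -> set Psi).
Hypothesis mA : forall c j, measurable (A c j).
Hypothesis mB : forall c j, measurable (B c j).
Context (J : nat).
Hypothesis rJ : forall c, c \in C -> (r c < J)%N.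

Definition joint_event : set Omega' := [set w | forall c, c \in C ->
  count_isb (in_class c ^~ w.1) (r c) /\ forall j, (j < J)%N -> rect (A c j) (B c j) (labelled_point c j w)].

Let fz c j : R := fine (szp c (A c j)) * fine (G (B c j)).
Let kap c : R := \prod_(j < J) (if (r c <= j)%N then fz c j else 1).

(** With the atoms fixed, the coordinate (c, r c) averages over the labellings of
the r c atoms of the class, and the coordinates (c, j) with r c <= j put fresh
points in the rectangles. *)
Lemma fresh_section (w : T) : (fresh_prob (xsection joint_event w) =
  (\prod_(c <- C) (symm_count ord_point (in_class c) (fun j : 'I_(r c) => \1_(rect (A c j) (B c j))) w * kap c))%:E)%E.
Proof.
have [hall|] := boolP (all (fun c => count_isb (in_class c ^~ w) (r c)) C); last first.
  move=> /allPn[c cC nh]; rewrite (_ : xsection _ _ = set0).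
    by rewrite measure0 (big_rem c)//= /symm_count (negbTE nh) !mul0r.
  apply/seteqP; split=> // u; rewrite /xsection/= inE => /(_ c cC)[/=].
  by rewrite (negbTE nh).
have rE c : c \in C -> forall u, rho c (w, u) = r c.
  by move=> cC u; have /allP/(_ c cC) := hall; rewrite count_isbE => /andP[_ /eqP].
pose V c : set nat := [set n | [forall k : 'I_(r c),
   class_point ord_point (in_class c) (nth_perm (r c) n k) w \in rect (A c k) (B c k)]].
pose D (i : class * nat) : set (Z * nat) :=
  (if (r i.1 <= i.2)%N then rect (A i.1 i.2) (B i.1 i.2) else setT) `*`
  (if i.2 == r i.1 then V i.1 else setT).
have mD i : measurable (D i).
  by apply: measurableX; case: ifP => // _; exact: measurableX.
pose s := [seq (c, j) | c <- C, j <- iota 0 J].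
have us : uniq s by apply: allpairs_uniq => //; rewrite ?iota_uniq// => -[? ?] [? ?].
have secE : xsection joint_event w = [set u | forall i, i \in s -> D i (fresh i u)].
  apply/seteqP; split=> u; rewrite /xsection/= inE.
    move=> H [c j] /allpairsP[[c' j'] /= [cC]]; rewrite mem_iota add0n/= => jJ [-> ->].
    move: cC jJ => {c j} cC jJ; have [_ H2] := H _ cC; split=> /=.
      case: ifPn => // rj; have := H2 _ jJ; rewrite /labelled_point rE// ltnNge rj/=.
      by [].
    case: eqVneq => // jr; rewrite /V/=; apply/forallP => k; apply/mem_set.
    have := H2 k (ltn_trans (ltn_ord k) (rJ cC)); rewrite /labelled_point rE// ltn_ord permnE.
    by rewrite jr.
  move=> H c cC; split; first by have /allP/(_ c cC) := hall.
  move=> j jJ; rewrite /labelled_point rE//.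
  have sin j' : (j' < J)%N -> (c, j') \in s.
    by move=> j'J; apply/allpairsP; exists (c, j'); rewrite mem_iota add0n.
  case: ltnP => jr /=.
    have [_ /=] := H _ (sin _ (rJ cC)); rewrite eqxx => /forallP/(_ (Ordinal jr))/set_mem.
    by rewrite (permnE _ (Ordinal jr)).
  by have [/=] := H _ (sin _ jJ); rewrite jr.
rewrite secE fresh_prob_coord// big_allpairs_dep/= -prodEFin.
apply: eq_big_seq => c cC.
have lawE j : (fresh_law (c, j) (D (c, j)) =
   ((if (r c <= j)%N then fz c j else 1) *
    (if j == r c then fine (unif_nat R (r c)`!.-1 (V c)) else 1))%:E)%E.
  transitivity ((szp c \x G) (if (r c <= j)%N then rect (A c j) (B c j) else setT) *
      unif_nat R (r c)`!.-1 (if j == r c then V c else setT))%E.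
    have -> : unif_nat R (r c)`!.-1 (if j == r c then V c else setT) =
        unif_nat R j`!.-1 (if j == r c then V c else setT).
      case: eqVneq => [->//|_]; transitivity (1%E : \bar R); first exact: probability_setT.
      by apply/esym; exact: probability_setT.
    apply: product_measure1E; last by case: ifP.
    by case: ifP => // _; exact: measurableX.
  rewrite EFinM; congr (_ * _)%E => /=.
    case: ifP => _; last exact: probability_setT.
    by rewrite product_measure1E// /fz EFinM !fineK// fin_num_measure.
  case: eqVneq => [_|_]; last exact: probability_setT.
  by rewrite fineK// fin_num_measure.
under eq_bigr do rewrite lawE.
rewrite prodEFin; congr EFin; rewrite big_split/= mulrC.
have iE (F : nat -> R) : \prod_(j <- iota 0 J) F j = \prod_(j < J) F j.
  by rewrite -[in LHS](subn0 J) -/(index_iota 0 J) big_mkord.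
rewrite !iE -/(kap c); congr (_ * _).
rewrite -big_mkcond/= (big_pred1 (Ordinal (rJ cC))); last by move=> j.
rewrite /V (unif_perm R (fun sg : 'S_(r c) => [forall k : 'I_(r c),
   class_point ord_point (in_class c) (sg k) w \in rect (A c k) (B c k)])).
rewrite /symm_count; have /allP/(_ c cC) -> := hall; rewrite mul1r; congr (_ * _).
(* In [symm_count] labels are permuted rather than points, hence the inverse. *)
rewrite [RHS](reindex_inj invg_inj)/=; apply: eq_bigr => sg _.
rewrite [RHS](reindex_perm sg)/=.
rewrite [RHS](eq_bigr (fun k => (class_point ord_point (in_class c) (sg k) w \in rect (A c k) (B c k))%:R)); last first.
  by move=> k _; rewrite permK indicE.
case: (boolP [forall k, _]) => [/forallP H|].
  by rewrite big1// => k _; rewrite H.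
rewrite negb_forall => /existsP[k /negbTE nk].
by rewrite (bigD1 k)//= nk mul0r.
Qed.

(** [fresh_section] integrates the fresh coordinates out, and [class_law] gives
the expectation of what remains. *)
Lemma joint_law : ext_prob joint_event = (\prod_(c <- C) (pois (rate c) (r c) *
  \prod_(j < J) fz c j))%:E.
Proof.
have mord' := mord; have mcl c := fun k => measurable_in_class x K0 c k.
have mg c j : measurable_fun setT (\1_(rect (A c j) (B c j)) : Z -> R).
  by apply: measurable_indic; exact: measurableX.
have g01 c j z : 0 <= (\1_(rect (A c j) (B c j)) z : R) <= 1.
  by rewrite indicE; case: (_ \in _); rewrite /= ?lexx ?ler01.
have bS : bm (fun w => \prod_(c <- C) symm_count ord_point (in_class c) (fun j : 'I_(r c) => \1_(rect (A c j) (B c j))) w).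
  by apply: bm_prod => c _; apply: bm_symm_count.
transitivity (\int[P]_w fresh_prob (xsection joint_event w))%E; first by [].
under eq_integral do rewrite fresh_section.
under eq_integral do rewrite big_split/= mulrC.
rewrite -EFin_Ex; last exact: bmZ.
rewrite ExZ//; congr EFin.
have uC0 : uniq (C ++ [::]) by rewrite cats0.
have cst01 (c : class) (z : Z) : 0 <= cst (0 : R) z <= 1 by rewrite /cst lexx ler01.
have s01 (c : class) : 0 <= (0 : R) < 1 by rewrite lexx ltr01.
have [_ e] := @class_law _ T R P _ Psi h hh theta psi x K0 theta0 mtheta mpsi hx (nu \x G)%E ppp
  (class_weight_integrable size_fin G) r (fun c j => \1_(rect (A c j) (B c j))) mg g01 C [::]
  (fun=> cst 0) (fun=> 0) uC0 (fun=> measurable_cst _) cst01 s01.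
move: e; under eq_Ex do rewrite big_nil mulr1.
rewrite big_nil mulr1 => ->.
rewrite -big_split/=; apply: eq_big_seq => c cC.
have kE : (\prod_(j < r c) fz c j) * kap c = \prod_(j < J) fz c j.
  rewrite (big_ord_widen J (fz c) (ltnW (rJ cC))) big_mkcond/= -big_split/=.
  by apply: eq_bigr => j _; case: ltnP; rewrite ?mul1r ?mulr1.
rewrite -kE (class_integral_total size_fin G) (eq_bigr (fun j : 'I_(r c) => rate c * fz c j)); last first.
  by move=> j _; exact: class_integral_rect.
rewrite big_split/= big_const_ord iter_mulr_1 /pois.
by ring.
Qed.

End joint.

Section joint_sets.
Context (A : class -> nat -> set (measurableTypeR R)) (B : class -> nat -> set Psi).
Hypothesis mA : forall c j, measurable (A c j).
Hypothesis mB : forall c j, measurable (B c j).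
Context (J : nat).

Definition in_rects (c : class) : set Omega' :=
  [set w | forall j, (j < J)%N -> rect (A c j) (B c j) (labelled_point c j w)].

Definition rects_mass (c : class) : R :=
  \prod_(j < J) (fine (szp c (A c j)) * fine (G (B c j))).

Lemma measurable_in_rects c : measurable (in_rects c).
Proof.
rewrite (_ : in_rects c = \big[setI/setT]_(j <- iota 0 J) (labelled_point c j @^-1` (rect (A c j) (B c j)))).
  apply: bigsetI_measurable => j _; rewrite -[X in measurable X]setTI.
  by apply: measurable_labelled_point => //; exact: measurableX.
rewrite bigsetI_mem; apply/seteqP; split=> w H j; first by rewrite mem_iota add0n; exact: H.
by move=> jJ; apply: H; rewrite mem_iota add0n.
Qed.

(** The bound on the totals in [joint_law] is removed by taking more labels,
with the whole space as rectangle for the new ones. *)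
Lemma joint_rho_is (C : seq class) (r : class -> nat) : uniq C ->
  P' [set w | forall c, c \in C -> rho_is c (r c) w /\ in_rects c w] =
  (\prod_(c <- C) (pois (rate c) (r c) * rects_mass c))%:E.
Proof.
move=> uC; pose J' := (J + (\max_(c <- C) r c).+1)%N.
pose A' c j := if (j < J)%N then A c j else setT.
pose B' c j := if (j < J)%N then B c j else setT.
have mA' c j : measurable (A' c j) by rewrite /A'; case: ifP.
have mB' c j : measurable (B' c j) by rewrite /B'; case: ifP.
have rJ' c : c \in C -> (r c < J')%N.
  by move=> cC; rewrite /J' addnS ltnS (leq_trans _ (leq_addl _ _))// (big_rem c)//= leq_maxl.
have := joint_law uC mA' mB' rJ'.
rewrite (_ : joint_event _ _ _ _ _ = [set w | forall c, c \in C -> rho_is c (r c) w /\ in_rects c w]).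
  move=> ->; congr EFin; apply: eq_bigr => c _; congr (_ * _).
  rewrite /J' big_split_ord/= [X in _ * X]big1 ?mulr1; last first.
    move=> j _; rewrite /A' /B' ltnNge leq_addr/=.
    transitivity (1 * 1 : R); last by rewrite mulr1.
    by congr (_ * _); exact: (congr1 fine (probability_setT _)).
  by apply: eq_bigr => j _; rewrite /A' /B' ltn_ord.
apply/seteqP; split=> w H c cC; have [h1 h2] := H c cC; split=> // j jJ.
  have := h2 j (leq_trans jJ (leq_addr _ _)); by rewrite /A' /B' jJ.
by rewrite /A' /B'; case: (ltnP j J) => [|_]; [exact: h2|split].
Qed.

End joint_sets.

Lemma prob_rho_is c r : P' (rho_is c r) = (pois (rate c) r)%:E.
Proof.
have mT (c0 : class) (j : nat) : measurable (setT : set (measurableTypeR R)) by [].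
have mT' (c0 : class) (j : nat) : measurable (setT : set Psi) by [].
have := @joint_rho_is (fun _ _ => setT) (fun _ _ => setT) mT mT' 0 [:: c] (fun=> r) isT.
rewrite big_seq1 /rects_mass big_ord0 mulr1 => <-; congr (P' _).
apply/seteqP; split=> w /=.
  by move=> H c'; rewrite inE => /eqP ->; split => // j.
by move=> /(_ c); rewrite mem_head => -[].
Qed.

Definition rho_finite (c : class) : set Omega' := [set w | finite_count (in_class c ^~ w.1)].

Lemma measurable_rho_finite c : measurable (rho_finite c).
Proof.
have := measurable_finite_count (fun k => measurable_in_class x K0 c k).
by move=> /(@measurable_fst _ _ T fresh_space measurableT); rewrite setTI.
Qed.

Lemma rho_finiteE c : rho_finite c = \bigcup_r rho_is c r.
Proof.
apply/seteqP; split=> w; rewrite /rho_finite /rho_is /=.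
  by move=> fw; exists (rho c w) => //=; rewrite count_isbE fw eqxx.
by move=> [r _ /=]; rewrite count_isbE => /andP[].
Qed.

Lemma trivIset_rho_is c : trivIset setT (rho_is c).
Proof.
move=> r r' _ _ [w []]; rewrite /rho_is/= !count_isbE.
by move=> /andP[_ /eqP ->] /andP[_ /eqP ->].
Qed.

(** The probabilities of the finite values add up to the total mass of a Poisson
law. *)
Lemma prob_rho_finite c : (P' (rho_finite c) = 1)%E.
Proof.
rewrite rho_finiteE measure_semi_bigcup//; last 3 first.
- by move=> r; exact: measurable_rho_is.
- exact: trivIset_rho_is.
- by apply: bigcupT_measurable => r; exact: measurable_rho_is.
transitivity (poisson_law (rate c) setT); last exact: (probability_setT (poisson_prob (rate c) 0%N)).
rewrite poisson_lawE ?size_rate_ge0//; apply: eq_eseriesr => r _.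
by rewrite in_setT; exact: prob_rho_is.
Qed.

Lemma prob_rho_split c (U : set nat) (D : set Omega') : measurable D ->
  (P' ([set w | U (rho c w)] `&` D) =
   \sum_(r <oo) if r \in U then P' (rho_is c r `&` D) else 0)%E.
Proof.
move=> mD.
have mU : measurable [set w : Omega' | U (rho c w)].
  have mr : measurable_fun setT (rho c : Omega' -> nat) by exact: measurable_rho.
  by rewrite -[X in measurable X]setTI; apply: mr.
have mf := measurable_rho_finite c.
set X := _ `&` D; have mX : measurable X by exact: measurableI.
have -> : P' X = P' (X `&` rho_finite c).
  have mXf : measurable (X `\` rho_finite c) by exact: measurableD.
  transitivity (P' (X `\` rho_finite c) +
      P' (X `&` rho_finite c))%E; first exact: measureDI.
  rewrite (_ : P' (X `\` _) = 0%E) ?add0e//.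
  apply: (subset_measure0 mXf (measurableC mf)); first by move=> w [].
  transitivity (1 - P' (rho_finite c))%E; first exact: probability_setC.
  by rewrite prob_rho_finite subee.
rewrite rho_finiteE setI_bigcupr measure_semi_bigcup//; last 3 first.
- by move=> r; apply: measurableI => //; exact: measurable_rho_is.
- by apply: trivIset_setIl; exact: trivIset_rho_is.
- by apply: bigcupT_measurable => r; apply: measurableI => //; exact: measurable_rho_is.
apply: eq_eseriesr => r _; case: ifPn => [/set_mem Ur|rU].
  congr (P' _); apply/seteqP; split=> w; rewrite /X/rho_is/=; first by move=> [[_ ?] ?].
  move=> [hr Dw]; split => //; split => //.
  by move: hr Ur; rewrite count_isbE => /andP[_ /eqP ->].
rewrite (_ : X `&` _ = set0) ?measure0//; apply/seteqP; split=> // w.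
rewrite /X/rho_is/= => -[[Uw _]]; rewrite count_isbE => /andP[_ /eqP rE].
by move/negP : rU; apply; apply/mem_set; rewrite rE.
Qed.

Section joint_sets_law.
Context (A : class -> nat -> set (measurableTypeR R)) (B : class -> nat -> set Psi).
Hypothesis mA : forall c j, measurable (A c j).
Hypothesis mB : forall c j, measurable (B c j).
Context (J : nat) (U : class -> set nat).

Local Notation totals_in C :=
  [set w | forall c, c \in C -> U c (rho c w) /\ in_rects A B J c w].
Local Notation totals_are r C :=
  [set w | forall c, c \in C -> rho_is c (r c) w /\ in_rects A B J c w].

(** [joint_rho_is] is summed over the values of the totals, for one class after the
other: exact totals are prescribed on C2 and sets of totals on C1. *)
Lemma joint_rho (C1 C2 : seq class) (r : class -> nat) : uniq (C1 ++ C2) ->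
  (P' ((totals_in C1) `&`
      (totals_are r C2)) =
  (\prod_(c <- C1) (poisson_law (rate c) (U c) * (rects_mass A B J c)%:E)) *
  (\prod_(c <- C2) (pois (rate c) (r c) * rects_mass A B J c))%:E)%E.
Proof.
elim: C1 C2 r => [|c C1 IH] C2 r uC.
  rewrite big_nil mul1e; transitivity (P' (totals_are r C2)); last exact: joint_rho_is.
  by congr (P' _); apply/seteqP; split=> w; [case|split].
have uC' : uniq (C1 ++ c :: C2) by rewrite -cat1s uniq_catCA.
have cC2 : c \notin C2.
  by move: uC => /= /andP[]; rewrite mem_cat negb_or => /andP[].
have mU c' : measurable [set w : Omega' | U c' (rho c' w)].
  have mr : measurable_fun setT (rho c' : Omega' -> nat) by exact: measurable_rho.
  by rewrite -[X in measurable X]setTI; apply: mr.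
have mC1 (C : seq class) : measurable (totals_in C).
  rewrite -(bigsetI_mem _ (fun c => [set w | U c (rho c w) /\ in_rects A B J c w])).
  by apply: bigsetI_measurable => c' _; apply: measurableI; [exact: mU|exact: measurable_in_rects].
have mC2 (C : seq class) : measurable (totals_are r C).
  rewrite -(bigsetI_mem _ (fun c => [set w | rho_is c (r c) w /\ in_rects A B J c w])).
  by apply: bigsetI_measurable => c' _; apply: measurableI;
    [exact: measurable_rho_is|exact: measurable_in_rects].
pose D := in_rects A B J c `&` ((totals_in C1) `&`
      (totals_are r C2)).
have mD : measurable D by apply: measurableI; [exact: measurable_in_rects|exact: measurableI].
rewrite [X in P' X](_ : _ = [set w | U c (rho c w)] `&` D); last first.
  apply/seteqP; split=> w /=.
    move=> [H1 H2]; have [h1 h2] := H1 c (mem_head _ _); split => //; split => //; split => //.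
    by move=> c' c'C; apply: H1; rewrite inE c'C orbT.
  by move=> [h1 [h2 [H1 H2]]]; split => // c'; rewrite inE => /predU1P[->|/H1].
rewrite prob_rho_split//.
have rcE q : (P' (rho_is c q `&` D) =
   (\prod_(c <- C1) (poisson_law (rate c) (U c) * (rects_mass A B J c)%:E)) *
   (pois (rate c) q * (rects_mass A B J c *
      \prod_(c <- C2) (pois (rate c) (r c) * rects_mass A B J c)))%:E)%E.
  pose r' c' := if c' == c then q else r c'.
  have r'E c' : c' \in C2 -> r' c' = r c'.
    by move=> c'C; rewrite /r'; case: eqVneq => // cc; rewrite -cc c'C in cC2.
  have := IH (c :: C2) r' uC'.
  rewrite big_cons [in X in _ = (_ * X%:E)%E](eq_big_seq (fun c => pois (rate c) (r c) * rects_mass A B J c)); last first.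
    by move=> c' /r'E ->.
  rewrite {2}/r' eqxx mulrA => <-; congr (P' _); apply/seteqP; split=> w /=.
    move=> [h1 [h2 [H1 H2]]]; split=> // c'; rewrite inE => /predU1P[->|c'C].
      by rewrite /r' eqxx.
    by rewrite r'E//; exact: H2.
  move=> [H1 H2]; have [h1 h2] := H2 c (mem_head _ _); split; first by move: h1; rewrite /r' eqxx.
  split => //; split => // c' c'C; rewrite -r'E//; apply: H2.
  by rewrite inE c'C orbT.
pose pl c' : R := fine (poisson_law (rate c') (U c')).
have plE c' : poisson_law (rate c') (U c') = (pl c')%:E.
  by rewrite /pl fineK//; exact: (fin_num_measure (poisson_prob (rate c') 0%N)).
have rm0 c' : 0 <= rects_mass A B J c'.
  by apply: prodr_ge0 => j _; rewrite mulr_ge0// fine_ge0.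
pose K1 : R := \prod_(c <- C1) (pl c * rects_mass A B J c).
have K1E : (\prod_(c <- C1) (poisson_law (rate c) (U c) * (rects_mass A B J c)%:E) = K1%:E)%E.
  by rewrite -prodEFin; apply: eq_bigr => c' _; rewrite plE.
pose K2 : R := \prod_(c <- C2) (pois (rate c) (r c) * rects_mass A B J c).
have K10 : 0 <= K1.
  by apply: prodr_ge0 => c' _; rewrite mulr_ge0// -lee_fin -plE; exact: measure_ge0.
have K20 : 0 <= K2.
  by apply: prodr_ge0 => c' _; rewrite mulr_ge0// pois_ge0// size_rate_ge0.
transitivity (\sum_(q <oo) (K1 * (rects_mass A B J c * K2))%:E *
    (if q \in U c then (pois (rate c) q)%:E else 0))%E.
  apply: eq_eseriesr => q _; case: ifP => _; last by rewrite mule0.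
  by rewrite rcE K1E -/K2 -!EFinM; congr EFin; ring.
rewrite nneseriesZl; last first.
  by move=> q _; case: ifP => // _; rewrite lee_fin pois_ge0// size_rate_ge0.
rewrite -poisson_lawE ?size_rate_ge0// big_cons K1E -/K2 plE -!EFinM.
by congr EFin; ring.
Qed.

End joint_sets_law.

Definition location (i : class * nat) (w : Omega') : Psi := (labelled_point i.1 i.2 w).2.
(** The absolute value makes the weights non-negative at every sample; it does
not change their law, which is carried by the half-line. *)
Definition weight (i : class * nat) (w : Omega') : R := `|(labelled_point i.1 i.2 w).1|.

Lemma measurable_location i : measurable_fun setT (location i).
Proof. by apply: (measurableT_comp measurable_snd); exact: measurable_labelled_point. Qed.

Lemma measurable_weight i : measurable_fun setT (weight i).
Proof.
have mf : measurable_fun setT (fun w : Omega' => (labelled_point i.1 i.2 w).1).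
  by apply: (measurableT_comp measurable_fst); exact: measurable_labelled_point.
exact: (measurableT_comp (@normr_measurable R setT) mf).
Qed.

Local Notation family := ((class * nat) + (class * nat) + class)%type.

Record family_sets := FamilySets {
  psi_sets : class * nat -> set Psi;
  theta_sets : class * nat -> set (measurableTypeR R);
  rho_sets : class -> set nat }.

Definition family_event (D : family_sets) (i : (class * nat) + (class * nat) + class) : set Omega' :=
  match i with
  | inl (inl p) => location p @^-1` psi_sets D p
  | inl (inr p) => weight p @^-1` theta_sets D p
  | inr c => rho c @^-1` rho_sets D c
  end.

Definition family_mass (D : family_sets) (i : (class * nat) + (class * nat) + class) : \bar R :=
  match i with
  | inl (inl p) => G (psi_sets D p)
  | inl (inr p) => szp p.1 ((Num.norm : R -> R) @^-1` theta_sets D p)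
  | inr c => poisson_law (rate c) (rho_sets D c)
  end.

(** This is [joint_rho] for the classes that occur in s, with the whole space for
the variables of these classes that do not occur. *)
Lemma family_law (D : family_sets) (s : seq family) :
  (forall p, measurable (psi_sets D p)) -> (forall p, measurable (theta_sets D p)) ->
  uniq s ->
  (P' (\big[setI/setT]_(i <- s) family_event D i) = \prod_(i <- s) family_mass D i)%E.
Proof.
move=> mpsi' mtheta' us.
pose cls (i : (class * nat) + (class * nat) + class) : class :=
  match i with inl (inl p) => p.1 | inl (inr p) => p.1 | inr c => c end.
pose idx (i : (class * nat) + (class * nat) + class) : nat :=
  match i with inl (inl p) => p.2 | inl (inr p) => p.2 | inr c => 0%N end.
pose D' := FamilySets (fun p => if inl (inl p) \in s then psi_sets D p else setT)
  (fun p => if inl (inr p) \in s then theta_sets D p else setT)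
  (fun c => if inr c \in s then rho_sets D c else setT).
have mass' i : family_mass D' i = (if i \in s then family_mass D i else 1)%E.
  case: i => [[p|p]|c] /=; case: ifP => // _.
  - exact: probability_setT.
  - by rewrite preimage_setT; exact: probability_setT.
  - exact: (probability_setT (poisson_prob (rate c) 0%N)).
pose C := undup (map cls s).
have [J idxJ] : exists J, forall i, i \in s -> (idx i < J)%N.
  by exists (\max_(i <- s) idx i).+1 => i i_s; rewrite ltnS (big_rem i)//= leq_maxl.
have uC : uniq (C ++ [::]) by rewrite cats0 undup_uniq.
have clsC i : i \in s -> cls i \in C by move=> i_s; rewrite mem_undup map_f.
pose A c j := (Num.norm : R -> R) @^-1` theta_sets D' (c, j).
pose B c j := psi_sets D' (c, j).
have mA c j : measurable (A c j : set (measurableTypeR R)).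
  rewrite /A -[X in measurable X]setTI; apply: (@normr_measurable R setT) => //.
  by rewrite /D'/=; case: ifP => _; [exact: mtheta'|exact: measurableT].
have mB c j : measurable (B c j).
  by rewrite /B/D'/=; case: ifP => _; [exact: mpsi'|exact: measurableT].
have := @joint_rho
  A B mA mB J (rho_sets D') C [::] (fun=> 0%N) uC.
rewrite [X in P' X](_ : _ = \big[setI/setT]_(i <- s) family_event D i); last first.
  rewrite bigsetI_mem; apply/seteqP; split=> w /=.
    move=> [H _] i i_s; have [h1 h2] := H _ (clsC _ i_s); have := h2 _ (idxJ _ i_s).
    case: i i_s {h2} h1 => [[[c j]|[c j]]|c] /= i_s h1 [h2 h3].
    - by move: h3; rewrite /B/= i_s.
    - by move: h2; rewrite /A/= i_s.
    - by move: h1; rewrite i_s.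
  move=> H; split=> // c cC; split=> /=.
    by case: ifPn => // /H.
  move=> j jJ; split=> /=; rewrite /A/B/=.
    by case: ifPn => // /H.
  by case: ifPn => // /H.
move=> ->; rewrite big_nil mule1.
pose b : seq family := [seq inr c | c <- C] ++
  ([seq inl (inl (c, j)) | c <- C, j <- iota 0 J] ++ [seq inl (inr (c, j)) | c <- C, j <- iota 0 J]).
transitivity (\prod_(i <- b) family_mass D' i)%E; last first.
  under eq_bigr do rewrite mass'.
  apply: prod_restrict => //.
    rewrite !cat_uniq; apply/and3P; split.
    - rewrite map_inj_uniq ?undup_uniq// => ? ? [] //.
    - apply/hasPn => i; rewrite mem_cat => /orP[] /allpairsP[p [_ _ ->]]; by apply/mapP => -[].
    - apply/and3P; split.
      + by apply: allpairs_uniq; rewrite ?undup_uniq ?iota_uniq// => -[? ?] [? ?] _ _ /= [-> ->].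
      + apply/hasPn => i /allpairsP[p [_ _ ->]]; by apply/allpairsP => -[? []].
      + by apply: allpairs_uniq; rewrite ?undup_uniq ?iota_uniq// => -[? ?] [? ?] _ _ /= [-> ->].
  move=> i i_s; have cC := clsC _ i_s; have jJ := idxJ _ i_s.
  have in2 (f : class -> nat -> (class * nat) + (class * nat) + class) c j :
      c \in C -> (j < J)%N -> f c j \in [seq f c j | c <- C, j <- iota 0 J].
    by move=> cC' jJ'; apply: allpairs_f => //; rewrite mem_iota add0n.
  rewrite !mem_cat; case: i i_s cC jJ => [[[c j]|[c j]]|c] i_s cC jJ.
  - by rewrite (in2 (fun c j => inl (inl (c, j)))) ?orbT.
  - by rewrite (in2 (fun c j => inl (inr (c, j)))) ?orbT.
  - by apply/orP; left; apply: map_f.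
rewrite /b 2!big_cat big_map !big_allpairs_dep/= -2!big_split/=.
apply: eq_bigr => c _; congr (_ * _)%E; rewrite /rects_mass -big_split/=.
rewrite -[in RHS](subn0 J) -/(index_iota 0 J) big_mkord -prodEFin.
apply: eq_bigr => j _; rewrite muleC EFinM !fineK//; exact: fin_num_measure.
Qed.

Definition family_system (i : family) : set (set Omega') :=
  match i with
  | inl (inl p) => preimage_set_system setT (location p) measurable
  | inl (inr p) => preimage_set_system setT (weight p) measurable
  | inr c => preimage_set_system setT (rho c) measurable
  end.

Lemma family_independent : mutually_independent P' family_system.
Proof.
move=> s E us FE.
have /choice[B BE] : forall p, exists X : set Psi, measurable X /\
    (inl (inl p) \in s -> location p @^-1` X = E (inl (inl p))).
  move=> p; case: (boolP (inl (inl p) \in s)) => [i_s|_]; last by exists setT; split.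
  by have [X mX XE] := FE _ i_s; exists X; split=> // _; rewrite -XE setTI.
have /choice[A AE] : forall p, exists X : set (measurableTypeR R), measurable X /\
    (inl (inr p) \in s -> weight p @^-1` X = E (inl (inr p))).
  move=> p; case: (boolP (inl (inr p) \in s)) => [i_s|_]; last by exists setT; split.
  by have [X mX XE] := FE _ i_s; exists X; split=> // _; rewrite -XE setTI.
have /choice[U UE] : forall c, exists X : set nat,
    (inr c \in s -> rho c @^-1` X = E (inr c)).
  move=> c; case: (boolP (inr c \in s)) => [i_s|_]; last by exists setT.
  by have [X mX XE] := FE _ i_s; exists X => _; rewrite -XE setTI.
pose D := FamilySets B A U.
have DE i : i \in s -> E i = family_event D i.
  case: i => [[p|p]|c] i_s /=.
  - by rewrite (BE p).2.
  - by rewrite (AE p).2.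
  - by rewrite UE.
rewrite (eq_big_seq _ DE) family_law//; last 2 first.
- by move=> p; exact: (BE p).1.
- by move=> p; exact: (AE p).1.
apply: eq_big_seq => i i_s; rewrite DE//.
have := @family_law D [:: i]; rewrite !big_seq1 => -> //.
- by move=> p; exact: (BE p).1.
- by move=> p; exact: (AE p).1.
Qed.

Lemma location_independent : independent_rvs P' location.
Proof.
apply: (@mutually_independent_inj _ _ _ _ _ _ family_system (fun p => inl (inl p))
  (fun i => if i is inl (inl p) then Some p else None)) => //.
exact: family_independent.
Qed.

Lemma weight_independent : independent_rvs P' weight.
Proof.
apply: (@mutually_independent_inj _ _ _ _ _ _ family_system (fun p => inl (inr p))
  (fun i => if i is inl (inr p) then Some p else None)) => //.
exact: family_independent.
Qed.

Lemma rho_independent : independent_rvs P' (fun c : class => rho c : Omega' -> nat).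
Proof.
apply: (@mutually_independent_inj _ _ _ _ _ _ family_system (fun c => inr c)
  (fun i => if i is inr c then Some c else None)) => //.
exact: family_independent.
Qed.

(** The product rule for the whole family is grouped by kind of variable. *)
Lemma families_independent : independent3 P' (sigma_gen setT location)
  (sigma_gen setT (fun c : class => rho c : Omega' -> nat)) (sigma_gen setT weight).
Proof.
pose b1 (i : family) := if i is inl (inl _) then true else false.
pose b2 (i : family) := if i is inr _ then true else false.
pose b3 (i : family) := if i is inl (inr _) then true else false.
have IF i : setI_closed (family_system i).
  by case: i => [[p|p]|c]; exact: preimage_system_setI.
have TF i : family_system i setT.
  by case: i => [[p|p]|c]; exact: preimage_systemT.
have mF i : family_system i `<=` measurable.
  case: i => [[p|p]|c]; apply: preimage_system_sub.
  - exact: measurable_location.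
  - exact: measurable_weight.
  - exact: measurable_rho.
have := @independent_blocks _ _ _ P' _ family_system IF TF mF family_independent b1 b2 b3.
rewrite /sigma_gen.
rewrite (_ : \bigcup_(i in [set i | b1 i]) _ = \bigcup_(p in setT) preimage_set_system setT (location p) measurable); last first.
  apply/seteqP; split=> X [i bi FX]; last by exists (inl (inl i)).
  by case: i bi FX => [[p|//]|//] _ FX; exists p.
rewrite (_ : \bigcup_(i in [set i | b2 i]) _ = \bigcup_(c in setT) preimage_set_system setT (rho c : Omega' -> nat) measurable); last first.
  apply/seteqP; split=> X [i bi FX]; last by exists (inr i).
  by case: i bi FX => [//|c] _ FX; exists c.
rewrite (_ : \bigcup_(i in [set i | b3 i]) _ = \bigcup_(p in setT) preimage_set_system setT (weight p) measurable); last first.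
  apply/seteqP; split=> X [i bi FX]; last by exists (inl (inr i)).
  by case: i bi FX => [[//|p]|//] _ FX; exists p.
by apply; case=> [[?|?]|?].
Qed.

Lemma location_law p (B : set Psi) : measurable B -> P' (location p @^-1` B) = G B.
Proof.
move=> mB; have := @family_law (FamilySets (fun=> B) (fun=> setT) (fun=> setT)) [:: inl (inl p)].
rewrite !big_seq1; apply => // q /=; first [exact: mB|exact: measurableT].
Qed.

Lemma weight_law p (A : set (measurableTypeR R)) : measurable A ->
  P' (weight p @^-1` A) = szp p.1 ((Num.norm : R -> R) @^-1` A).
Proof.
move=> mA; have := @family_law (FamilySets (fun=> setT) (fun=> A) (fun=> setT)) [:: inl (inr p)].
rewrite !big_seq1; apply => // q /=; first [exact: measurableT|exact: mA].
Qed.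

Lemma rho_law c (U : set nat) :
  P' ((rho c : Omega' -> nat) @^-1` U) = poisson_law (rate c) U.
Proof.
have := @family_law (FamilySets (fun=> setT) (fun=> setT) (fun=> U)) [:: inr c].
by rewrite !big_seq1; apply => // q /=; exact: measurableT.
Qed.

(** The negative half-line has no mass. *)
Lemma size_prob_norm c (A : set (measurableTypeR R)) : measurable A ->
  size_law nu hh c setT != 0%E ->
  szp c ((Num.norm : R -> R) @^-1` A) = F_size nu h c.1.+1 c.2.+1 A.
Proof.
move=> mA c0; transitivity ((size_rate nu hh c)^-1%:E * size_law nu hh c A)%E.
  rewrite (size_probE size_fin)//; congr (_ * _)%E.
  rewrite /size_law [LHS]integral_mkcond [RHS]integral_mkcond.
  apply: eq_integral => t _; rewrite !patchE.
  have [t0|t0] := leP 0 t.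
    have -> : (t \in (Num.norm : R -> R) @^-1` A) = (t \in (A : set R)).
      by apply/idP/idP; rewrite !inE /preimage/= ger0_norm.
    by [].
  by rewrite /class_weight leNgt t0/=; do 2 case: ifP.
by rewrite /F_size /size_rate 2!size_lawE.
Qed.

Lemma in_class_exists k w : (exists n, x n (K0 + k)%N w != 0%N) -> exists c, in_class c k w.
Proof.
move=> ex; have [m xm mmin] := ex_minnP ex.
exists (m, (x m (K0 + k)%N w).-1); apply/andP; split; last by rewrite /= prednK ?lt0n.
apply/forallP => n; apply/negPn/negP => /mmin; by rewrite leqNgt ltn_ord.
Qed.

(** The sum over the ordinary atoms is grouped by classes, and within a class the
relabelling permutes finitely many terms. *)
Lemma atomic_measure_split (w : Omega') (A : set Psi) :
  (forall c, finite_count (in_class c ^~ w.1)) ->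
  (forall k, 0 < theta (K0 + k)%N w.1 -> exists c, in_class c k w.1) ->
  (atomic_measure (theta ^~ w.1) (psi ^~ w.1) A =
   \sum_(k < K0) (theta k w.1)%:E * \d_(psi k w.1) A +
   \sum_(m <oo) \sum_(y <oo) \sum_(j < rho (m, y) w)
     (weight (m, y, nat_of_ord j) w)%:E * \d_(location (m, y, nat_of_ord j) w) A)%E.
Proof.
move=> fin vis.
pose F k : \bar R := ((theta k w.1)%:E * \d_(psi k w.1) A)%E.
have F0 k : (0 <= F k)%E by rewrite mule_ge0// lee_fin.
rewrite /atomic_measure -/(F _) (@nneseries_split _ F 0 K0)// add0n big_mkord.
congr (_ + _)%E; rewrite -(nneseries_addn K0)//.
rewrite (@series_partition _ (fun c k => in_class c k w.1) (fun k => F (k + K0)%N))//; first last.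
- move=> k Fk; apply: vis; rewrite lt_neqAle theta0 andbT eq_sym.
  by apply: contraNneq Fk => t0; rewrite /F addnC t0 mul0e.
- by move=> c c' k; exact: in_class_uniq.
apply: eq_eseriesr => m _; apply: eq_eseriesr => y _.
rewrite (@series_kth _ (in_class (m, y) ^~ w.1))//.
transitivity (\sum_(j < rho (m, y) w)
    F (kth (in_class (m, y) ^~ w.1) (permn (rho (m, y) w) (fresh ((m, y), rho (m, y) w) w.2).2 j) + K0)%N)%E;
  first by rewrite (sum_permn _ _ (fun i => F (kth (in_class (m, y) ^~ w.1) i + K0)%N)).
apply: eq_bigr => j _.
rewrite /weight /location /labelled_point/= ltn_ord /class_point/= /F addnC ger0_norm//.
Qed.

(** The weights of the atoms that no observation sees. *)
Definition invisible : set (measurableTypeR R) :=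
  [set t | 0 < t /\ h 0%N t = 1].

Lemma measurable_invisible : measurable invisible.
Proof.
have mh : measurable_fun (`[0, +oo[ : set R) (h 0%N) by have [] := hh.
rewrite /invisible (_ : [set t | _] = (`]0, +oo[ : set R) `&` (`[0, +oo[ `&` h 0%N @^-1` [set 1])).
  by apply: measurableI => //; exact: mh.
apply/seteqP; split=> t /=; rewrite !in_itv/= !andbT.
  by move=> [t0 ?]; split=> //; split=> //; exact: ltW.
by move=> [? []].
Qed.

(** Almost surely the Poisson process has no point in a set of mean measure 0. *)
Lemma invisible_null k :
  nu invisible = 0%E ->
  P [set w | 0 < theta (K0 + k)%N w /\ h 0%N (theta (K0 + k)%N w) = 1] = 0%E.
Proof.
pose W := invisible => W0; have mW : measurable W := measurable_invisible.
set E := [set w | _].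
have mE : measurable E.
  rewrite (_ : E = theta (K0 + k)%N @^-1` W)// -[X in measurable X]setTI.
  exact: mtheta.
have [mN pN _ _] := ppp.
have mWT : measurable (W `*` (setT : set Psi)) by exact: measurableX.
have mu0 : ((nu \x G) (W `*` setT) = 0)%E.
  transitivity (nu W * G setT)%E; first exact: product_measure1E.
  by transitivity (0 * G setT)%E; [congr (_ * _)%E; exact: W0|rewrite mul0e].
have := pN _ 0%N mWT; rewrite mu0 => /(_ (ltry _)).
rewrite poisson_law1// /pois oppr0 expR0 expr0 fact0 divr1 mulr1 => N0.
set N0s := [set w | _] in N0.
have mN0 : measurable N0s.
  have := mN _ mWT measurableT _ (emeasurable_set1 (0%:R%:E : \bar R)).
  by rewrite setTI.
have : P (~` N0s) = 0%E by rewrite probability_setC// N0 subee.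
apply: subset_measure0 => //; first exact: measurableC.
move=> w [t0 h1] /=; apply/eqP; rewrite gt_eqF//.
apply: (@lt_le_trans _ _ (\d_(ord_point k w) (W `*` setT))%E).
  by rewrite diracE mem_set//=.
by rewrite (@nneseriesD1 _ (fun k => \d_(ord_point k w) (W `*` setT))%E k xpredT)// leeDl// nneseries_ge0.
Qed.

(** With t the weight of the atom, the event that t > 0 and that the first N
observations do not see the atom has as probability the mean of [h 0 t ^ N] on
t > 0, which tends to the probability that t > 0 and [h 0 t = 1]. *)
Lemma unseen_null k :
  nu invisible = 0%E ->
  P.-negligible [set w | 0 < theta (K0 + k)%N w /\ forall n, x n (K0 + k)%N w = 0%N].
Proof.
move=> W0; set K := (K0 + k)%N.
pose D w : R := (0 < theta K w)%R%:R.
have mD : measurable_fun setT (D : TG -> R).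
  have mt : measurable_fun setT (theta K : TG -> R).
    exact: (measurableT_comp measurable_fst (@measurable_points _ _ _ _ _ theta psi K)).
  rewrite (_ : D = \1_[set w | 0 < theta K w]); last by apply/funext => w; rewrite indic_bool.
  apply: measurable_indic; rewrite (_ : [set w | _] = (theta K : TG -> R) @^-1` `]0, +oo[).
    by rewrite -[X in measurable X]setTI; exact: mt.
  by apply/seteqP; split=> w /=; rewrite in_itv/= andbT.
have D01 w : 0 <= D w <= 1 by rewrite /D; case: (_ < _); rewrite ?lexx ?ler01.
pose E N := [set w | (0 < theta K w) && [forall n : 'I_N, x n K w == 0%N]].
have mE N : measurable (E N).
  rewrite (_ : E N = [set w | 0 < theta K w] `&` \bigcap_(n < N) (x n K @^-1` [set 0%N])).
    apply: measurableI.
      rewrite (_ : [set w | _] = theta K @^-1` `]0, +oo[).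
        by rewrite -[X in measurable X]setTI; exact: mtheta.
      by apply/seteqP; split=> w /=; rewrite in_itv/= andbT.
    by apply: bigcap_measurableType => n _; exact: measurable_funPTI.
  apply/seteqP; split=> w /=.
    move=> /andP[t0 /forallP xn]; split=> // n nN; exact/eqP/(xn (Ordinal nN)).
  move=> [t0 xn]; apply/andP; split=> //; apply/forallP => n; apply/eqP; exact: (xn n (ltn_ord n)).
have PE N : fine (P (E N)) = Ex P (fun w => D w * h 0%N (theta K w) ^+ N).
  rewrite -Ex_indic//.
  transitivity (Ex P (fun w => D w * \prod_(i <- [seq (n, K) | n <- iota 0 N]) (x i.1 i.2 w == 0%N)%:R)).
    apply: eq_Ex => w; rewrite indic_bool /D -mulnb natrM; congr (_ * _).
    rewrite big_map/=; case: forallP => [xn|/forallP].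
      rewrite big1_seq// => n /andP[_]; rewrite mem_iota add0n/= => nN.
      by rewrite (xn (Ordinal nN)).
    rewrite negb_forall => /existsP[n xn].
    by rewrite (big_rem (n : nat))/= ?mem_iota ?ltn_ord// (negbTE xn) mul0r.
  rewrite (@array_counts _ T R P _ Psi h hh theta psi x theta0 mtheta mpsi hx D mD D01 _ (fun=> 0%N)); last first.
    by rewrite map_inj_uniq ?iota_uniq// => ? ? [].
  apply: eq_Ex => w; congr (_ * _); rewrite big_map/=.
  by rewrite -[in LHS](subn0 N) -/(index_iota 0 N) prodr_const_nat subn0.
pose L := [set w | 0 < theta K w /\ h 0%N (theta K w) = 1].
have hK w : 0 <= h 0%N (theta K w) <= 1 by rewrite (h_ge0 hh)//= (h_le1 hh).
have mh : measurable_fun setT (fun w => h 0%N (theta K w)).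
  exact: (measurable_htheta hh theta0 mtheta).
have mD' : measurable_fun setT D.
  exact: (sub_measurable_fun (points_system_sub mtheta mpsi) mD).
have [bL cL] : bounded_measurable (\1_L : T -> R) /\
    (fun N => Ex P (fun w => D w * h 0%N (theta K w) ^+ N)) @ \oo --> Ex P (\1_L).
  apply: (@Ex_cvg _ _ _ _ _ _ 1).
  - by move=> n; apply: measurable_funM => //; exact: measurable_funX.
  - move=> n w; have /andP[D0 D1] := D01 w; have /andP[h0 h1] := hK w.
    by rewrite ger0_norm ?mulr_ge0 ?exprn_ge0// mulr_ile1 ?exprn_ge0 ?exprn_ile1.
  - move=> w; rewrite indicE; have /andP[h0 h1] := hK w.
    have [t0|t0] := boolP (0 < theta K w); last first.
      rewrite memNset; last by move=> [/(negP t0)].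
      by rewrite /D (negbTE t0); under eq_fun do rewrite mul0r; exact: cvg_cst.
    have [e1|n1] := eqVneq (h 0%N (theta K w)) 1.
      rewrite mem_set//; under eq_fun do rewrite /D t0 e1 expr1n mulr1.
      exact: cvg_cst.
    rewrite memNset; last by move=> [_ /eqP]; exact: (negP n1).
    under eq_fun do rewrite /D t0 mul1r.
    by apply: cvg_expr; rewrite ger0_norm// lt_neqAle n1.
have mL : measurable L.
  rewrite (_ : L = theta K @^-1` invisible)//.
  by rewrite -[X in measurable X]setTI; apply: mtheta => //; exact: measurable_invisible.
have L0 : Ex P \1_L = 0.
  by rewrite Ex_indic// (_ : P L = 0%E)//; exact: invisible_null.
rewrite L0 in cL.
exists (\bigcap_N E N); split.
- by apply: bigcap_measurable => // N _; exact: mE.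
- have mI : measurable (\bigcap_N E N) by apply: bigcap_measurable => // N _; exact: mE.
  apply/eqP; rewrite eq_le measure_ge0 andbT.
  have Pf : P (\bigcap_N E N) \is a fin_num by exact: fin_num_measure.
  rewrite -(fineK Pf) lee_fin.
  have c0 : (fun=> fine (P (\bigcap_N E N))) @ \oo --> fine (P (\bigcap_N E N)) by exact: cvg_cst.
  apply: (ler_cvg_to c0 cL); apply: nearW => N /=; rewrite -PE.
  apply: fine_le => //; first exact: fin_num_measure.
  by apply: le_measure; rewrite ?inE//; exact: bigcap_inf.
- move=> w [t0 xn] N _; apply/andP; split=> //; apply/forallP => n; exact/eqP/xn.
Qed.

Lemma ext_prob_fst (E : set T) : measurable E -> P' (@fst T fresh_space @^-1` E) = P E.
Proof.
move=> mE; rewrite (_ : _ @^-1` _ = E `*` setT); last first.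
  by apply/seteqP; split=> w //= [].
transitivity (P E * fresh_prob setT)%E; first exact: product_measure1E.
rewrite (_ : fresh_prob setT = 1%E) ?mule1//; exact: probability_setT.
Qed.

Lemma atomic_measure_ae :
  nu invisible = 0%E ->
  {ae P', forall w, forall A : set Psi, (atomic_measure (theta ^~ w.1) (psi ^~ w.1) A =
   \sum_(k < K0) (theta k w.1)%:E * \d_(psi k w.1) A +
   \sum_(m <oo) \sum_(y <oo) \sum_(j < rho (m, y) w)
     (weight (m, y, nat_of_ord j) w)%:E * \d_(location (m, y, nat_of_ord j) w) A)%E}.
Proof.
move=> W0.
have negl (E : set T) : P.-negligible E -> P'.-negligible (@fst T fresh_space @^-1` E).
  move=> [N [mN N0 EN]]; exists (fst @^-1` N); split.
  - by rewrite -[X in measurable X]setTI; exact: measurable_fst.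
  - by rewrite ext_prob_fst.
  - by move=> w; exact: EN.
have A1 : P'.-negligible (\bigcup_k (@fst T fresh_space @^-1`
    [set w | 0 < theta (K0 + k)%N w /\ forall n, x n (K0 + k)%N w = 0%N])).
  by apply: negligible_bigcup => k; apply: negl; exact: unseen_null.
have A2 : P'.-negligible (\bigcup_n [set w : Omega' | ~~ finite_count (in_class (odflt (0, 0)%N (unpickle n)) ^~ w.1)]).
  apply: negligible_bigcup => n; set c := odflt _ _.
  have mf : measurable (rho_finite c) by exact: measurable_rho_finite.
  exists (~` rho_finite c); split.
  - exact: measurableC.
  - transitivity (1 - P' (rho_finite c))%E; first exact: probability_setC.
    by rewrite prob_rho_finite subee.
  - by move=> w /negP.
apply: (negligibleS _ (negligibleU A1 A2)) => w /= nrep.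
apply: contrapT => /not_orP[n1 n2]; apply: nrep => A; apply: atomic_measure_split.
  move=> c; apply: contrapT => nc; apply: n2; exists (pickle c) => //=.
  by rewrite pickleK/=; apply/negP.
move=> k t0; apply: in_class_exists; apply: contrapT => nex; apply: n1; exists k => //=; split=> // n.
by apply/eqP/negPn/negP => xn; apply: nex; exists n.
Qed.

End extension.

(** * The representation *)

Lemma splice_fix (A : Type) (K : nat) (f : 'I_K -> A) (g : nat -> A) (k : 'I_K) :
  splice f g k = f k.
Proof. by rewrite /splice valK. Qed.

Lemma splice_ord (A : Type) (K : nat) (f : 'I_K -> A) (g : nat -> A) k :
  splice f g (K + k)%N = g k.
Proof. by rewrite /splice insubN ?addKn// -leqNgt leq_addr. Qed.

Lemma splice_all (A : Type) (K : nat) (f : 'I_K -> A) (g : nat -> A) (Q : A -> Prop) :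
  (forall k, Q (f k)) -> (forall k, Q (g k)) -> forall k, Q (splice f g k).
Proof. by move=> Qf Qg k; rewrite /splice; case: insubP. Qed.

Theorem theorem5p1 (R : realType)
  (dPsi : measure_display) (Psi : measurableType dPsi)
  (hPsi : forall a : Psi, measurable [set a])
  (dOmega : measure_display) (Omega : measurableType dOmega)
  (P : probability Omega R)
  (nu : {sigma_finite_measure set (measurableTypeR R) -> \bar R})
  (hnu_neg : nu (`]-oo, 0%R[%classic : set R) = 0)
  (hnu_oo : nu (`[0%R, +oo[%classic : set R) = +oo)
  (G : probability Psi R)
  (hG : forall a : Psi, G [set a] = 0)
  (Kfix : nat)
  (theta_fix : 'I_Kfix -> {mfun Omega >-> R})
  (htheta_fix : forall k w, (0 <= theta_fix k w)%R)
  (psi_fix : 'I_Kfix -> Psi)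
  (hpsi_fix : injective psi_fix)
  (theta_ord : nat -> {mfun Omega >-> R})
  (htheta_ord : forall k w, (0 <= theta_ord k w)%R)
  (psi_ord : nat -> {mfun Omega >-> Psi})
  (hord : poisson_point_process P (nu \x G) (ordinary_points theta_ord psi_ord))
  (hindep : independent_components P theta_fix
              (ordinary_points theta_ord psi_ord))
  (theta : nat -> Omega -> R)
  (htheta : theta = splice (T := Omega -> R) theta_fix theta_ord)
  (psi : nat -> Omega -> Psi)
  (hpsi : psi = splice (T := Omega -> Psi) (fun k => cst (psi_fix k)) psi_ord)
  (Theta : Omega -> set Psi -> \bar R)
  (hTheta : forall w A, measurable A ->
     Theta w A = atomic_measure (theta ^~ w) (psi ^~ w) A)
  (h : nat -> R -> R)
  (hh : pmf_family h)
  (* every ordinary atom of positive weight is eventually seen by the X_n *)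
  (hvisible : nu [set t : R | (0 < t)%R /\ h 0%N t = 1%R] = 0)
  (x : nat -> nat -> {mfun Omega >-> nat})
  (hx : conditionally_independent_counts P h theta psi x)
  (X : nat -> Omega -> set Psi -> \bar R)
  (hX : forall n w A, measurable A ->
     X n w A = atomic_measure (fun k => (x n k w)%:R%R) (psi ^~ w) A)
  (hfin : \sum_(1 <= y <oo) \int[nu]_(t in `[0%R, +oo[) (h y t)%:E < +oo) :
  (* an extension pi : Omega' -> Omega of the probability space *)
  exists (d' : measure_display) (Omega' : measurableType d')
    (P' : probability Omega' R) (pi : {mfun Omega' >-> Omega}),
    (forall E, measurable E -> P' (pi @^-1` E) = P E) /\
  (* indices (m, x, j) start at 0 and stand for (m + 1, x + 1, j + 1) *)
  exists (psis : nat * nat * nat -> {mfun Omega' >-> Psi})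
    (rho : nat * nat -> {mfun Omega' >-> nat})
    (thetas : nat * nat * nat -> {mfun Omega' >-> R}),
  [/\ {ae P', forall w, forall A, measurable A ->
        Theta (pi w) A =
          \sum_(k < Kfix) (theta_fix k (pi w))%:E * \d_(psi_fix k) A +
          \sum_(m <oo) \sum_(y <oo) \sum_(j < rho (m, y) w)
            (thetas (m, y, nat_of_ord j) w)%:E *
              \d_(psis (m, y, nat_of_ord j) w) A},
      (forall i B, measurable B -> distribution P' (psis i) B = G B) /\
      independent_rvs P' psis,
      (forall m y U, distribution P' (rho (m, y)) U =
         poisson_law (fine (size_measure nu h m.+1 y.+1 setT)) U) /\
      independent_rvs P' rho,
      [/\ (forall i w, (0 <= thetas i w)%R),
          (forall m y j B, measurable B -> size_measure nu h m.+1 y.+1 setT != 0 ->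
            distribution P' (thetas (m, y, j)) B = F_size nu h m.+1 y.+1 B)
        & independent_rvs P' thetas]
    & independent3 P' (sigma_gen setT psis) (sigma_gen setT rho)
        (sigma_gen setT thetas)].

Proof.
have theta0 k w : (0 <= theta k w)%R.
  by rewrite htheta; apply: (splice_all (Q := fun f : Omega -> R => (0 <= f w)%R)).
have mtheta k : measurable_fun setT (theta k).
  by rewrite htheta; apply: (splice_all (Q := fun f : Omega -> R => measurable_fun setT f)).
have mpsi k : measurable_fun setT (psi k).
  rewrite hpsi; apply: (splice_all (Q := fun f : Omega -> Psi => measurable_fun setT f)) => i; last exact: measurable_funPT.
  exact: measurable_cst.
have zoE k w : ord_point theta psi Kfix k w = (theta_ord k w, psi_ord k w).
  by rewrite /ord_point htheta hpsi !splice_ord.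
have ppp : poisson_point_process P (nu \x G)
    (fun w B => \sum_(k <oo) \d_(ord_point theta psi Kfix k w) B).
  rewrite (_ : (fun w B => _) = ordinary_points theta_ord psi_ord)//.
  by apply/funext => w; apply/funext => B; apply: eq_eseriesr => k _; rewrite zoE.
have size_fin := @size_law_fin _ _ nu hh hfin.
exists _, (Omega * fresh_space R Psi)%type, (ext_prob P hh nu G).
pose pi : {mfun (Omega * fresh_space R Psi)%type >-> Omega} := mfun_Sub (mem_set measurable_fst).
exists pi; split; first by move=> E mE; exact: ext_prob_fst.
pose psis p : {mfun (Omega * fresh_space R Psi)%type >-> Psi} :=
  mfun_Sub (mem_set (measurable_location x Kfix mtheta mpsi p)).
pose thetas p : {mfun (Omega * fresh_space R Psi)%type >-> R} :=
  mfun_Sub (mem_set (measurable_weight x Kfix mtheta mpsi p)).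
pose rhos c : {mfun (Omega * fresh_space R Psi)%type >-> nat} :=
  mfun_Sub (mem_set (@measurable_rho _ _ R _ Psi x Kfix c)).
exists psis, rhos, thetas; split.
- have rep_ae := atomic_measure_ae theta0 mtheta mpsi hx ppp size_fin hvisible.
  apply: filterS rep_ae => w rep A mA; rewrite hTheta// rep; congr (_ + _).
  by apply: eq_bigr => k _; rewrite htheta hpsi !splice_fix.
- split; last exact: (location_independent theta0 mtheta mpsi hx ppp size_fin).
  by move=> i B mB; exact: (location_law theta0 mtheta mpsi hx ppp size_fin).
- split; last exact: (rho_independent theta0 mtheta mpsi hx ppp size_fin).
  move=> m y U; transitivity (poisson_law (size_rate nu hh (m, y)) U).
    exact: (rho_law theta0 mtheta mpsi hx ppp size_fin).
  by rewrite /size_rate size_lawE.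
- split; last exact: (weight_independent theta0 mtheta mpsi hx ppp size_fin).
    by move=> i w; exact: normr_ge0.
  move=> m y j B mB c0.
  transitivity (size_prob nu hh (m, y) ((Num.norm : R -> R) @^-1` B)).
    exact: (weight_law theta0 mtheta mpsi hx ppp size_fin).
  by rewrite (size_prob_norm size_fin)// size_lawE.
- exact: (families_independent theta0 mtheta mpsi hx ppp size_fin).
Qed.
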